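(* Assume (A1)–(A6). Then there exists $\lambda^*>0$ such that problem $(P_{\lambda^*})$ possesses a singular solution $u^*_{\lambda^*}$ satisfying, as $r\to 0^+$, $$u^*_{\lambda^*}(r)=g(Z(r))+O\big(g''(\ln r^{-\theta})\big),$$ where $$Z(r)=\ln\{\theta^{\beta+1}(\alpha-\beta-1)\}-\ln\lambda^*-\theta\ln r+(\beta+1)\ln\big\{g'(\tau)+(\beta+1)g''(\tau)\ln g'(\tau)\big\},\qquad \tau=\ln\Big\{\frac{\beta+1}{\lambda^* r^{\theta}}\Big\}.$$
   Context: Let $\alpha,\beta,\gamma\in\mathbb R$ and define the radial operator $L(u)(r)=r^{-\gamma}\big(r^{\alpha}|u'(r)|^{\beta}u'(r)\big)'$, and $\theta=\gamma+2+\beta-\alpha$. Let $f$ be given and $g=f^{-1}$ its inverse. For a function $x(t)$, ''$x(t)=O(g''(t))$'' means $|x(t)|\le C|g''(t)|$ for some $C$ and all large $t$; $o(t)$ denotes any function $h$ with $h(t)/t\to0$. Assumptions: (A1) $f\in C^4([0,\infty))$, $f'>0$, $f(u)\to+\infty$ as $u\to+\infty$. (A2) $g''(t)\to0$ as $t\to+\infty$, and $\lim_{t\to+\infty} f(g(t)+\varepsilon(t))/t=1$ for every function $\varepsilon(t)=O(g''(t))$. (A3) $\lim_{t\to+\infty} g'(t)/g'(t+h(t))=1$ for every $h(t)=o(t)$. (A4) $\lim_{t\to+\infty}\frac{g''(t)}{g'(t)}\ln g'(t)=0$. (A5) (a) $g'''(t)(\ln g'(t))^n=O(g''(t))$ for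 $n=0,1,2$, and $g^{(4)}(t)\ln g'(t)=O(g''(t))$; (b) $\sup_{s\ge t}|g''(s)|=O(g''(t))$ and $g''(t+h(t))=O(g''(t))$ for every $h(t)=o(t)$. (A6) $\alpha>\beta+1$, $\beta\ge0$, $\theta>0$. Problem $(P_\lambda)$, $\lambda>0$: $L(u)+\lambda e^{f(u)}=0$ for $0\le r<1$, $u>0$ on $[0,1)$, $u(1)=0$. A singular solution of $(P_\lambda)$ is a function $u\in C^2((0,1])$ satisfying $L(u)+\lambda e^{f(u)}=0$ and $u>0$ on $(0,1)$, $u(1)=0$, and $u(r)\to+\infty$ as $r\to0^+$. *)

(* Defs.v *)
From Stdlib Require Import Reals.
From Coquelicot Require Import Coquelicot.
Open Scope R_scope.

Definition abs_pow (x b : R) : R :=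
  if Req_EM_T x 0 then (if Req_EM_T b 0 then 1 else 0) else Rpower (Rabs x) b.

Definition Ck_on_Ico0_infty (k : nat) (f : R -> R) : Prop :=
  (forall x, 0 < x ->
     (forall j, (j <= k)%nat -> ex_derive_n f j x) /\ continuous (Derive_n f k) x) /\
  filterlim f (at_right 0) (locally (f 0)) /\
  (forall j, (j <= k)%nat -> exists l : R, filterlim (Derive_n f j) (at_right 0) (locally l)).

Definition Ck_on_Ioc (k : nat) (a b : R) (u : R -> R) : Prop :=
  (forall r, a < r < b ->
     (forall j, (j <= k)%nat -> ex_derive_n u j r) /\ continuous (Derive_n u k) r) /\
  filterlim u (at_left b) (locally (u b)) /\
  (forall j, (j <= k)%nat -> exists l : R, filterlim (Derive_n u j) (at_left b) (locally l)).

Definition flux (alpha beta : R) (u : R -> R) (r : R) : R :=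
  Rpower r alpha * abs_pow (Derive u r) beta * Derive u r.

Definition Lop (alpha beta gamma : R) (u : R -> R) (r : R) : R :=
  Rpower r (- gamma) * Derive (flux alpha beta u) r.

Definition singular_solution (alpha beta gamma lambda : R) (f u : R -> R) : Prop :=
  Ck_on_Ioc 2 0 1 u /\
  (forall r, 0 < r < 1 ->
     ex_derive (flux alpha beta u) r /\
     Lop alpha beta gamma u r + lambda * exp (f (u r)) = 0) /\
  (forall r, 0 < r < 1 -> 0 < u r) /\
  u 1 = 0 /\
  filterlim u (at_right 0) (Rbar_locally p_infty).

Definition bigO_infty (x y : R -> R) : Prop :=
  exists C T : R, forall t, T <= t -> Rabs (x t) <= C * Rabs (y t).

Definition little_o_id (h : R -> R) : Prop :=
  is_lim (fun t => h t / t) p_infty 0.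

(* Main.v *)
(* Put m = beta + 1, a = (alpha - m) / theta, t = - theta ln r + const and u(r) = y(t). The equation
   becomes a y'^m - (y'^m)' = a e^(f(y) - t). In terms of x = f(y), z = ln (y' / g'(x)) and
   v = x - t - m ln g'(x) - m z it is the perturbed linear system
     v' = (e^z - 1) + a (e^v - 1),   z' = - (a/m) (e^v - 1) - (g''/g')(x) e^z,
   whose linear part has both eigenvalues in the right half-plane. Hence it has a solution that stays
   bounded as t tends to infinity, and an energy estimate bounds it by its forcing, which gives
   v, z = O(g''/g'). Thus x = t + m ln g'(x) + O(g''/g'), and the stated expansion of u = g(x) follows
   by expanding g'(x) to second order around tau. Continued in r, this solution decreases to 0 at
   some rs, and the dilation r -> rs r turns it into a singular solution for lambda = rs^theta. *)

Require Import Defs.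
From Stdlib Require Import Reals Lra Lia ClassicalEpsilon Ranalysis5.
From Coquelicot Require Import Coquelicot.
Open Scope R_scope.

(** Because the linear part is expanding, generic solutions run away; the wanted one is selected by
    its behaviour at infinity, and its bound at time t involves the forcing at all later times. The
    forcing g''/g' need not be monotone, so the energy estimate tolerates a forcing that grows like
    e^(c(s-t)/4) after t; this absorbs the slow variation of g'. The forcing also depends on the
    unknown through x. As k(x) = x - m ln g'(x) is increasing for large x and k(x) = t + v + m z, it
    is a small Lipschitz function of t + v + m z, which closes the system in (v, z). An error
    O(g''/g') in x is exactly what the claim needs: g multiplies it by its slope, about g', and
    makes it O(g''). The radius where the solution reaches 0 is not known in advance, so lambda
    comes out of the construction instead of being prescribed; its logarithm only shifts t by a
    constant, and the assumptions on g' and g'' tolerate every shift o(t). *)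

(** * Mean value inequalities *)

Lemma exp_le_compat (x y : R) : x <= y -> exp x <= exp y.
Proof. intros [h | ->]; [left; apply exp_increasing, h | right; reflexivity]. Qed.

Lemma derive_nonneg_incr (f df : R -> R) (a b : R) :
  a <= b -> (forall x, a <= x <= b -> is_derive f x (df x)) ->
  (forall x, a <= x <= b -> 0 <= df x) -> f a <= f b.
Proof.
  intros Hab Hd Hp.
  destruct (MVT_gen f a b df) as [c [Hc E]].
  - intros x Hx. rewrite Rmin_left, Rmax_right in Hx by lra. apply Hd; lra.
  - intros x Hx. rewrite Rmin_left, Rmax_right in Hx by lra.
    apply continuity_pt_filterlim. apply (ex_derive_continuous f x).
    exists (df x). apply Hd; lra.
  - rewrite Rmin_left, Rmax_right in Hc by lra.
    assert (0 <= df c) by (apply Hp; lra). nra.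
Qed.

Lemma lipschitz_of_derive (f df : R -> R) (a b L : R) :
  (forall x, Rmin a b <= x <= Rmax a b -> is_derive f x (df x)) ->
  (forall x, Rmin a b <= x <= Rmax a b -> Rabs (df x) <= L) ->
  Rabs (f b - f a) <= L * Rabs (b - a).
Proof.
  intros Hd Hp.
  destruct (MVT_gen f a b df) as [c [Hc E]].
  - intros x Hx. apply Hd; lra.
  - intros x Hx. apply continuity_pt_filterlim. apply (ex_derive_continuous f x).
    exists (df x). apply Hd; lra.
  - rewrite E, Rabs_mult. apply Rmult_le_compat_r; [apply Rabs_pos | apply Hp; lra].
Qed.

(** * Picard iteration and continuous dependence for globally Lipschitz systems *)

(** Banach's theorem for the norm sup |u i| / w i, stated pointwise so that no element has to have
    finite norm: only the first step [Phi u0 - u0] does. The last premise says that [S] is closed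
    for this norm. *)
Lemma contraction_fixed_point (I : Type) (w : I -> R) (S : (I -> R) -> Prop)
  (Phi : (I -> R) -> I -> R) (k M0 : R) (u0 : I -> R) :
  0 <= k < 1 -> (forall i, 0 <= w i) ->
  S u0 -> (forall u, S u -> S (Phi u)) ->
  (forall u v M, S u -> S v -> (forall i, Rabs (u i - v i) <= M * w i) ->
     forall i, Rabs (Phi u i - Phi v i) <= k * M * w i) ->
  (forall i, Rabs (Phi u0 i - u0 i) <= M0 * w i) ->
  (forall (un : nat -> I -> R) u (e : nat -> R), (forall n, S (un n)) -> is_lim_seq e 0 ->
     (forall n i, Rabs (un n i - u i) <= e n * w i) -> S u) ->
  exists u, S u /\ forall i, Phi u i = u i.
Proof.
  intros Hk Hw HS0 HSP Hc HM Hcl.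
  set (un := fun n => Nat.iter n Phi u0).
  assert (HS : forall n, S (un n)).
  { induction n; simpl; auto. }
  assert (Hstep : forall n i, Rabs (un (Datatypes.S n) i - un n i) <= k ^ n * M0 * w i).
  { induction n; intros i.
    - simpl. rewrite Rmult_1_l. apply HM.
    - replace (k ^ Datatypes.S n * M0) with (k * (k ^ n * M0)) by (simpl; ring).
      apply (Hc (un (Datatypes.S n)) (un n)); auto. }
  assert (Hk' : forall n, 0 <= k ^ n) by (intros; apply pow_le; lra).
  assert (HMw : forall i, 0 <= M0 * w i).
  { intros i. eapply Rle_trans; [apply Rabs_pos | apply (HM i)]. }
  assert (Hgeo : forall n p i,
    Rabs (un (n + p)%nat i - un n i) <= k ^ n * (1 - k ^ p) * / (1 - k) * (M0 * w i)).
  { intros n p i. induction p.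
    - rewrite Nat.add_0_r, Rminus_diag, Rabs_R0. simpl. lra.
    - rewrite Nat.add_succ_r.
      replace (un (Datatypes.S (n + p)) i - un n i)
        with ((un (Datatypes.S (n + p)) i - un (n + p)%nat i) + (un (n + p)%nat i - un n i)) by ring.
      eapply Rle_trans; [apply Rabs_triang |].
      eapply Rle_trans; [apply Rplus_le_compat; [apply Hstep | apply IHp] |].
      rewrite pow_add. apply Req_le. simpl. field. lra. }
  assert (Hgeo' : forall n p i, (n <= p)%nat ->
    Rabs (un p i - un n i) <= k ^ n * / (1 - k) * (M0 * w i)).
  { intros n p i Hnp. replace p with (n + (p - n))%nat by lia.
    eapply Rle_trans; [apply Hgeo |].
    apply Rmult_le_compat_r; [apply HMw |].
    apply Rmult_le_compat_r; [left; apply Rinv_0_lt_compat; lra |].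
    assert (B1 := Hk' (p - n)%nat). assert (B2 := Hk' n). nra. }
  assert (Hklim : is_lim_seq (fun n => k ^ n) 0).
  { apply is_lim_seq_geom. rewrite Rabs_pos_eq; lra. }
  assert (Hlim0 : forall i, is_lim_seq (fun n => k ^ n * (/ (1 - k) * (M0 * w i))) 0).
  { intros i. replace (Finite 0) with (Rbar_mult 0 (/ (1 - k) * (M0 * w i)))
      by (simpl; f_equal; ring).
    apply is_lim_seq_scal_r, Hklim. }
  assert (Hcv : forall i, ex_finite_lim_seq (fun n => un n i)).
  { intros i. apply ex_lim_seq_cauchy_corr. intros eps.
    destruct (proj1 (is_lim_seq_Reals _ _) (Hlim0 i) (eps / 2)) as [N HN].
    { destruct eps; simpl; lra. }
    exists N. intros n p Hn Hp.
    specialize (HN N (le_n _)). unfold Rdist in HN. rewrite Rminus_0_r in HN.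
    apply Rabs_def2 in HN.
    assert (A1 := Hgeo' N n i Hn). assert (A2 := Hgeo' N p i Hp).
    rewrite Rmult_assoc in A1, A2.
    replace (un n i - un p i) with ((un n i - un N i) - (un p i - un N i)) by ring.
    eapply Rle_lt_trans; [apply Rabs_triang |]. rewrite Rabs_Ropp. lra. }
  set (u := fun i => real (Lim_seq (fun n => un n i))).
  assert (Hu : forall i, is_lim_seq (fun n => un n i) (u i)).
  { intros i. apply Lim_seq_correct', Hcv. }
  assert (Hun : forall n i, Rabs (un n i - u i) <= k ^ n * / (1 - k) * M0 * w i).
  { intros n i.
    apply (is_lim_seq_le_loc (fun p => Rabs (un n i - un p i)) (fun _ => k ^ n * / (1 - k) * M0 * w i)
             (Rabs (un n i - u i)) (k ^ n * / (1 - k) * M0 * w i)).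
    - exists n. intros p Hp. rewrite Rabs_minus_sym.
      eapply Rle_trans; [apply Hgeo'; auto |]. lra.
    - apply (is_lim_seq_abs _ (un n i - u i)).
      apply is_lim_seq_minus'; [apply is_lim_seq_const | apply Hu].
    - apply is_lim_seq_const. }
  assert (HSu : S u).
  { apply (Hcl un u (fun n => k ^ n * / (1 - k) * M0)); auto.
    replace (Finite 0) with (Rbar_mult 0 (/ (1 - k) * M0)) by (simpl; f_equal; ring).
    apply (is_lim_seq_ext (fun n => k ^ n * (/ (1 - k) * M0))); [intros; ring |].
    apply is_lim_seq_scal_r, Hklim. }
  exists u. split; [exact HSu |]. intros i.
  assert (H1 : is_lim_seq (fun n => un (Datatypes.S n) i) (Phi u i)).
  { apply is_lim_seq_Reals. intros eps Heps.
    destruct (proj1 (is_lim_seq_Reals _ _) (Hlim0 i) eps Heps) as [N HN].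
    exists N. intros n Hn. specialize (HN n Hn). unfold Rdist in *. rewrite Rminus_0_r in HN.
    apply Rabs_def2 in HN.
    eapply Rle_lt_trans; [apply (Hc (un n) u (k ^ n * / (1 - k) * M0)); auto |].
    assert (0 <= k ^ n * (/ (1 - k) * (M0 * w i))).
    { apply Rmult_le_pos; [auto |]. apply Rmult_le_pos; [| auto].
      left; apply Rinv_0_lt_compat; lra. }
    nra. }
  assert (H2 := proj1 (is_lim_seq_incr_1 (fun n => un n i) (u i)) (Hu i)).
  apply is_lim_seq_unique in H1. apply is_lim_seq_unique in H2.
  rewrite H1 in H2. injection H2; auto.
Qed.

(* [auto_derive] states its side conditions with eta-expanded functions. *)
Ltac subst_derive H :=
  match type of H with
  | is_derive ?f ?x ?l =>
      replace (Derive (fun s : R => f s) x) with l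
        by (symmetry; apply is_derive_unique; exact H)
  end.

(** Integrating the weight exp(L|t - t0|) gains a factor 1/L, which is what makes the Picard map
    contract for large [L]. The half-line before [t0] is reduced to the other one by reflection
    about [t0]. *)
Lemma exp_primitive_bound (D dD : R -> R) (t0 A L : R) :
  0 < L -> 0 <= A -> (forall t, is_derive D t (dD t)) -> D t0 = 0 ->
  (forall t, Rabs (dD t) <= A * exp (L * Rabs (t - t0))) ->
  forall t, Rabs (D t) <= A / L * exp (L * Rabs (t - t0)).
Proof.
  intros HL HA.
  assert (fwd : forall D dD : R -> R, (forall t, is_derive D t (dD t)) -> D t0 = 0 ->
    (forall t, Rabs (dD t) <= A * exp (L * Rabs (t - t0))) ->
    forall t, t0 <= t -> D t <= A / L * exp (L * Rabs (t - t0))).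
  { intros E dE HE E0 HB t Ht. rewrite (Rabs_pos_eq (t - t0)) by lra.
    assert (H : A / L * exp (L * (t0 - t0)) - E t0 <= A / L * exp (L * (t - t0)) - E t).
    { apply (derive_nonneg_incr (fun s => A / L * exp (L * (s - t0)) - E s)
               (fun s => A * exp (L * (s - t0)) - dE s)); [lra | |].
      - intros x _. auto_derive; [exists (dE x); apply HE |].
        subst_derive (HE x). unfold Rminus. field. lra.
      - intros x Hx. specialize (HB x). rewrite (Rabs_pos_eq (x - t0)) in HB by lra.
        apply Rabs_le_between in HB. lra. }
    rewrite E0, Rminus_diag, Rmult_0_r, exp_0 in H.
    assert (0 <= A / L) by (apply Rdiv_le_0_compat; lra). lra. }
  assert (fwd2 : forall D dD : R -> R, (forall t, is_derive D t (dD t)) -> D t0 = 0 ->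
    (forall t, Rabs (dD t) <= A * exp (L * Rabs (t - t0))) ->
    forall t, t0 <= t -> Rabs (D t) <= A / L * exp (L * Rabs (t - t0))).
  { intros E dE HE E0 HB t Ht. apply Rabs_le. split.
    - assert (H := fwd (fun s => - E s) (fun s => - dE s)). cbv beta in H.
      enough (- E t <= A / L * exp (L * Rabs (t - t0))) by lra.
      apply H; auto.
      + intros s. apply (is_derive_opp E s (dE s)), HE.
      + lra.
      + intros s. rewrite Rabs_Ropp. apply HB.
    - apply (fwd E dE); auto. }
  intros HD D0 HB t.
  destruct (Rle_lt_dec t0 t) as [Ht | Ht]; [apply (fwd2 D dD); auto |].
  assert (H := fwd2 (fun s => D (2 * t0 - s)) (fun s => - dD (2 * t0 - s))).
  cbv beta in H.
  replace t with (2 * t0 - (2 * t0 - t)) at 1 by ring.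
  replace (Rabs (t - t0)) with (Rabs (2 * t0 - t - t0))
    by (rewrite <- Rabs_Ropp; f_equal; ring).
  apply H; [| replace (2 * t0 - t0) with t0 by ring; auto | | lra].
  - intros s. auto_derive; [exists (dD (2 * t0 - s)); apply HD |].
    change (2 * t0 + - s) with (2 * t0 - s). subst_derive (HD (2 * t0 - s)). ring.
  - intros s. rewrite Rabs_Ropp. eapply Rle_trans; [apply HB |].
    apply Req_le. do 3 f_equal. rewrite <- Rabs_Ropp. f_equal. ring.
Qed.

Lemma continuous_eps (f : R -> R) (x : R) :
  continuous f x <->
  forall eps, 0 < eps -> exists d, 0 < d /\ forall y, Rabs (y - x) < d -> Rabs (f y - f x) < eps.
Proof.
  split.
  - intros H eps Heps.
    destruct (proj1 (filterlim_locally f (f x)) H (mkposreal eps Heps)) as [d Hd].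
    exists d. split; [apply cond_pos | exact Hd].
  - intros H. apply filterlim_locally. intros eps.
    destruct (H eps (cond_pos eps)) as [d [Hd Hy]].
    exists (mkposreal d Hd). exact Hy.
Qed.

Lemma continuous_lipschitz_comp (F : R -> R -> R -> R) (K : R) (y z : R -> R) :
  (forall t y z y' z', Rabs (F t y z - F t y' z') <= K * (Rabs (y - y') + Rabs (z - z'))) ->
  (forall y z t, continuous (fun t => F t y z) t) ->
  (forall t, continuous y t) -> (forall t, continuous z t) ->
  forall t, continuous (fun t => F t (y t) (z t)) t.
Proof.
  intros HF HFt Hy Hz t. apply continuous_eps. intros eps Heps.
  destruct (proj1 (continuous_eps _ _) (HFt (y t) (z t) t) (eps / 2)) as [d1 [Hd1 H1]]; [lra |].
  set (e := eps / (4 * (Rabs K + 1))).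
  assert (HK := Rabs_pos K).
  assert (He : 0 < e) by (apply Rdiv_lt_0_compat; lra).
  destruct (proj1 (continuous_eps _ _) (Hy t) e He) as [d2 [Hd2 H2]].
  destruct (proj1 (continuous_eps _ _) (Hz t) e He) as [d3 [Hd3 H3]].
  exists (Rmin d1 (Rmin d2 d3)). split; [repeat apply Rmin_glb_lt; auto |].
  intros s Hs.
  assert (S1 := Rlt_le_trans _ _ _ Hs (Rmin_l _ _)).
  assert (S' := Rlt_le_trans _ _ _ Hs (Rmin_r _ _)).
  assert (S2 := Rlt_le_trans _ _ _ S' (Rmin_l _ _)).
  assert (S3 := Rlt_le_trans _ _ _ S' (Rmin_r _ _)).
  specialize (H1 s S1). specialize (H2 s S2). specialize (H3 s S3).
  replace (F s (y s) (z s) - F t (y t) (z t)) with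
    ((F s (y s) (z s) - F s (y t) (z t)) + (F s (y t) (z t) - F t (y t) (z t))) by ring.
  eapply Rle_lt_trans; [apply Rabs_triang |].
  assert (H4 := HF s (y s) (z s) (y t) (z t)).
  assert (K * (Rabs (y s - y t) + Rabs (z s - z t)) <= Rabs K * (e + e)).
  { assert (A1 := Rabs_pos (y s - y t)). assert (A2 := Rabs_pos (z s - z t)).
    assert (A3 := Rle_abs K). nra. }
  assert (Rabs K * (e + e) <= eps / 2).
  { assert (E : (Rabs K + 1) * (e + e) = eps / 2) by (unfold e; field; lra). nra. }
  lra.
Qed.

(** Picard iteration on the whole line at once, in the norm weighted by exp(L|t - t0|): two
    components cost 2|K| <= L/2 and the integration gains 1/L, so the contraction factor is 1/2. The
    pair is one function on [bool * R], with [true] for [y] and [false] for [z]. The bound [M] along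
    the constant initial guess makes the first Picard step finite in this norm. *)
Lemma ode_global_solution (F : bool -> R -> R -> R -> R) (K M t0 y0 z0 : R) :
  (forall b t y z y' z', Rabs (F b t y z - F b t y' z') <= K * (Rabs (y - y') + Rabs (z - z'))) ->
  (forall b y z t, continuous (fun t => F b t y z) t) ->
  (forall b t, Rabs (F b t y0 z0) <= M) ->
  exists y z : R -> R, y t0 = y0 /\ z t0 = z0 /\
    forall t, is_derive y t (F true t (y t) (z t)) /\ is_derive z t (F false t (y t) (z t)).
Proof.
  intros HF HFt HM.
  set (L := 4 * (Rabs K + 1)).
  assert (HK := Rabs_pos K). assert (HK1 := Rle_abs K).
  assert (HL : 0 < L) by (unfold L; lra).
  assert (HM0 : 0 <= M) by (eapply Rle_trans; [apply Rabs_pos | apply (HM true 0)]).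
  set (init := fun b : bool => if b then y0 else z0).
  set (w := fun i : bool * R => exp (L * Rabs (snd i - t0))).
  set (S := fun u : bool * R -> R => forall b (t : R), continuous (fun t : R => u (b, t)) t).
  set (rhs := fun (u : bool * R -> R) b s => F b s (u (true, s)) (u (false, s))).
  set (Phi := fun (u : bool * R -> R) (i : bool * R) =>
     init (fst i) + RInt (rhs u (fst i)) t0 (snd i)).
  assert (Hrhs : forall u b, S u -> forall t, continuous (rhs u b) t).
  { intros u b Hu. apply (continuous_lipschitz_comp (F b) K); auto. }
  assert (HdPhi : forall u b, S u -> forall t, is_derive (fun t => Phi u (b, t)) t (rhs u b t)).
  { intros u b Hu t. unfold Phi; simpl.
    replace (rhs u b t) with (0 + rhs u b t) by ring.
    apply (is_derive_plus (fun _ : R => init b) (RInt (rhs u b) t0)); [apply (is_derive_const (K := R_AbsRing) (V := R_NormedModule)) |].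
    apply is_derive_RInt with (a := t0).
    - apply filter_forall. intros s. apply (RInt_correct (V := R_CompleteNormedModule)).
      apply (ex_RInt_continuous (V := R_CompleteNormedModule)). intros; apply Hrhs; auto.
    - apply Hrhs; auto. }
  assert (HPhi0 : forall u b, Phi u (b, t0) = init b).
  { intros u b. unfold Phi; simpl. rewrite RInt_point. unfold zero; simpl. ring. }
  assert (Hw1 : forall i, 1 <= w i).
  { intros i. unfold w. rewrite <- exp_0.
    apply exp_le_compat, Rmult_le_pos; [lra | apply Rabs_pos]. }
  destruct (contraction_fixed_point (bool * R) w S Phi (1 / 2) (M / L) (fun i => init (fst i)))
    as [u [Su Hu]].
  - lra.
  - intros i. specialize (Hw1 i). lra.
  - intros b t. apply continuous_const.
  - intros u Hu b t. apply (ex_derive_continuous (fun t => Phi u (b, t))).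
    exists (rhs u b t). apply HdPhi; auto.
  - intros u v N Hu Hv HN [b t].
    assert (HN0 : 0 <= N).
    { specialize (HN (b, t)). specialize (Hw1 (b, t)).
      assert (A := Rabs_pos (u (b, t) - v (b, t))). nra. }
    replace (1 / 2 * N * w (b, t)) with (N * L / 2 / L * w (b, t)) by (field; lra).
    apply (exp_primitive_bound (fun t => Phi u (b, t) - Phi v (b, t))
             (fun t => rhs u b t - rhs v b t) t0 (N * L / 2) L); auto.
    + nra.
    + intros s. apply (is_derive_minus (fun t => Phi u (b, t)) (fun t => Phi v (b, t))); apply HdPhi; auto.
    + rewrite !HPhi0. ring.
    + intros s. unfold rhs. eapply Rle_trans; [apply HF |].
      assert (A1 := HN (true, s)). assert (A2 := HN (false, s)).
      unfold w in A1, A2; simpl in A1, A2.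
      set (E := exp (L * Rabs (s - t0))) in *.
      assert (A3 := Rabs_pos (u (true, s) - v (true, s))).
      assert (A4 := Rabs_pos (u (false, s) - v (false, s))).
      unfold L. nra.
  - intros [b t]. simpl.
    apply (exp_primitive_bound (fun t => Phi (fun i => init (fst i)) (b, t) - init b)
             (fun t => rhs (fun i => init (fst i)) b t) t0 M L); auto.
    + intros s. replace (rhs (fun i => init (fst i)) b s) with (rhs (fun i => init (fst i)) b s - 0) by ring.
      apply (is_derive_minus (fun t => Phi (fun i => init (fst i)) (b, t)) (fun _ => init b));
        [| apply (is_derive_const (K := R_AbsRing) (V := R_NormedModule))].
      apply HdPhi. intros b' t'. apply continuous_const.
    + rewrite HPhi0. ring.
    + intros s. specialize (Hw1 (b, s)). unfold w in Hw1; simpl in Hw1.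
      assert (A := HM b s). unfold rhs; simpl. nra.
  (* The weight is at most [W] near [t], so convergence in the weighted norm is locally uniform and
     preserves continuity. *)
  - intros un u e Hun He Hue b t. apply continuous_eps. intros eps Heps.
    assert (Hwc : continuous (fun t : R => w (b, t)) t).
    { unfold w; simpl. apply (continuous_comp (fun t => L * Rabs (t - t0)) exp).
      - apply (continuous_comp (fun t => Rabs (t - t0)) (fun x => L * x)).
        + apply (continuous_comp (fun t => t - t0) Rabs).
          * apply (continuous_minus (fun t : R => t) (fun _ => t0)); [apply continuous_id | apply continuous_const].
          * apply continuous_Rabs.
        + apply (continuous_scal_r L (fun x : R => x)). apply continuous_id.
      - apply continuous_exp. }
    destruct (proj1 (continuous_eps _ _) Hwc 1 Rlt_0_1) as [d1 [Hd1 H1]].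
    set (W := w (b, t) + 1).
    assert (HW : 0 < W) by (unfold W; specialize (Hw1 (b, t)); lra).
    destruct (proj1 (is_lim_seq_Reals _ _) He (eps / (4 * W))) as [n Hn].
    { apply Rdiv_lt_0_compat; lra. }
    specialize (Hn n (le_n _)). unfold Rdist in Hn. rewrite Rminus_0_r in Hn.
    apply Rabs_def2 in Hn.
    assert (Hb : forall s, Rabs (s - t) < d1 -> Rabs (un n (b, s) - u (b, s)) <= eps / 4).
    { intros s Hs. eapply Rle_trans; [apply Hue |].
      specialize (H1 s Hs). cbv beta in H1. apply Rabs_def2 in H1. specialize (Hw1 (b, s)).
      assert (E : eps / (4 * W) * W = eps / 4) by (field; lra).
      assert (w (b, s) <= W). { unfold W. lra. }
      assert (0 < eps / (4 * W)) by (apply Rdiv_lt_0_compat; lra). nra. }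
    destruct (proj1 (continuous_eps _ _) (Hun n b t) (eps / 4)) as [d2 [Hd2 H2]]; [lra |].
    exists (Rmin d1 d2). split; [apply Rmin_glb_lt; auto |].
    intros s Hs.
    assert (S1 := Rlt_le_trans _ _ _ Hs (Rmin_l _ _)).
    assert (S2 := Rlt_le_trans _ _ _ Hs (Rmin_r _ _)).
    specialize (H2 s S2). assert (B1 := Hb s S1).
    assert (B2 : Rabs (un n (b, t) - u (b, t)) <= eps / 4).
    { apply Hb. rewrite Rminus_diag, Rabs_R0. auto. }
    apply Rabs_le_between in B1. apply Rabs_le_between in B2. apply Rabs_def2 in H2.
    apply Rabs_def1; lra.
  - exists (fun t => u (true, t)), (fun t => u (false, t)).
    split; [rewrite <- Hu, HPhi0; reflexivity |].
    split; [rewrite <- Hu, HPhi0; reflexivity |].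
    intros t. split.
    + apply (is_derive_ext (fun t => Phi u (true, t))); [intros; apply Hu |]. apply HdPhi; auto.
    + apply (is_derive_ext (fun t => Phi u (false, t))); [intros; apply Hu |]. apply HdPhi; auto.
Qed.

(* Gronwall's inequality for the squared Euclidean distance. *)
Lemma ode_continuous_dependence (F : bool -> R -> R -> R -> R) (K t0 : R) (y z y' z' : R -> R) :
  (forall b t y z y' z', Rabs (F b t y z - F b t y' z') <= K * (Rabs (y - y') + Rabs (z - z'))) ->
  (forall t, is_derive y t (F true t (y t) (z t)) /\ is_derive z t (F false t (y t) (z t))) ->
  (forall t, is_derive y' t (F true t (y' t) (z' t)) /\ is_derive z' t (F false t (y' t) (z' t))) ->
  forall t, (y t - y' t) ^ 2 + (z t - z' t) ^ 2 <=
    ((y t0 - y' t0) ^ 2 + (z t0 - z' t0) ^ 2) * exp (4 * Rabs K * Rabs (t - t0)).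
Proof.
  intros HF H H'.
  assert (HK := Rabs_pos K). assert (HK1 := Rle_abs K).
  set (C := 4 * Rabs K).
  set (E := fun t => (y t - y' t) ^ 2 + (z t - z' t) ^ 2).
  set (dE := fun t => 2 * (y t - y' t) * (F true t (y t) (z t) - F true t (y' t) (z' t)) +
                      2 * (z t - z' t) * (F false t (y t) (z t) - F false t (y' t) (z' t))).
  assert (HE : forall t, is_derive E t (dE t)).
  { intros t. destruct (H t) as [H1 H2], (H' t) as [H3 H4]. unfold E, dE. auto_derive.
    - repeat split; eexists; eassumption.
    - subst_derive H1. subst_derive H2. subst_derive H3. subst_derive H4. ring. }
  assert (HB : forall t, Rabs (dE t) <= C * E t).
  { intros t. unfold dE, E, C.
    assert (B1 := HF true t (y t) (z t) (y' t) (z' t)).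
    assert (B2 := HF false t (y t) (z t) (y' t) (z' t)).
    set (p := y t - y' t) in *. set (q := z t - z' t) in *.
    set (n1 := F true t (y t) (z t) - F true t (y' t) (z' t)) in *.
    set (n2 := F false t (y t) (z t) - F false t (y' t) (z' t)) in *.
    eapply Rle_trans; [apply Rabs_triang |]. rewrite !Rabs_mult, (Rabs_pos_eq 2) by lra.
    rewrite <- (pow2_abs p), <- (pow2_abs q).
    assert (P1 := Rabs_pos p). assert (P2 := Rabs_pos q).
    set (ap := Rabs p) in *. set (aq := Rabs q) in *.
    assert (Rabs n1 <= Rabs K * (ap + aq)) by nra.
    assert (Rabs n2 <= Rabs K * (ap + aq)) by nra.
    assert (2 * ap * Rabs n1 <= 2 * ap * (Rabs K * (ap + aq))) by (apply Rmult_le_compat_l; lra).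
    assert (2 * aq * Rabs n2 <= 2 * aq * (Rabs K * (ap + aq))) by (apply Rmult_le_compat_l; lra).
    assert (0 <= Rabs K * (ap - aq) ^ 2) by (apply Rmult_le_pos; [lra | apply pow2_ge_0]).
    nra. }
  intros t. fold (E t) (E t0).
  destruct (Rle_lt_dec t0 t) as [Ht | Ht].
  - rewrite (Rabs_pos_eq (t - t0)) by lra.
    assert (I : - E t0 * exp (- C * (t0 - t0)) <= - E t * exp (- C * (t - t0))).
    { apply (derive_nonneg_incr (fun s => - E s * exp (- C * (s - t0)))
         (fun s => (C * E s - dE s) * exp (- C * (s - t0)))); [lra | |].
      - intros s _. auto_derive; [eexists; apply HE |].
        subst_derive (HE s). unfold Rminus. ring.
      - intros s _. specialize (HB s). apply Rabs_le_between in HB.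
        apply Rmult_le_pos; [lra | left; apply exp_pos]. }
    rewrite Rminus_diag, Rmult_0_r, exp_0 in I.
    replace (E t) with (E t * exp (- C * (t - t0)) * exp (C * (t - t0))).
    + apply Rmult_le_compat_r; [left; apply exp_pos | lra].
    + rewrite Rmult_assoc, <- exp_plus. replace (- C * (t - t0) + C * (t - t0)) with 0 by ring.
      rewrite exp_0; ring.
  - rewrite (Rabs_left (t - t0)) by lra.
    assert (I : E t * exp (C * (t - t0)) <= E t0 * exp (C * (t0 - t0))).
    { apply (derive_nonneg_incr (fun s => E s * exp (C * (s - t0)))
         (fun s => (C * E s + dE s) * exp (C * (s - t0)))); [lra | |].
      - intros s _. auto_derive; [eexists; apply HE |].
        subst_derive (HE s). unfold Rminus. ring.
      - intros s _. specialize (HB s). apply Rabs_le_between in HB.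
        apply Rmult_le_pos; [lra | left; apply exp_pos]. }
    rewrite Rminus_diag, Rmult_0_r, exp_0 in I.
    replace (E t) with (E t * exp (C * (t - t0)) * exp (C * - (t - t0))).
    + apply Rmult_le_compat_r; [left; apply exp_pos | lra].
    + rewrite Rmult_assoc, <- exp_plus. replace (C * (t - t0) + C * - (t - t0)) with 0 by ring.
      rewrite exp_0; ring.
Qed.

(** * Energy estimates and the bounded solution of a perturbed linear system *)

(* The matrix (a, 1; -b, 0) has both eigenvalues in the right half-plane, whether real or not; the
   form b v^2 + z^2 + 2 d v z with d small is strictly increasing along its flow. *)
Lemma energy_inequality (a b : R) : 0 < a -> 0 < b ->
  exists d c e K0 mu, 0 < c /\ 0 < e /\ 0 < K0 /\ 0 < mu /\
    (forall v z, mu * (v ^ 2 + z ^ 2) <= b * v ^ 2 + z ^ 2 + 2 * d * v * z <= 2 * (b + 1) * (v ^ 2 + z ^ 2)) /\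
    (forall v z n1 n2 W, 0 <= W -> Rabs n1 <= e * (Rabs v + Rabs z) + W ->
       Rabs n2 <= e * (Rabs v + Rabs z) + W ->
       c * (b * v ^ 2 + z ^ 2 + 2 * d * v * z) - K0 * W ^ 2 <=
       2 * b * v * (a * v + z + n1) + 2 * z * (- b * v + n2) +
       2 * d * ((a * v + z + n1) * z + v * (- b * v + n2))).
Proof.
  intros Ha Hb.
  assert (Hab : 0 < a * b) by nra.
  (* Along the linear flow the form has derivative 2ab v^2 + 2d(z^2 + a v z - b v^2). The first
     bound on [d] lets the diagonal terms absorb a v z; the other two keep the form positive
     definite. *)
  set (d := Rmin (a * b / (2 * b + a ^ 2)) (Rmin (b / 2) (1 / 2))).
  assert (Hd : 0 < d).
  { unfold d. repeat apply Rmin_glb_lt; try lra. apply Rdiv_lt_0_compat; nra. }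
  assert (Hd1 : d * (2 * b + a ^ 2) <= a * b).
  { assert (d <= a * b / (2 * b + a ^ 2)) by apply Rmin_l.
    replace (a * b) with (a * b / (2 * b + a ^ 2) * (2 * b + a ^ 2)) by (field; nra).
    apply Rmult_le_compat_r; [nra | auto]. }
  assert (Hd2 : d <= b / 2) by (eapply Rle_trans; [apply Rmin_r | apply Rmin_l]).
  assert (Hd3 : d <= 1 / 2) by (eapply Rle_trans; [apply Rmin_r | apply Rmin_r]).
  set (kap := Rmin (a * b) d).
  assert (Hk : 0 < kap) by (apply Rmin_glb_lt; lra).
  assert (Hk1 : kap <= a * b) by apply Rmin_l.
  assert (Hk2 : kap <= d) by apply Rmin_r.
  set (B := b + 1). assert (HB : 1 < B) by (unfold B; lra).
  set (mu := Rmin (b / 2) (1 / 2)).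
  assert (Hmu : 0 < mu) by (apply Rmin_glb_lt; lra).
  assert (Hmu1 : mu <= b / 2) by apply Rmin_l.
  assert (Hmu2 : mu <= 1 / 2) by apply Rmin_r.
  assert (Hup : forall v z, b * v ^ 2 + z ^ 2 + 2 * d * v * z <= 2 * B * (v ^ 2 + z ^ 2)).
  { intros v z. unfold B.
    assert (0 <= d * (v - z) ^ 2) by (apply Rmult_le_pos; [lra | apply pow2_ge_0]).
    assert (P1 := pow2_ge_0 v). assert (P2 := pow2_ge_0 z). nra. }
  (* The linear growth kap (v^2 + z^2) is shared out: one half pays for [c] times the form, which is
     at most 2B (v^2 + z^2), the other half for the perturbation, through Young's inequality. *)
  exists d, (kap / (4 * B)), (kap / (16 * B)), (8 * B ^ 2 / kap), mu.
  split; [apply Rdiv_lt_0_compat; lra |].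
  split; [apply Rdiv_lt_0_compat; lra |].
  split; [apply Rdiv_lt_0_compat; nra |].
  split; [auto |].
  split.
  - intros v z. split; [| apply Hup].
    assert (0 <= d * (v + z) ^ 2) by (apply Rmult_le_pos; [lra | apply pow2_ge_0]).
    assert (P1 := pow2_ge_0 v). assert (P2 := pow2_ge_0 z). nra.
  - intros v z n1 n2 W HW H1 H2.
    set (q := v ^ 2 + z ^ 2).
    set (s := Rabs v + Rabs z) in *.
    assert (Pv := Rabs_pos v). assert (Pz := Rabs_pos z).
    assert (Hs : s ^ 2 <= 2 * q).
    { unfold s, q. rewrite <- (pow2_abs v), <- (pow2_abs z).
      assert (P := pow2_ge_0 (Rabs v - Rabs z)). nra. }
    assert (Hs0 : 0 <= s) by (unfold s; lra).
    assert (Hc : kap / (4 * B) * (b * v ^ 2 + z ^ 2 + 2 * d * v * z) <= kap / 2 * q).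
    { replace (kap / 2 * q) with (kap / (4 * B) * (2 * B * q)) by (field; lra).
      apply Rmult_le_compat_l; [left; apply Rdiv_lt_0_compat; lra | apply Hup]. }
    assert (Hlin : kap * q <= 2 * b * v * (a * v + z) + 2 * z * (- b * v) +
                     2 * d * ((a * v + z) * z + v * (- b * v))).
    { unfold q.
      assert (0 <= d * (a * v + z) ^ 2) by (apply Rmult_le_pos; [lra | apply pow2_ge_0]).
      assert (P1 := pow2_ge_0 v). assert (P2 := pow2_ge_0 z). nra. }
    set (E := kap / (16 * B) * s + W) in *.
    assert (HE : 0 <= E).
    { unfold E. assert (0 < kap / (16 * B)) by (apply Rdiv_lt_0_compat; lra). nra. }
    assert (Hn : Rabs (2 * (b * v + d * z) * n1 + 2 * (z + d * v) * n2) <= 2 * B * s * E).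
    { eapply Rle_trans; [apply Rabs_triang |]. rewrite !Rabs_mult, (Rabs_pos_eq 2) by lra.
      assert (A1 : Rabs (b * v + d * z) <= b * Rabs v + d * Rabs z).
      { eapply Rle_trans; [apply Rabs_triang |].
        rewrite !Rabs_mult, (Rabs_pos_eq b), (Rabs_pos_eq d) by lra. lra. }
      assert (A2 : Rabs (z + d * v) <= Rabs z + d * Rabs v).
      { eapply Rle_trans; [apply Rabs_triang |].
        rewrite !Rabs_mult, (Rabs_pos_eq d) by lra. lra. }
      assert (Rabs (b * v + d * z) * Rabs n1 <= (b * Rabs v + d * Rabs z) * E)
        by (apply Rmult_le_compat; auto using Rabs_pos).
      assert (Rabs (z + d * v) * Rabs n2 <= (Rabs z + d * Rabs v) * E)
        by (apply Rmult_le_compat; auto using Rabs_pos).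
      assert ((b * Rabs v + d * Rabs z) + (Rabs z + d * Rabs v) <= B * s) by (unfold B, s; nra).
      nra. }
    assert (Hy : 2 * B * s * E <= kap / 2 * q + 8 * B ^ 2 / kap * W ^ 2).
    { unfold E.
      replace (2 * B * s * (kap / (16 * B) * s + W)) with (kap / 8 * s ^ 2 + 2 * B * s * W) by (field; lra).
      assert (0 <= kap / 8 * (s - 8 * B / kap * W) ^ 2)
        by (apply Rmult_le_pos; [lra | apply pow2_ge_0]).
      replace (kap / 8 * (s - 8 * B / kap * W) ^ 2)
        with (kap / 8 * s ^ 2 - 2 * B * s * W + 8 * B ^ 2 / kap * W ^ 2) in H by (field; lra).
      nra. }
    apply Rabs_le_between in Hn. lra.
Qed.

(** An expanding form is estimated backwards in time: the value at [T] reaches [t1] with the factor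
    exp(-c(T - t1)). The same decay leaves room for a forcing whose square grows at rate c/2, since
    the product is still integrable. *)
Lemma energy_estimate (a b : R) : 0 < a -> 0 < b ->
  exists c e K, 0 < c /\ 0 < e /\ 0 < K /\
  forall (v z n1 n2 W : R -> R) (M t1 T : R), t1 <= T ->
    (forall s, t1 <= s <= T -> is_derive v s (a * v s + z s + n1 s) /\
       is_derive z s (- b * v s + n2 s) /\
       0 <= W s /\ W s ^ 2 <= M ^ 2 * exp (c / 2 * (s - t1)) /\
       Rabs (n1 s) <= e * (Rabs (v s) + Rabs (z s)) + W s /\
       Rabs (n2 s) <= e * (Rabs (v s) + Rabs (z s)) + W s) ->
    v t1 ^ 2 + z t1 ^ 2 <= K * (exp (- c * (T - t1)) * (v T ^ 2 + z T ^ 2) + M ^ 2).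
Proof.
  intros Ha Hb.
  destruct (energy_inequality a b Ha Hb) as (d & c & e & K0 & mu & Hc & He & HK0 & Hmu & HE & HdE).
  assert (HK0c : 0 < 2 * K0 / c) by (apply Rdiv_lt_0_compat; lra).
  exists c, e, ((2 * (b + 1) + 2 * K0 / c) / mu).
  split; [auto | split; [auto | split; [apply Rdiv_lt_0_compat; lra |]]].
  intros v z n1 n2 W M t1 T HT H.
  set (E := fun s => b * v s ^ 2 + z s ^ 2 + 2 * d * v s * z s).
  assert (HEt1 : E t1 <= exp (- c * (T - t1)) * E T + 2 * K0 / c * M ^ 2).
  (* The subtracted term has derivative -K0 M^2 exp(-c(s - t1)/2), so removing it compensates the
     loss K0 W^2 of the energy inequality and makes [Q] nondecreasing. *)
  { set (Q := fun s => exp (- c * (s - t1)) * (b * v s ^ 2 + z s ^ 2 + 2 * d * v s * z s) -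
                2 * K0 / c * M ^ 2 * exp (- c / 2 * (s - t1))).
    assert (HQ : Q t1 <= Q T).
    { apply (derive_nonneg_incr Q (fun s => exp (- c * (s - t1)) *
        ((2 * b * v s * (a * v s + z s + n1 s) + 2 * z s * (- b * v s + n2 s) +
         2 * d * ((a * v s + z s + n1 s) * z s + v s * (- b * v s + n2 s))) - c * E s) +
         K0 * M ^ 2 * exp (- c / 2 * (s - t1)))); [lra | |].
      - intros s Hs. destruct (H s Hs) as (H1 & H2 & _). unfold Q, E. auto_derive.
        + repeat split; eexists; eassumption.
        + subst_derive H1. subst_derive H2. unfold Rminus. field. lra.
      - intros s Hs. destruct (H s Hs) as (_ & _ & HW & HM & H1 & H2).
        assert (A := HdE _ _ _ _ _ HW H1 H2). fold (E s) in A.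
        assert (Hexp : exp (- c * (s - t1)) * exp (c / 2 * (s - t1)) = exp (- c / 2 * (s - t1))).
        { rewrite <- exp_plus. f_equal. field. }
        rewrite <- Hexp.
        assert (P := exp_pos (- c * (s - t1))).
        set (e1 := exp (- c * (s - t1))) in *. set (e2 := exp (c / 2 * (s - t1))) in *.
        match goal with |- 0 <= e1 * (?X - c * E s) + _ => set (X' := X) in * end.
        assert (0 <= e1 * (X' - c * E s + K0 * W s ^ 2)) by (apply Rmult_le_pos; lra).
        assert (0 <= K0 * e1 * (M ^ 2 * e2 - W s ^ 2)) by (apply Rmult_le_pos; nra).
        nra. }
    unfold Q in HQ. fold (E t1) (E T) in HQ.
    rewrite Rminus_diag, !Rmult_0_r, exp_0 in HQ.
    assert (0 <= 2 * K0 / c * M ^ 2 * exp (- c / 2 * (T - t1))).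
    { apply Rmult_le_pos; [apply Rmult_le_pos; [lra | apply pow2_ge_0] | left; apply exp_pos]. }
    lra. }
  destruct (HE (v t1) (z t1)) as [L1 _]. destruct (HE (v T) (z T)) as [_ L2].
  fold (E t1) in L1. fold (E T) in L2.
  assert (P := exp_pos (- c * (T - t1))). set (ex := exp (- c * (T - t1))) in *.
  set (q1 := v t1 ^ 2 + z t1 ^ 2) in *. set (q2 := v T ^ 2 + z T ^ 2) in *.
  assert (Hq2 : 0 <= q2) by (unfold q2; assert (P1 := pow2_ge_0 (v T)); assert (P2 := pow2_ge_0 (z T)); lra).
  assert (HM := pow2_ge_0 M).
  apply (Rmult_le_reg_l mu); [auto |].
  replace (mu * ((2 * (b + 1) + 2 * K0 / c) / mu * (ex * q2 + M ^ 2)))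
    with ((2 * (b + 1) + 2 * K0 / c) * (ex * q2 + M ^ 2)) by (field; lra).
  assert (ex * E T <= ex * (2 * (b + 1) * q2)) by (apply Rmult_le_compat_l; lra).
  assert (0 <= ex * q2) by nra.
  nra.
Qed.

Lemma Rabs_le_of_sum_squares (x y : R) (A : R) : x ^ 2 + y ^ 2 <= A ^ 2 -> 0 <= A -> Rabs x <= A /\ Rabs y <= A.
Proof.
  intros H HA. rewrite <- (pow2_abs x), <- (pow2_abs y) in H.
  assert (P1 := Rabs_pos x). assert (P2 := Rabs_pos y). split; nra.
Qed.

(* The solution is the limit of those vanishing at time n, which form a Cauchy sequence by the
   energy estimate since the linear part is contracting backwards in time. *)
Lemma bounded_solution (a b : R) : 0 < a -> 0 < b ->
  exists c e K, 0 < c /\ 0 < e /\ 0 < K /\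
  forall (N : bool -> R -> R -> R -> R) (M0 : R),
    (forall i t y z y' z', Rabs (N i t y z - N i t y' z') <= e * (Rabs (y - y') + Rabs (z - z'))) ->
    (forall i y z t, continuous (fun t => N i t y z) t) ->
    (forall i t, Rabs (N i t 0 0) <= M0) ->
    exists v z : R -> R,
      (forall t, is_derive v t (a * v t + z t + N true t (v t) (z t)) /\
                 is_derive z t (- b * v t + N false t (v t) (z t))) /\
      forall t1 M, 0 <= M ->
        (forall i s, t1 <= s -> Rabs (N i s 0 0) <= M * exp (c / 4 * (s - t1))) ->
        v t1 ^ 2 + z t1 ^ 2 <= K * M ^ 2.
Proof.
  intros Ha Hb.
  destruct (energy_estimate a b Ha Hb) as (c & e & K & Hc & He & HK & HE).
  exists c, e, K. split; [auto | split; [auto | split; [auto |]]].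
  intros N M0 HN HNt HN0.
  set (F := fun (i : bool) t y z => if i then a * y + z + N true t y z else - b * y + N false t y z).
  set (KF := a + 1 + b + e).
  assert (HF : forall i t y z y' z', Rabs (F i t y z - F i t y' z') <= KF * (Rabs (y - y') + Rabs (z - z'))).
  { intros [|] t y z y' z'; simpl.
    - replace (a * y + z + N true t y z - (a * y' + z' + N true t y' z')) with
        (a * (y - y') + (z - z') + (N true t y z - N true t y' z')) by ring.
      eapply Rle_trans; [apply Rabs_triang |].
      eapply Rle_trans; [apply Rplus_le_compat_r; apply Rabs_triang |].
      rewrite Rabs_mult, (Rabs_pos_eq a) by lra.
      specialize (HN true t y z y' z'). unfold KF.
      assert (P1 := Rabs_pos (y - y')). assert (P2 := Rabs_pos (z - z')). nra.
    - replace (- b * y + N false t y z - (- b * y' + N false t y' z')) with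
        (- (b * (y - y')) + (N false t y z - N false t y' z')) by ring.
      eapply Rle_trans; [apply Rabs_triang |].
      rewrite Rabs_Ropp, Rabs_mult, (Rabs_pos_eq b) by lra.
      specialize (HN false t y z y' z'). unfold KF.
      assert (P1 := Rabs_pos (y - y')). assert (P2 := Rabs_pos (z - z')). nra. }
  assert (HFt : forall i y z t, continuous (fun t => F i t y z) t).
  { intros [|] y z t; simpl.
    - apply (continuous_plus (fun _ => a * y + z) (fun t => N true t y z)); [apply continuous_const | apply HNt].
    - apply (continuous_plus (fun _ => - b * y) (fun t => N false t y z)); [apply continuous_const | apply HNt]. }
  (* The difference of two solutions carries no forcing: the Lipschitz bound [e] on [N] is all that
     enters, with [W] and [M] equal to 0. *)
  assert (Hdiff : forall V Z V' Z' : R -> R,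
    (forall t, is_derive V t (F true t (V t) (Z t)) /\ is_derive Z t (F false t (V t) (Z t))) ->
    (forall t, is_derive V' t (F true t (V' t) (Z' t)) /\ is_derive Z' t (F false t (V' t) (Z' t))) ->
    forall t1 T, t1 <= T ->
      (V t1 - V' t1) ^ 2 + (Z t1 - Z' t1) ^ 2 <=
      K * (exp (- c * (T - t1)) * ((V T - V' T) ^ 2 + (Z T - Z' T) ^ 2) + 0 ^ 2)).
  { intros V Z V' Z' H H' t1 T HT.
    apply (HE (fun s => V s - V' s) (fun s => Z s - Z' s)
      (fun s => N true s (V s) (Z s) - N true s (V' s) (Z' s))
      (fun s => N false s (V s) (Z s) - N false s (V' s) (Z' s)) (fun _ => 0)); [auto |].
    intros s _. destruct (H s) as [H1 H2], (H' s) as [H3 H4]. unfold F in H1, H2, H3, H4.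
    split; [| split; [| split; [| split; [| split]]]].
    - evar_last; [apply (is_derive_minus V V'); eassumption |]. unfold minus, plus, opp; simpl. ring.
    - evar_last; [apply (is_derive_minus Z Z'); eassumption |]. unfold minus, plus, opp; simpl. ring.
    - lra.
    - lra.
    - rewrite Rplus_0_r. apply HN.
    - rewrite Rplus_0_r. apply HN. }
  assert (Hzero : forall V Z : R -> R,
    (forall t, is_derive V t (F true t (V t) (Z t)) /\ is_derive Z t (F false t (V t) (Z t))) ->
    forall t1 T M, t1 <= T -> V T = 0 -> Z T = 0 -> 0 <= M ->
      (forall i s, t1 <= s -> Rabs (N i s 0 0) <= M * exp (c / 4 * (s - t1))) ->
      V t1 ^ 2 + Z t1 ^ 2 <= K * M ^ 2).
  { intros V Z H t1 T M HT HV HZ HM0 HM.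
    replace (K * M ^ 2) with (K * (exp (- c * (T - t1)) * (V T ^ 2 + Z T ^ 2) + M ^ 2))
      by (rewrite HV, HZ; ring).
    apply (HE V Z (fun s => N true s (V s) (Z s)) (fun s => N false s (V s) (Z s))
              (fun s => M * exp (c / 4 * (s - t1)))); [auto |].
    assert (HNb : forall i s, t1 <= s -> Rabs (N i s (V s) (Z s)) <=
       e * (Rabs (V s) + Rabs (Z s)) + M * exp (c / 4 * (s - t1))).
    { intros i s Hs. specialize (HN i s (V s) (Z s) 0 0). rewrite !Rminus_0_r in HN.
      specialize (HM i s Hs).
      replace (N i s (V s) (Z s)) with ((N i s (V s) (Z s) - N i s 0 0) + N i s 0 0) by ring.
      eapply Rle_trans; [apply Rabs_triang |]. lra. }
    intros s Hs. destruct (H s) as [H1 H2].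
    split; [exact H1 |]. split; [exact H2 |].
    split; [apply Rmult_le_pos; [auto | left; apply exp_pos] |].
    split; [| split; apply HNb; lra].
    rewrite Rpow_mult_distr. apply Req_le. f_equal. simpl. rewrite Rmult_1_r, <- exp_plus.
    f_equal. field. }
  assert (HM0 : 0 <= M0) by (eapply Rle_trans; [apply Rabs_pos | apply (HN0 true 0)]).
  assert (Hsol : forall y0 z0 t0, exists yz : (R -> R) * (R -> R), fst yz t0 = y0 /\ snd yz t0 = z0 /\
    forall t, is_derive (fst yz) t (F true t (fst yz t) (snd yz t)) /\
              is_derive (snd yz) t (F false t (fst yz t) (snd yz t))).
  { intros y0 z0 t0.
    destruct (ode_global_solution F KF (KF * (Rabs y0 + Rabs z0) + M0) t0 y0 z0) as (y & z & H); auto.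
    - intros i t. specialize (HF i t y0 z0 0 0). rewrite !Rminus_0_r in HF.
      assert (Rabs (F i t 0 0) <= M0).
      { destruct i; simpl; rewrite Rmult_0_r, ?Rplus_0_l; apply HN0. }
      replace (F i t y0 z0) with ((F i t y0 z0 - F i t 0 0) + F i t 0 0) by ring.
      eapply Rle_trans; [apply Rabs_triang |]. lra.
    - exists (y, z). exact H. }
  destruct (ClassicalEpsilon.choice _ (fun n : nat => Hsol 0 0 (INR n))) as [yz Hyz].
  assert (Hexp1 : forall t1 s, t1 <= s -> 1 <= exp (c / 4 * (s - t1))).
  { intros t1 s Hs. rewrite <- exp_0. apply exp_le_compat. apply Rmult_le_pos; lra. }
  (* At time n the n-th solution vanishes and the p-th one is bounded by [Hzero]; [Hdiff] carries
     this gap back to time 0 with the factor exp(-c n). *)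
  assert (Hcauchy0 : forall n p, (n <= p)%nat ->
    (fst (yz n) 0 - fst (yz p) 0) ^ 2 + (snd (yz n) 0 - snd (yz p) 0) ^ 2 <=
    K * K * M0 ^ 2 * exp (- c * INR n)).
  { intros n p Hnp. destruct (Hyz n) as (A1 & A2 & A3). destruct (Hyz p) as (B1 & B2 & B3).
    assert (D := Hdiff _ _ _ _ A3 B3 0 (INR n) (pos_INR n)).
    rewrite A1, A2 in D.
    assert (G := Hzero _ _ B3 (INR n) (INR p) M0 (le_INR _ _ Hnp) B1 B2 HM0).
    assert (G' : fst (yz p) (INR n) ^ 2 + snd (yz p) (INR n) ^ 2 <= K * M0 ^ 2).
    { apply G. intros i s Hs. specialize (HN0 i s). specialize (Hexp1 _ _ Hs). nra. }
    eapply Rle_trans; [apply D |]. rewrite Rminus_0_r.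
    assert (P := exp_pos (- c * INR n)). set (ex := exp (- c * INR n)) in *.
    replace (K * K * M0 ^ 2 * ex) with (K * (ex * (K * M0 ^ 2))) by ring.
    apply Rmult_le_compat_l; [lra |]. nra. }
  assert (Hexp0 : is_lim_seq (fun n => K * K * M0 ^ 2 * exp (- c * INR n)) 0).
  { replace (Finite 0) with (Rbar_mult (K * K * M0 ^ 2) 0) by (simpl; f_equal; ring).
    apply is_lim_seq_scal_l.
    apply (is_lim_seq_ext (fun n => (exp (- c)) ^ n)).
    - intros n. induction n; [simpl; rewrite Rmult_0_r, exp_0; reflexivity |].
      rewrite S_INR, Rmult_plus_distr_l, exp_plus, Rmult_1_r, <- IHn. simpl. ring.
    - apply is_lim_seq_geom. rewrite Rabs_pos_eq by (left; apply exp_pos).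
      rewrite <- exp_0. apply exp_increasing. lra. }
  assert (Hcauchy : forall eps, 0 < eps -> exists n0, forall n p, (n0 <= n)%nat -> (n <= p)%nat ->
    Rabs (fst (yz n) 0 - fst (yz p) 0) <= eps /\ Rabs (snd (yz n) 0 - snd (yz p) 0) <= eps).
  { intros eps Heps.
    destruct (proj1 (is_lim_seq_Reals _ _) Hexp0 (eps ^ 2)) as [n0 Hn0]; [apply pow_lt; auto |].
    exists n0. intros n p Hn Hp. specialize (Hn0 n Hn). unfold Rdist in Hn0. rewrite Rminus_0_r in Hn0.
    apply Rabs_def2 in Hn0. apply Rabs_le_of_sum_squares; [| lra].
    eapply Rle_trans; [apply Hcauchy0; auto | lra]. }
  assert (Hlim : forall pr : (R -> R) * (R -> R) -> R -> R, (pr = fst \/ pr = snd) ->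
     exists l : R, is_lim_seq (fun n => pr (yz n) 0) l).
  { intros pr Hpr. apply ex_lim_seq_cauchy_corr. intros eps.
    destruct (Hcauchy (eps / 2)) as [n0 H0]; [destruct eps; simpl; lra |].
    exists n0. intros n p Hn Hp.
    assert (G : Rabs (pr (yz n) 0 - pr (yz p) 0) <= eps / 2).
    { destruct (Nat.le_ge_cases n p) as [h | h].
      - destruct (H0 n p Hn h), Hpr; subst; auto.
      - rewrite Rabs_minus_sym. destruct (H0 p n Hp h), Hpr; subst; auto. }
    destruct eps as [eps He']; simpl in *. lra. }
  destruct (Hlim fst (or_introl eq_refl)) as [v0 Hv0].
  destruct (Hlim snd (or_intror eq_refl)) as [z0 Hz0].
  destruct (Hsol v0 z0 0) as [[v z] (Ev & Ez & Hvz)]. simpl in *.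
  exists v, z. split; [exact Hvz |].
  intros t1 M HM0' HM.
  (* Convergence is known at time 0 only; continuous dependence transports it to [t1], where the
     bounds on the approximants then pass to the limit. *)
  set (dn := fun n => (fst (yz n) t1 - v t1) ^ 2 + (snd (yz n) t1 - z t1) ^ 2).
  assert (Hdn : is_lim_seq dn 0).
  { set (cst := exp (4 * Rabs KF * Rabs (t1 - 0))).
    apply (is_lim_seq_le_le (fun _ => 0) dn
      (fun n => ((fst (yz n) 0 - v0) * (fst (yz n) 0 - v0) + (snd (yz n) 0 - z0) * (snd (yz n) 0 - z0)) * cst)).
    - intros n. split.
      + unfold dn. assert (P1 := pow2_ge_0 (fst (yz n) t1 - v t1)).
        assert (P2 := pow2_ge_0 (snd (yz n) t1 - z t1)). lra.
      + destruct (Hyz n) as (A1 & A2 & A3).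
        eapply Rle_trans; [apply (ode_continuous_dependence F KF 0); eauto |].
        rewrite Ev, Ez. unfold cst. apply Req_le. f_equal. ring.
    - apply is_lim_seq_const.
    - replace (Finite 0) with (Finite (((v0 - v0) * (v0 - v0) + (z0 - z0) * (z0 - z0)) * cst)) by (f_equal; ring).
      apply is_lim_seq_mult'; [| apply is_lim_seq_const].
      apply is_lim_seq_plus'; apply is_lim_seq_mult'; apply is_lim_seq_minus'; auto using is_lim_seq_const. }
  assert (Hpt : forall pr : (R -> R) * (R -> R) -> R -> R, (pr = fst \/ pr = snd) ->
     is_lim_seq (fun n => pr (yz n) t1) (pr (v, z) t1)).
  { intros pr Hpr. apply is_lim_seq_Reals. intros eps Heps.
    destruct (proj1 (is_lim_seq_Reals _ _) Hdn (eps ^ 2 / 4)) as [n0 Hn0]; [nra |].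
    exists n0. intros n Hn. specialize (Hn0 n Hn). unfold Rdist in *. rewrite Rminus_0_r in Hn0.
    apply Rabs_def2 in Hn0. unfold dn in Hn0.
    destruct (Rabs_le_of_sum_squares (fst (yz n) t1 - v t1) (snd (yz n) t1 - z t1) (eps / 2)) as [G1 G2];
      [lra | lra |].
    destruct Hpr; subst; simpl; lra. }
  apply (is_lim_seq_le_loc (fun n => fst (yz n) t1 * fst (yz n) t1 + snd (yz n) t1 * snd (yz n) t1)
           (fun _ => K * M ^ 2) (v t1 ^ 2 + z t1 ^ 2) (K * M ^ 2)).
  - destruct (INR_unbounded t1) as [n0 Hn0]. exists n0. intros n Hn.
    destruct (Hyz n) as (A1 & A2 & A3).
    assert (INR n0 <= INR n) by (apply le_INR; auto).
    assert (G := Hzero _ _ A3 t1 (INR n) M).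
    replace (fst (yz n) t1 * fst (yz n) t1 + snd (yz n) t1 * snd (yz n) t1)
      with (fst (yz n) t1 ^ 2 + snd (yz n) t1 ^ 2) by ring.
    apply G; auto. lra.
  - replace (Finite (v t1 ^ 2 + z t1 ^ 2)) with (Finite (v t1 * v t1 + z t1 * z t1)) by (f_equal; ring).
    apply is_lim_seq_plus'; apply is_lim_seq_mult';
      first [apply (Hpt fst); auto | apply (Hpt snd); auto].
  - apply is_lim_seq_const.
Qed.

Lemma clamp_spec (l u x y : R) : l <= u ->
  let c x := Rmax l (Rmin u x) in
  l <= c x <= u /\ Rabs (c x - c y) <= Rabs (x - y) /\ (l <= x <= u -> c x = x).
Proof.
  intros H c. unfold c, Rmax, Rmin.
  repeat split; repeat destruct Rle_dec; try lra;
    unfold Rabs; repeat destruct Rcase_abs; try lra.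
Qed.

(* Only the linear part is kept outside the interval [-e0,e0], which the solution never leaves. *)
Lemma small_solution (a b m : R) : 0 < a -> 0 < b -> 0 <= m ->
  exists c eta K, 0 < c /\ 0 < eta /\ 0 < K /\
  forall H : R -> R, (forall s, Rabs (H s) <= eta) ->
    (forall s s', Rabs (H s - H s') <= eta * Rabs (s - s')) ->
    exists v z : R -> R,
      (forall t, is_derive v t (exp (z t) - 1 + a * (exp (v t) - 1)) /\
                 is_derive z t (- b * (exp (v t) - 1) - H (t + v t + m * z t) * exp (z t)) /\
                 Rabs (v t + m * z t) <= 1) /\
      forall t1 M, 0 <= M ->
        (forall s, t1 <= s -> Rabs (H s) <= M * exp (c / 4 * (s - t1))) ->
        v t1 ^ 2 + z t1 ^ 2 <= K * M ^ 2.
Proof.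
  intros Ha Hb Hm.
  destruct (bounded_solution a b Ha Hb) as (c & e & K & Hc & He & HK & HB).
  (* On the interval [-e0,e0] the remainder exp x - 1 - x has slope at most [q], and q(1 + a + b)
     uses up at most half of the Lipschitz constant [e] that is allowed. *)
  set (q := Rmin 1 (e / (2 * (1 + a + b)))).
  assert (Hq : 0 < q) by (apply Rmin_glb_lt; [lra | apply Rdiv_lt_0_compat; lra]).
  assert (Hq1 : q <= 1) by apply Rmin_l.
  assert (Hqe : q * (1 + a + b) <= e / 2).
  { replace (e / 2) with (e / (2 * (1 + a + b)) * (1 + a + b)) by (field; lra).
    apply Rmult_le_compat_r; [lra | apply Rmin_r]. }
  destruct (proj1 (continuous_eps exp 0) (continuous_exp 0) q Hq) as (d & Hd & Hexp).
  (* The second bound is the source of |v + m z| <= 1. *)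
  set (e0 := Rmin (d / 2) (1 / (1 + m))).
  assert (H1m : 0 < 1 / (1 + m)) by (apply Rdiv_lt_0_compat; lra).
  assert (He0 : 0 < e0) by (apply Rmin_glb_lt; lra).
  assert (He0d : e0 < d) by (assert (e0 <= d / 2) by apply Rmin_l; lra).
  assert (He0m : e0 * (1 + m) <= 1).
  { replace 1 with (1 / (1 + m) * (1 + m)) at 2 by (field; lra).
    apply Rmult_le_compat_r; [lra | apply Rmin_r]. }
  assert (He1 : forall x, - e0 <= x <= e0 -> Rabs (exp x - 1) <= q).
  { intros x Hx. rewrite <- exp_0. left. apply Hexp. rewrite Rminus_0_r. apply Rabs_def1; lra. }
  assert (He2 : forall x, - e0 <= x <= e0 -> Rabs (exp x) <= 2).
  { intros x Hx. specialize (He1 x Hx). apply Rabs_le_between in He1.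
    assert (P := exp_pos x). apply Rabs_le. lra. }
  (* The first bound fits the term with [H] into the other half of [e]; the second gives K eta^2 <=
     e0^2, which keeps the solution where the truncation is inactive. *)
  set (eta := Rmin (e / (4 * (1 + m))) (e0 / (K + 1))).
  assert (Heta : 0 < eta) by (apply Rmin_glb_lt; apply Rdiv_lt_0_compat; lra).
  assert (Heta1 : eta * (1 + m) <= e / 4).
  { replace (e / 4) with (e / (4 * (1 + m)) * (1 + m)) by (field; lra).
    apply Rmult_le_compat_r; [lra | apply Rmin_l]. }
  assert (Heta2 : eta * (K + 1) <= e0).
  { replace e0 with (e0 / (K + 1) * (K + 1)) by (field; lra).
    apply Rmult_le_compat_r; [lra | apply Rmin_r]. }
  exists c, eta, K. split; [auto | split; [auto | split; [auto |]]].
  intros H HH HHL.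
  set (cl := fun x => Rmax (- e0) (Rmin e0 x)).
  assert (Hcl : forall x y, - e0 <= cl x <= e0 /\ Rabs (cl x - cl y) <= Rabs (x - y) /\
    (- e0 <= x <= e0 -> cl x = x)).
  { intros x y. apply clamp_spec. lra. }
  assert (Hbetw : forall x y w, Rmin (cl x) (cl y) <= w <= Rmax (cl x) (cl y) -> - e0 <= w <= e0).
  { intros x y w Hw. destruct (Hcl x y) as [A1 _]. destruct (Hcl y x) as [A2 _].
    revert Hw. unfold Rmin at 1, Rmax at 1. destruct Rle_dec; lra. }
  set (rho := fun x => exp (cl x) - 1 - cl x).
  assert (Hrho : forall x y, Rabs (rho x - rho y) <= q * Rabs (x - y)).
  { intros x y. unfold rho.
    eapply Rle_trans.
    - apply (lipschitz_of_derive (fun w => exp w - 1 - w) (fun w => exp w - 1) (cl y) (cl x) q).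
      + intros w _. auto_derive; [auto | ring].
      + intros w Hw. apply He1. eapply Hbetw; eauto.
    - apply Rmult_le_compat_l; [lra | apply Hcl]. }
  assert (Hecl : forall x y, Rabs (exp (cl x) - exp (cl y)) <= 2 * Rabs (x - y)).
  { intros x y. eapply Rle_trans.
    - apply (lipschitz_of_derive exp exp (cl y) (cl x) 2).
      + intros w _. apply is_derive_exp.
      + intros w Hw. apply He2. eapply Hbetw; eauto.
    - apply Rmult_le_compat_l; [lra | apply Hcl]. }
  assert (Hcl0 : cl 0 = 0) by (apply (Hcl 0 0); lra).
  set (N := fun (i : bool) t y z => if i then rho z + a * rho y
     else - b * rho y - H (t + cl y + m * cl z) * exp (cl z)).
  assert (N0 : forall i s, Rabs (N i s 0 0) <= Rabs (H s)).
  { intros i s. assert (R0 : rho 0 = 0) by (unfold rho; rewrite Hcl0, exp_0; ring).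
    destruct i; simpl; rewrite R0, ?Hcl0, ?exp_0, ?Rmult_0_r.
    - rewrite Rplus_0_r, Rabs_R0. apply Rabs_pos.
    - replace (0 - H (s + 0 + 0) * 1) with (- H s) by (rewrite !Rplus_0_r; ring).
      rewrite Rabs_Ropp. lra. }
  destruct (HB N eta) as (v & z & Hvz & Hbd).
  - intros i t y z y' z'.
    assert (Py := Rabs_pos (y - y')). assert (Pz := Rabs_pos (z - z')).
    assert (A1 := Hrho z z'). assert (A2 := Hrho y y').
    assert (Qa : 0 < q * a) by nra. assert (Qb : 0 < q * b) by nra.
    assert (Qe : q + q * a + q * b <= e / 2) by lra.
    destruct i; simpl.
    + replace (rho z + a * rho y - (rho z' + a * rho y'))
        with ((rho z - rho z') + a * (rho y - rho y')) by ring.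
      eapply Rle_trans; [apply Rabs_triang |]. rewrite Rabs_mult, (Rabs_pos_eq a) by lra.
      assert (a * Rabs (rho y - rho y') <= a * (q * Rabs (y - y'))) by (apply Rmult_le_compat_l; lra).
      assert (q * Rabs (z - z') <= e * Rabs (z - z')) by (apply Rmult_le_compat_r; lra).
      assert (q * a * Rabs (y - y') <= e * Rabs (y - y')) by (apply Rmult_le_compat_r; lra).
      lra.
    + set (s := t + cl y + m * cl z). set (s' := t + cl y' + m * cl z').
      replace (- b * rho y - H s * exp (cl z) - (- b * rho y' - H s' * exp (cl z')))
        with (- (b * (rho y - rho y')) + (- ((H s - H s') * exp (cl z)) - H s' * (exp (cl z) - exp (cl z'))))
        by ring.
      eapply Rle_trans; [apply Rabs_triang |].
      eapply Rle_trans; [apply Rplus_le_compat_l; apply Rabs_triang |].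
      rewrite !Rabs_Ropp, !Rabs_mult, (Rabs_pos_eq b) by lra.
      assert (B1 : b * Rabs (rho y - rho y') <= b * (q * Rabs (y - y'))) by (apply Rmult_le_compat_l; lra).
      assert (B2 : Rabs (s - s') <= Rabs (y - y') + m * Rabs (z - z')).
      { unfold s, s'.
        replace (t + cl y + m * cl z - (t + cl y' + m * cl z'))
          with ((cl y - cl y') + m * (cl z - cl z')) by ring.
        eapply Rle_trans; [apply Rabs_triang |]. rewrite Rabs_mult, (Rabs_pos_eq m) by lra.
        apply Rplus_le_compat; [apply Hcl |]. apply Rmult_le_compat_l; [lra | apply Hcl]. }
      assert (B3 : Rabs (H s - H s') * Rabs (exp (cl z)) <= eta * (Rabs (y - y') + m * Rabs (z - z')) * 2).
      { apply Rmult_le_compat; auto using Rabs_pos.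
        - eapply Rle_trans; [apply HHL |]. apply Rmult_le_compat_l; lra.
        - apply He2. apply (Hcl z z). }
      assert (B4 : Rabs (H s') * Rabs (exp (cl z) - exp (cl z')) <= eta * (2 * Rabs (z - z'))).
      { apply Rmult_le_compat; auto using Rabs_pos. }
      assert (0 <= eta * m) by nra. assert (0 <= q * (1 + a)) by nra.
      assert (eta * (Rabs (y - y') + m * Rabs (z - z')) * 2 + eta * (2 * Rabs (z - z')) <=
        2 * (eta * (1 + m)) * (Rabs (y - y') + Rabs (z - z'))).
      { assert (0 <= eta * m * Rabs (y - y')) by (apply Rmult_le_pos; lra). nra. }
      assert (b * (q * Rabs (y - y')) <= e / 2 * Rabs (y - y')) by nra.
      nra.
  - intros i y z t. apply continuous_eps. intros eps Heps. destruct i; simpl.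
    + exists 1. split; [lra |]. intros s _. rewrite Rminus_diag, Rabs_R0. auto.
    + exists (eps / (4 * eta)). split; [apply Rdiv_lt_0_compat; lra |]. intros s Hs.
      replace (- b * rho y - H (s + cl y + m * cl z) * exp (cl z) -
         (- b * rho y - H (t + cl y + m * cl z) * exp (cl z)))
        with (- ((H (s + cl y + m * cl z) - H (t + cl y + m * cl z)) * exp (cl z))) by ring.
      rewrite Rabs_Ropp, Rabs_mult.
      apply Rle_lt_trans with (eta * (eps / (4 * eta)) * 2).
      * apply Rmult_le_compat; auto using Rabs_pos.
        -- eapply Rle_trans; [apply HHL |]. apply Rmult_le_compat_l; [lra |].
           replace (s + cl y + m * cl z - (t + cl y + m * cl z)) with (s - t) by ring. lra.
        -- apply He2. apply (Hcl z z).
      * replace (eta * (eps / (4 * eta)) * 2) with (eps / 2) by (field; lra). lra.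
  - intros i t. eapply Rle_trans; [apply N0 | apply HH].
  - assert (Hsm : forall t, Rabs (v t) <= e0 /\ Rabs (z t) <= e0).
    { intros t. apply Rabs_le_of_sum_squares; [| lra].
      eapply Rle_trans; [apply (Hbd t eta); [lra |] |].
      - intros i s Hs. eapply Rle_trans; [apply N0 |]. eapply Rle_trans; [apply HH |].
        assert (1 <= exp (c / 4 * (s - t))).
        { rewrite <- exp_0. apply exp_le_compat. apply Rmult_le_pos; lra. }
        nra.
      - assert ((eta * (K + 1)) ^ 2 <= e0 ^ 2) by (apply pow_incr; split; [nra | auto]).
        assert (0 <= eta ^ 2) by (apply pow2_ge_0). nra. }
    exists v, z. split.
    + intros t. destruct (Hvz t) as [D1 D2]. destruct (Hsm t) as [S1 S2].
      assert (C1 : cl (v t) = v t) by (apply (Hcl _ 0); apply Rabs_le_between; auto).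
      assert (C2 : cl (z t) = z t) by (apply (Hcl _ 0); apply Rabs_le_between; auto).
      unfold N, rho in D1, D2. rewrite C1, C2 in D1, D2.
      split; [| split].
      * replace (exp (z t) - 1 + a * (exp (v t) - 1))
          with (a * v t + z t + (exp (z t) - 1 - z t + a * (exp (v t) - 1 - v t))) by ring. exact D1.
      * replace (- b * (exp (v t) - 1) - H (t + v t + m * z t) * exp (z t))
          with (- b * v t + (- b * (exp (v t) - 1 - v t) - H (t + v t + m * z t) * exp (z t))) by ring.
        exact D2.
      * eapply Rle_trans; [apply Rabs_triang |]. rewrite Rabs_mult, (Rabs_pos_eq m) by lra. nra.
    + intros t1 M HM HHM. apply Hbd; auto.
      intros i s Hs. eapply Rle_trans; [apply N0 | apply HHM; auto].
Qed.

(** * Local inverse functions *)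

Lemma ivt_incr (f : R -> R) (a b c : R) :
  a <= b -> (forall x, a <= x <= b -> continuous f x) -> f a <= c <= f b ->
  exists x, a <= x <= b /\ f x = c.
Proof.
  intros Hab Hf [[Ha | Ha] Hc]; [| exists a; lra].
  destruct Hc as [Hb | Hb]; [| exists b; lra].
  destruct Hab as [Hab | ->]; [| lra].
  destruct (IVT_interv (fun x => f x - c) a b) as [x [Hx E]]; try lra.
  - intros x Hx. apply continuity_pt_filterlim.
    apply (continuous_minus f (fun _ => c)); [apply Hf; auto | apply continuous_const].
  - exists x. split; [auto | lra].
Qed.

(** By the intermediate value theorem every value near [f x0] is attained near [x0], and the mean
    value theorem evaluates the difference quotient there. So [g] has to be a left inverse only near
    [x0]. *)
Lemma is_derive_inverse (f df g : R -> R) (x0 d : R) :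
  0 < d ->
  (forall x, Rabs (x - x0) < d -> is_derive f x (df x) /\ 0 < df x /\ g (f x) = x) ->
  continuous df x0 -> is_derive g (f x0) (/ df x0).
Proof.
  intros Hd H Hc. apply is_derive_Reals. intros eps Heps.
  assert (Hp : 0 < df x0) by (apply H; rewrite Rminus_diag, Rabs_R0; auto).
  assert (Hic : continuous (fun x => / df x) x0).
  { apply (continuous_comp df Rinv); [auto |].
    apply continuity_pt_filterlim. apply continuity_pt_inv; [apply continuity_pt_id | lra]. }
  destruct (proj1 (continuous_eps _ _) Hic eps Heps) as (r' & Hr' & Hr).
  set (r := Rmin (d / 2) (r' / 2)).
  assert (R0 : 0 < r) by (apply Rmin_glb_lt; lra).
  assert (R1 : r < d) by (assert (r <= d / 2) by apply Rmin_l; lra).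
  assert (R2 : r < r') by (assert (r <= r' / 2) by apply Rmin_r; lra).
  assert (Hder : forall x, x0 - r <= x <= x0 + r -> is_derive f x (df x)).
  { intros x Hx. apply H. apply Rabs_def1; lra. }
  assert (Hmvt : forall x, x0 - r <= x <= x0 + r ->
    exists xi, Rabs (xi - x0) <= r /\ f x - f x0 = df xi * (x - x0)).
  { intros x Hx. destruct (MVT_gen f x0 x df) as [xi [Hxi E]].
    - intros y Hy. apply Hder. revert Hy. unfold Rmin, Rmax; destruct Rle_dec; lra.
    - intros y Hy. apply continuity_pt_filterlim. apply (ex_derive_continuous f y).
      exists (df y). apply Hder. revert Hy. unfold Rmin, Rmax; destruct Rle_dec; lra.
    - exists xi. split; [| exact E]. apply Rabs_le.
      revert Hxi. unfold Rmin, Rmax; destruct Rle_dec; lra. }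
  assert (Hl : f (x0 - r) < f x0).
  { destruct (Hmvt (x0 - r)) as (xi & B & E); [lra |].
    assert (0 < df xi) by (apply H; lra). nra. }
  assert (Hu : f x0 < f (x0 + r)).
  { destruct (Hmvt (x0 + r)) as (xi & B & E); [lra |].
    assert (0 < df xi) by (apply H; lra). nra. }
  assert (Hdl : 0 < Rmin (f x0 - f (x0 - r)) (f (x0 + r) - f x0)) by (apply Rmin_glb_lt; lra).
  exists (mkposreal _ Hdl). intros h Hh Hhd. simpl in Hhd.
  assert (D1 := Rlt_le_trans _ _ _ Hhd (Rmin_l _ _)).
  assert (D2 := Rlt_le_trans _ _ _ Hhd (Rmin_r _ _)).
  apply Rabs_def2 in D1. apply Rabs_def2 in D2.
  destruct (ivt_incr f (x0 - r) (x0 + r) (f x0 + h)) as (x & Hx & Ex); [lra | | lra |].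
  { intros y Hy. apply (ex_derive_continuous f y). exists (df y). apply Hder; auto. }
  destruct (Hmvt x Hx) as (xi & B & E).
  assert (0 < df xi) by (apply H; lra).
  rewrite <- Ex. destruct (H x0) as (_ & _ & ->); [rewrite Rminus_diag, Rabs_R0; auto |].
  destruct (H x) as (_ & _ & ->); [apply Rabs_def1; lra |].
  replace h with (df xi * (x - x0)) by lra.
  replace ((x - x0) / (df xi * (x - x0))) with (/ df xi).
  - apply (Hr xi). lra.
  - field. split; [| lra]. intros Z. apply Hh.
    replace h with (df xi * (x - x0)) by lra. rewrite Z. ring.
Qed.

(** * Slow variation of g' at infinity *)

Lemma is_lim_infty_eps (f : R -> R) (l : R) :
  is_lim f p_infty l <-> forall eps, 0 < eps -> exists T, forall t, T <= t -> Rabs (f t - l) < eps.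
Proof.
  split.
  - intros H eps Heps. apply is_lim_spec in H. destruct (H (mkposreal eps Heps)) as [T HT].
    exists (T + 1). intros t Ht. apply HT. lra.
  - intros H. apply is_lim_spec. intros eps. destruct (H eps (cond_pos eps)) as [T HT].
    exists T. intros t Ht. apply HT. lra.
Qed.

Lemma little_o_intro (h : R -> R) :
  (forall d, 0 < d -> exists T, forall t, T <= t -> Rabs (h t) <= d * t) -> little_o_id h.
Proof.
  intros H. apply is_lim_infty_eps. intros eps Heps.
  destruct (H (eps / 2)) as [T HT]; [lra |].
  exists (Rmax 1 T). intros t Ht.
  assert (1 <= t) by (eapply Rle_trans; [apply Rmax_l | eauto]).
  assert (T <= t) by (eapply Rle_trans; [apply Rmax_r | eauto]).
  rewrite Rminus_0_r. unfold Rdiv. rewrite Rabs_mult, (Rabs_pos_eq (/ t))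
    by (left; apply Rinv_0_lt_compat; lra).
  apply Rle_lt_trans with (eps / 2 * t * / t).
  - apply Rmult_le_compat_r; [left; apply Rinv_0_lt_compat; lra | auto].
  - field_simplify; lra.
Qed.

Lemma bigO_infty_nonneg (x y : R -> R) : bigO_infty x y ->
  exists C T, 0 < C /\ forall t, T <= t -> Rabs (x t) <= C * Rabs (y t).
Proof.
  intros (C & T & H). exists (Rabs C + 1), T.
  assert (P := Rabs_pos C). split; [lra |]. intros t Ht.
  eapply Rle_trans; [apply H; auto |]. apply Rmult_le_compat_r; [apply Rabs_pos |].
  assert (C <= Rabs C) by apply Rle_abs. lra.
Qed.

(* Instantiated with p = g', p1 = g'', p2 = g'''. *)
Definition tame (p p1 p2 : R -> R) (T0 : R) : Prop :=
  (forall t, T0 < t -> 0 < p t /\ is_derive p t (p1 t) /\ is_derive p1 t (p2 t)) /\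
  is_lim p1 p_infty 0 /\
  (forall h, little_o_id h -> is_lim (fun t => p t / p (t + h t)) p_infty 1) /\
  is_lim (fun t => p1 t / p t * ln (p t)) p_infty 0 /\
  bigO_infty p2 p1 /\
  (exists C T, forall t s, T <= t -> t <= s -> Rabs (p1 s) <= C * Rabs (p1 t)) /\
  (forall h, little_o_id h -> bigO_infty (fun t => p1 (t + h t)) p1).

Lemma exp_1_lt_4 : exp 1 < 4.
Proof. assert (H := exp_le_3). lra. Qed.

(** The assumption controls p1/p only after multiplication by ln p. Where |ln p| >= 1 this suffices;
    where |ln p| < 1, [p] is bounded below by 1/e and [p1] tends to 0. The bound on [p2] follows
    from p2 = O(p1). *)
Lemma tame_ratio (p p1 p2 : R -> R) (T0 : R) : tame p p1 p2 T0 ->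
  forall eps, 0 < eps -> exists T, T0 < T /\ 0 <= T /\
    forall t, T <= t -> Rabs (p1 t) <= eps * p t /\ Rabs (p2 t) <= eps * p t.
Proof.
  intros (Hd & H1 & _ & H4 & H5 & _).
  assert (G : forall eps, 0 < eps -> exists T, T0 < T /\ 0 <= T /\
    forall t, T <= t -> Rabs (p1 t) <= eps * p t).
  { intros eps Heps.
    destruct (proj1 (is_lim_infty_eps _ _) H1 (eps / 4)) as [T1 HT1]; [lra |].
    destruct (proj1 (is_lim_infty_eps _ _) H4 eps Heps) as [T2 HT2].
    exists (Rmax (Rmax (T0 + 1) 0) (Rmax T1 T2)).
    assert (B1 := Rmax_l (Rmax (T0 + 1) 0) (Rmax T1 T2)).
    assert (B2 := Rmax_r (Rmax (T0 + 1) 0) (Rmax T1 T2)).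
    assert (B3 := Rmax_l (T0 + 1) 0). assert (B4 := Rmax_r (T0 + 1) 0).
    assert (B5 := Rmax_l T1 T2). assert (B6 := Rmax_r T1 T2).
    split; [lra |]. split; [lra |]. intros t Ht.
    destruct (Hd t) as (Hp & _); [lra |].
    specialize (HT1 t ltac:(lra)). specialize (HT2 t ltac:(lra)).
    rewrite Rminus_0_r in HT1, HT2.
    destruct (Rle_lt_dec 1 (Rabs (ln (p t)))) as [h | h].
    - rewrite Rabs_mult in HT2. unfold Rdiv in HT2.
      rewrite Rabs_mult, (Rabs_pos_eq (/ p t)) in HT2 by (left; apply Rinv_0_lt_compat; auto).
      assert (P := Rabs_pos (p1 t)).
      assert (Q : 0 <= Rabs (p1 t) * / p t).
      { apply Rmult_le_pos; [auto | left; apply Rinv_0_lt_compat; auto]. }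
      replace (Rabs (p1 t)) with (Rabs (p1 t) * / p t * p t) by (field; lra).
      apply Rmult_le_compat_r; [lra | nra].
    - apply Rabs_def2 in h.
      assert (exp (-1) < p t).
      { rewrite <- (exp_ln (p t)) by auto. apply exp_increasing. lra. }
      assert (/ 4 < exp (-1)).
      { replace (-1) with (- (1)) by ring. rewrite exp_Ropp.
        apply Rinv_lt_contravar; [| apply exp_1_lt_4].
        apply Rmult_lt_0_compat; [apply exp_pos | lra]. }
      nra. }
  intros eps Heps. destruct (bigO_infty_nonneg _ _ H5) as (C & T5 & HC & HT5).
  set (e' := eps / (C + 1)).
  assert (He' : 0 < e') by (apply Rdiv_lt_0_compat; lra).
  assert (He'' : e' * (C + 1) = eps) by (unfold e'; field; lra).
  destruct (G e' He') as (T & B1 & B2 & HT).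
  exists (Rmax T T5).
  assert (B5 := Rmax_l T T5). assert (B6 := Rmax_r T T5).
  split; [lra |]. split; [lra |]. intros t Ht.
  specialize (HT t ltac:(lra)). specialize (HT5 t ltac:(lra)).
  destruct (Hd t) as (Hp & _); [lra |].
  assert (C * Rabs (p1 t) <= C * (e' * p t)) by (apply Rmult_le_compat_l; lra).
  assert (0 < e' * p t) by nra.
  split; nra.
Qed.

Lemma is_derive_ln_comp (p p1 : R -> R) (t : R) :
  0 < p t -> is_derive p t (p1 t) -> is_derive (fun t => ln (p t)) t (p1 t / p t).
Proof.
  intros Hp Hd. auto_derive; [split; [eexists; eassumption | split; auto] |].
  subst_derive Hd. field. lra.
Qed.

Lemma tame_ln_lipschitz (p p1 p2 : R -> R) (T0 T eps : R) : tame p p1 p2 T0 -> T0 < T ->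
  (forall t, T <= t -> Rabs (p1 t) <= eps * p t) ->
  forall x y, T <= x -> T <= y -> Rabs (ln (p y) - ln (p x)) <= eps * Rabs (y - x).
Proof.
  intros (Hd & _) HT0 HT x y Hx Hy.
  assert (HB : forall w, Rmin x y <= w <= Rmax x y -> T <= w).
  { intros w. unfold Rmin; destruct Rle_dec; lra. }
  apply (lipschitz_of_derive (fun t => ln (p t)) (fun t => p1 t / p t)).
  - intros w Hw. apply HB in Hw. destruct (Hd w) as (Hp & D & _); [lra |].
    apply is_derive_ln_comp; auto.
  - intros w Hw. apply HB in Hw. destruct (Hd w) as (Hp & D & _); [lra |].
    unfold Rdiv. rewrite Rabs_mult, (Rabs_pos_eq (/ p w)) by (left; apply Rinv_0_lt_compat; auto).
    replace eps with (eps * p w * / p w) by (field; lra).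
    apply Rmult_le_compat_r; [left; apply Rinv_0_lt_compat; auto | auto].
Qed.

(** The logarithm of [p] is eventually Lipschitz with an arbitrarily small constant, so m ln p(x) =
    o(x) and x = t + m ln p(x) + O(1) forces x - t = o(t). The factor 1/2 required beyond [X0]
    serves beforehand to show that [x] tends to infinity, where the small constants apply. *)
Lemma tame_displacement (p p1 p2 : R -> R) (T0 m X0 T1 : R) (x : R -> R) :
  tame p p1 p2 T0 -> 0 <= m -> T0 < X0 ->
  (forall y, X0 <= y -> m * Rabs (p1 y) <= / 2 * p y) ->
  (forall t, T1 <= t -> X0 <= x t /\ Rabs (x t - t - m * ln (p (x t))) <= 1) ->
  little_o_id (fun t => x t - t).
Proof.
  intros Hp Hm HX0 Hh Hx. apply little_o_intro. intros d Hd.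
  set (d' := Rmin d 1).
  assert (Hd' : 0 < d') by (apply Rmin_glb_lt; lra).
  assert (Hd1 : d' <= d) by apply Rmin_l. assert (Hd2 : d' <= 1) by apply Rmin_r.
  set (d1 := d' / (4 * (m + 1))).
  assert (Hd3 : 0 < d1) by (apply Rdiv_lt_0_compat; lra).
  assert (Hd4 : m * d1 <= d' / 4).
  { replace (d' / 4) with ((m + 1) * d1) by (unfold d1; field; lra). nra. }
  destruct (tame_ratio _ _ _ _ Hp d1 Hd3) as (T & HT0 & HT & HR).
  assert (HL := tame_ln_lipschitz _ _ _ _ T d1 Hp HT0 (fun t Ht => proj1 (HR t Ht))).
  assert (HL0 : forall y, X0 <= y -> m * Rabs (ln (p y) - ln (p X0)) <= / 2 * (y - X0)).
  { intros y Hy. destruct Hm as [Hm | <-]; [| lra].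
    apply (Rmult_le_reg_l (/ m)); [apply Rinv_0_lt_compat; auto |].
    rewrite <- Rmult_assoc, Rinv_l, Rmult_1_l, <- Rmult_assoc by lra.
    rewrite <- (Rabs_pos_eq (y - X0)) by lra.
    apply (tame_ln_lipschitz p p1 p2 T0 X0); auto; [| lra].
    intros t Ht. specialize (Hh t Ht).
    replace (Rabs (p1 t)) with (/ m * (m * Rabs (p1 t))) by (field; lra).
    rewrite Rmult_assoc. apply Rmult_le_compat_l; [left; apply Rinv_0_lt_compat; auto | auto]. }
  set (A0 := m * Rabs (ln (p X0)) + Rabs X0).
  set (A := 1 + m * Rabs (ln (p T))).
  assert (HA : 1 <= A) by (unfold A; assert (P := Rabs_pos (ln (p T))); nra).
  exists (Rmax T1 (Rmax (2 * T + A0 + 1) (2 * A / d'))). intros t Ht.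
  assert (B1 := Rmax_l T1 (Rmax (2 * T + A0 + 1) (2 * A / d'))).
  assert (B2 := Rmax_r T1 (Rmax (2 * T + A0 + 1) (2 * A / d'))).
  assert (B3 := Rmax_l (2 * T + A0 + 1) (2 * A / d')).
  assert (B4 := Rmax_r (2 * T + A0 + 1) (2 * A / d')).
  destruct (Hx t) as [Hx1 Hx2]; [lra |].
  apply Rabs_le_between in Hx2.
  assert (Hxl := HL0 _ Hx1).
  assert (M1 : m * ln (p (x t)) <= m * Rabs (ln (p (x t)) - ln (p X0)) + m * Rabs (ln (p X0))).
  { assert (U1 := Rle_abs (ln (p (x t)) - ln (p X0))). assert (U2 := Rle_abs (ln (p X0))). nra. }
  assert (M2 : - (m * Rabs (ln (p (x t)) - ln (p X0))) - m * Rabs (ln (p X0)) <= m * ln (p (x t))).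
  { assert (U1 := Rle_abs (- (ln (p (x t)) - ln (p X0)))). assert (U2 := Rle_abs (- ln (p X0))).
    rewrite Rabs_Ropp in U1, U2. nra. }
  assert (U3 := Rle_abs X0). assert (U4 := Rle_abs (- X0)). rewrite Rabs_Ropp in U4.
  assert (P0 := Rabs_pos X0).
  assert (HxT : T <= x t) by (unfold A0 in *; lra).
  assert (HLx := HL T (x t) (Rle_refl _) HxT). rewrite (Rabs_pos_eq (x t - T)) in HLx by lra.
  assert (M3 : Rabs (m * ln (p (x t))) <= m * Rabs (ln (p T)) + d' / 4 * x t).
  { rewrite Rabs_mult, (Rabs_pos_eq m) by lra.
    assert (V : Rabs (ln (p (x t))) <= Rabs (ln (p T)) + Rabs (ln (p (x t)) - ln (p T))).
    { replace (ln (p (x t))) with (ln (p T) + (ln (p (x t)) - ln (p T))) at 1 by ring.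
      apply Rabs_triang. }
    assert (Rabs (ln (p (x t))) <= Rabs (ln (p T)) + d1 * x t) by nra.
    assert (m * d1 * x t <= d' / 4 * x t) by (apply Rmult_le_compat_r; lra).
    nra. }
  apply Rabs_le_between in M3.
  assert (HtA : 2 * A <= d' * t).
  { replace (2 * A) with (d' * (2 * A / d')) by (field; lra). apply Rmult_le_compat_l; lra. }
  assert (M4 : d' / 4 * x t <= / 4 * x t) by (apply Rmult_le_compat_r; lra).
  assert (Ht0 : 0 <= t) by (unfold A0 in *; assert (P := Rabs_pos (ln (p X0))); nra).
  assert (M5 : x t <= 4 / 3 * (t + A)) by (unfold A in *; lra).
  assert (M6 : d' / 4 * x t <= d' / 3 * (t + A)).
  { replace (d' / 3 * (t + A)) with (d' / 4 * (4 / 3 * (t + A))) by field.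
    apply Rmult_le_compat_l; lra. }
  assert (M7 : d' / 3 * A <= / 3 * A) by (apply Rmult_le_compat_r; lra).
  assert (M8 : d' * t <= d * t) by (apply Rmult_le_compat_r; lra).
  apply Rabs_le. unfold A in *. lra.
Qed.

(** * The profile in the logarithmic variable *)

(** The inverse [psi] of k(x) = x - m ln p(x) turns p1/p into a function [H] of k(x) = t + v + m z,
    to which the closed system of [small_solution] applies; [x] is then defined as psi(t + v + m z),
    and x' = exp z is a consequence. *)
Lemma profile_solution (p p1 p2 : R -> R) (T0 a b m : R) :
  tame p p1 p2 T0 -> 0 < a -> 0 < b -> 0 < m -> m * b = a ->
  exists (T1 C : R) (x v z : R -> R), 0 < C /\ little_o_id (fun t => x t - t) /\
    forall t, T1 <= t ->
      T0 < x t /\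
      is_derive x t (exp (z t)) /\
      is_derive z t (- b * (exp (v t) - 1) - p1 (x t) / p (x t) * exp (z t)) /\
      x t = t + m * ln (p (x t)) + v t + m * z t /\
      Rabs (v t + m * z t) <= 1 /\
      Rabs (v t) + Rabs (z t) <= C * Rabs (p1 t) / p t.
Proof.
  intros Hp Ha Hb Hm Hmb.
  destruct (small_solution a b m Ha Hb ltac:(lra)) as (c & eta & K & Hc & Heta & HK & Hsol).
  assert (Hp' := Hp). destruct Hp' as (Hd & _ & HA3 & _ & _ & (C5 & T5 & HT5) & H6).
  (* The bound 1/(2m) gives k' >= 1/2. The bounds eta/4 and 1 give |h'| <= eps + eps^2 <= eta/2, so
     that [H], composed with the 2-Lipschitz [psi], has constant [eta]. The bound c/4 makes ln p
     vary slower than the growth tolerated in the forcing. *)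
  set (eps := Rmin (Rmin (/ (2 * m)) (Rmin (eta / 4) 1)) (c / 4)).
  assert (Heps : 0 < eps).
  { unfold eps. repeat apply Rmin_glb_lt; try lra. apply Rinv_0_lt_compat; lra. }
  assert (He1 : eps <= / (2 * m)) by (eapply Rle_trans; [apply Rmin_l | apply Rmin_l]).
  assert (He2 : eps <= eta / 4).
  { eapply Rle_trans; [apply Rmin_l |]. eapply Rle_trans; [apply Rmin_r | apply Rmin_l]. }
  assert (He3 : eps <= 1).
  { eapply Rle_trans; [apply Rmin_l |]. eapply Rle_trans; [apply Rmin_r | apply Rmin_r]. }
  assert (He4 : eps <= c / 4) by apply Rmin_r.
  assert (He5 : m * eps <= / 2).
  { replace (/ 2) with (m * / (2 * m)) by (field; lra). apply Rmult_le_compat_l; lra. }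
  destruct (tame_ratio _ _ _ _ Hp eps Heps) as (X0 & HX0 & _ & HR).
  set (h := fun x => p1 x / p x).
  assert (Hh : forall x, X0 <= x -> Rabs (h x) <= eps).
  { intros x Hx. destruct (Hd x) as (Px & _); [lra |]. unfold h, Rdiv.
    rewrite Rabs_mult, (Rabs_pos_eq (/ p x)) by (left; apply Rinv_0_lt_compat; auto).
    replace eps with (eps * p x * / p x) by (field; lra).
    apply Rmult_le_compat_r; [left; apply Rinv_0_lt_compat; auto | apply HR; auto]. }
  set (k := fun x => x - m * ln (p x)).
  assert (Hk : forall x, X0 <= x -> is_derive k x (1 - m * h x)).
  { intros x Hx. destruct (Hd x) as (Px & Dx & _); [lra |].
    assert (D := is_derive_ln_comp p p1 x Px Dx). unfold k. auto_derive.
    - split; [eexists; eassumption | auto].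
    - subst_derive Dx. unfold h. field. lra. }
  assert (Hk2 : forall x, X0 <= x -> / 2 <= 1 - m * h x).
  { intros x Hx. specialize (Hh x Hx). apply Rabs_le_between in Hh. nra. }
  assert (Hkm : forall x y, X0 <= x -> x <= y -> / 2 * (y - x) <= k y - k x).
  { intros x y Hx Hxy.
    enough (k x - / 2 * x <= k y - / 2 * y) by lra.
    apply (derive_nonneg_incr (fun s => k s - / 2 * s) (fun s => 1 - m * h s - / 2)); [auto | |].
    - intros s Hs. assert (D := Hk s ltac:(lra)). auto_derive; [eexists; eassumption |].
      subst_derive D. ring.
    - intros s Hs. specialize (Hk2 s ltac:(lra)). lra. }
  assert (Hkabs : forall x y, X0 <= x -> X0 <= y -> Rabs (x - y) <= 2 * Rabs (k x - k y)).
  { intros x y Hx Hy. destruct (Rle_lt_dec x y) as [hxy | hxy].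
    - specialize (Hkm x y Hx hxy). rewrite Rabs_minus_sym, (Rabs_minus_sym (k x)), !Rabs_pos_eq by lra. lra.
    - specialize (Hkm y x Hy ltac:(lra)). rewrite !Rabs_pos_eq by lra. lra. }
  assert (Hkc : forall x, X0 <= x -> continuous k x).
  { intros x Hx. apply (ex_derive_continuous k x). eexists; apply Hk; auto. }
  set (S0 := k X0).
  assert (Hinv : forall s, exists x, S0 <= s -> X0 <= x /\ k x = s).
  { intros s. destruct (Rle_lt_dec S0 s) as [hs | hs]; [| exists 0; intros; lra].
    destruct (ivt_incr k X0 (X0 + 2 * (s - S0)) s) as (x & Hx & E); [lra | | |].
    - intros x Hx. apply Hkc. lra.
    - specialize (Hkm X0 (X0 + 2 * (s - S0)) ltac:(lra) ltac:(lra)). fold S0 in Hkm |- *. lra.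
    - exists x. intros _. split; [lra | auto]. }
  destruct (ClassicalEpsilon.choice _ Hinv) as [psi Hpsi].
  assert (Hpsik : forall x, X0 <= x -> psi (k x) = x).
  { intros x Hx. destruct (Hpsi (k x)) as [A1 A2].
    - unfold S0. specialize (Hkm X0 x ltac:(lra) Hx). lra.
    - specialize (Hkabs (psi (k x)) x A1 Hx). rewrite A2, Rminus_diag, Rabs_R0, Rmult_0_r in Hkabs.
      assert (P := Rabs_pos (psi (k x) - x)).
      assert (E : Rabs (psi (k x) - x) = 0) by lra. apply Rabs_eq_0 in E. lra. }
  assert (Hpsil : forall s s', S0 <= s -> S0 <= s' -> Rabs (psi s - psi s') <= 2 * Rabs (s - s')).
  { intros s s' Hs Hs'. destruct (Hpsi s Hs) as [A1 A2]. destruct (Hpsi s' Hs') as [A3 A4].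
    rewrite <- A2 at 2. rewrite <- A4 at 2. apply Hkabs; auto. }
  assert (Hhd : forall x, X0 <= x -> is_derive h x (p2 x / p x - h x ^ 2)).
  { intros x Hx. destruct (Hd x) as (Px & D1 & D2); [lra |]. unfold h. auto_derive.
    - repeat split; try (eexists; eassumption). lra.
    - subst_derive D1. subst_derive D2. field. lra. }
  assert (Hhl : forall x y, X0 <= x -> X0 <= y -> Rabs (h y - h x) <= eta / 2 * Rabs (y - x)).
  { intros x y Hx Hy.
    assert (HBt : forall w, Rmin x y <= w <= Rmax x y -> X0 <= w).
    { intros w. unfold Rmin; destruct Rle_dec; lra. }
    apply (lipschitz_of_derive h (fun x => p2 x / p x - h x ^ 2)).
    - intros w Hw. apply Hhd. apply HBt; auto.
    - intros w Hw. apply HBt in Hw. destruct (Hd w) as (Pw & _); [lra |].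
      destruct (HR w Hw) as [_ R2].
      assert (Rabs (p2 w / p w) <= eps).
      { unfold Rdiv. rewrite Rabs_mult, (Rabs_pos_eq (/ p w)) by (left; apply Rinv_0_lt_compat; auto).
        replace eps with (eps * p w * / p w) by (field; lra).
        apply Rmult_le_compat_r; [left; apply Rinv_0_lt_compat; auto | auto]. }
      specialize (Hh w Hw).
      eapply Rle_trans; [apply Rabs_triang |]. rewrite Rabs_Ropp, <- RPow_abs.
      assert (P := Rabs_pos (h w)). nra. }
  (* Below [S0] the value of [psi] is an arbitrary choice, so the argument is cut there. As |v + m
     z| <= 1, the cut is inactive from time S0 + 2 on. *)
  set (H := fun s => h (psi (Rmax s S0))).
  assert (Hmax : forall s, S0 <= Rmax s S0) by (intros; apply Rmax_r).
  destruct (Hsol H) as (v & z & Hvz & Hbd).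
  { intros s. eapply Rle_trans; [apply Hh; apply Hpsi; auto |]. lra. }
  { intros s s'. unfold H.
    eapply Rle_trans; [apply Hhl; apply Hpsi; auto |].
    assert (Rabs (psi (Rmax s S0) - psi (Rmax s' S0)) <= 2 * Rabs (Rmax s S0 - Rmax s' S0))
      by (apply Hpsil; auto).
    assert (Rabs (Rmax s S0 - Rmax s' S0) <= Rabs (s - s')).
    { unfold Rmax; repeat destruct Rle_dec; unfold Rabs; repeat destruct Rcase_abs; lra. }
    nra. }
  set (x := fun t => psi (t + v t + m * z t)).
  assert (Harg : forall t, S0 + 2 <= t -> S0 + 1 <= t + v t + m * z t).
  { intros t Ht. destruct (Hvz t) as (_ & _ & B). apply Rabs_le_between in B. lra. }
  assert (Hx : forall t, S0 + 2 <= t -> X0 < x t /\ k (x t) = t + v t + m * z t).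
  { intros t Ht. specialize (Harg t Ht). destruct (Hpsi (t + v t + m * z t)) as [A1 A2]; [lra |].
    split; [| exact A2]. fold (x t) in A1, A2. destruct A1 as [A1 | A1]; [auto |].
    exfalso. rewrite <- A1 in A2. fold S0 in A2. lra. }
  assert (Hmh : forall y, X0 <= y -> m * Rabs (p1 y) <= / 2 * p y).
  { intros y Hy. destruct (HR y Hy) as [R1 _]. destruct (Hd y) as (Py & _); [lra |].
    apply Rle_trans with (m * (eps * p y)); [apply Rmult_le_compat_l; lra | nra]. }
  assert (Hpsi_o : little_o_id (fun s => psi s - s)).
  { apply (tame_displacement p p1 p2 T0 m X0 S0 psi); auto; [lra |].
    intros s Hs. destruct (Hpsi s Hs) as [A1 A2]. split; [auto |].
    unfold k in A2. replace (psi s - s - m * ln (p (psi s))) with 0 by lra. rewrite Rabs_R0. lra. }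
  assert (Hx_o : little_o_id (fun t => x t - t)).
  { apply (tame_displacement p p1 p2 T0 m X0 (S0 + 2) x); auto; [lra |].
    intros t Ht. destruct (Hx t Ht) as [A1 A2]. destruct (Hvz t) as (_ & _ & B).
    split; [lra |]. unfold k in A2.
    replace (x t - t - m * ln (p (x t))) with (v t + m * z t) by lra. auto. }
  destruct (proj1 (is_lim_infty_eps _ _) (HA3 _ Hpsi_o) 1 Rlt_0_1) as [T3 HT3].
  destruct (bigO_infty_nonneg _ _ (H6 _ Hpsi_o)) as (C6 & T6 & HC6 & HT6).
  set (T := Rmax (Rmax (S0 + 2) X0) (Rmax T3 (Rmax T5 T6))).
  assert (HTS : S0 + 2 <= T) by (eapply Rle_trans; [| apply Rmax_l]; apply Rmax_l).
  assert (HTX : X0 <= T) by (eapply Rle_trans; [| apply Rmax_l]; apply Rmax_r).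
  assert (HTT3 : T3 <= T) by (eapply Rle_trans; [| apply Rmax_r]; apply Rmax_l).
  assert (HTT5 : T5 <= T).
  { eapply Rle_trans; [| apply Rmax_r]. eapply Rle_trans; [| apply Rmax_r]. apply Rmax_l. }
  assert (HTT6 : T6 <= T).
  { eapply Rle_trans; [| apply Rmax_r]. eapply Rle_trans; [| apply Rmax_r]. apply Rmax_r. }
  set (C0 := 2 * C6 * (Rabs C5 + 1)).
  assert (PC5 := Rabs_pos C5).
  assert (HC0 : 0 < C0) by (unfold C0; apply Rmult_lt_0_compat; lra).
  (* The forcing at the later time s is measured by p1/p at time t: the bound on later values of
     [p1] handles the numerator, up to the o(s) displacement of [psi], and the slow variation of [p]
     costs the factor exp(c(s - t)/4). *)
  assert (HH : forall t s, T <= t -> t <= s ->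
    Rabs (H s) <= C0 * Rabs (p1 t) / p t * exp (c / 4 * (s - t))).
  { intros t s Ht Hs. unfold H. rewrite Rmax_left by lra. unfold h.
    destruct (Hpsi s ltac:(lra)) as [A1 _].
    destruct (Hd s) as (Ps & _); [lra |]. destruct (Hd t) as (Pt & _); [lra |].
    destruct (Hd (psi s)) as (Pps & _); [lra |].
    specialize (HT3 s ltac:(lra)). specialize (HT6 s ltac:(lra)). cbv beta in HT6.
    replace (s + (psi s - s)) with (psi s) in HT3, HT6 by ring.
    apply Rabs_def2 in HT3.
    assert (Hs2 : / p (psi s) <= 2 * / p s).
    { apply (Rmult_le_reg_l (p s)); [auto |].
      replace (p s * (2 * / p s)) with 2 by (field; lra).
      unfold Rdiv in HT3. lra. }
    specialize (HT5 t s ltac:(lra) Hs).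
    assert (Hps : p t <= p s * exp (c / 4 * (s - t))).
    { rewrite <- (exp_ln (p t)), <- (exp_ln (p s)), <- exp_plus by auto. apply exp_le_compat.
      assert (L := tame_ln_lipschitz _ _ _ _ X0 eps Hp HX0 (fun t Ht => proj1 (HR t Ht)) t s ltac:(lra) ltac:(lra)).
      rewrite (Rabs_pos_eq (s - t)) in L by lra. apply Rabs_le_between in L.
      assert (eps * (s - t) <= c / 4 * (s - t)) by (apply Rmult_le_compat_r; lra). lra. }
    assert (Hps' : / p s <= / p t * exp (c / 4 * (s - t))).
    { apply (Rmult_le_reg_l (p s)); [auto |]. apply (Rmult_le_reg_l (p t)); [auto |].
      replace (p t * (p s * / p s)) with (p t) by (field; lra).
      replace (p t * (p s * (/ p t * exp (c / 4 * (s - t))))) with (p s * exp (c / 4 * (s - t)))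
        by (field; lra). auto. }
    unfold Rdiv. rewrite Rabs_mult, (Rabs_pos_eq (/ p (psi s))) by (left; apply Rinv_0_lt_compat; auto).
    assert (Q1 : Rabs (p1 (psi s)) <= C6 * ((Rabs C5 + 1) * Rabs (p1 t))).
    { eapply Rle_trans; [apply HT6 |]. apply Rmult_le_compat_l; [lra |].
      eapply Rle_trans; [apply HT5 |]. apply Rmult_le_compat_r; [apply Rabs_pos |].
      assert (L := Rle_abs C5). lra. }
    assert (Q2 : / p (psi s) <= 2 * (/ p t * exp (c / 4 * (s - t)))) by lra.
    apply Rle_trans with
      (C6 * ((Rabs C5 + 1) * Rabs (p1 t)) * (2 * (/ p t * exp (c / 4 * (s - t)))));
      [| apply Req_le; unfold C0, Rdiv; ring].
    apply Rmult_le_compat; [apply Rabs_pos | left; apply Rinv_0_lt_compat; auto | exact Q1 | exact Q2]. }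
  exists T, (2 * (K + 1) * C0), x, v, z.
  split; [apply Rmult_lt_0_compat; lra |]. split; [exact Hx_o |].
  intros t Ht.
  destruct (Hx t ltac:(lra)) as [Hx1 Hx2].
  destruct (Hvz t) as (Dv & Dz & B).
  specialize (Harg t ltac:(lra)).
  destruct (Hd t) as (Pt & _); [lra |].
  assert (EH : H (t + v t + m * z t) = h (x t)).
  { unfold H. rewrite Rmax_left by lra. reflexivity. }
  rewrite EH in Dz.
  split; [lra |]. split; [| split; [exact Dz | split; [| split; [exact B |]]]].
  (* Since m b = a, the terms in exp v cancel and t + v + m z has derivative (1 - m h(x)) exp z; the
     first factor is k'(x) and cancels against the derivative of [psi]. *)
  - assert (Dpsi : is_derive psi (k (x t)) (/ (1 - m * h (x t)))).
    { apply (is_derive_inverse k (fun x => 1 - m * h x) psi (x t) (x t - X0)); [lra | |].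
      - intros y Hy. apply Rabs_def2 in Hy.
        split; [apply Hk; lra |]. split; [| apply Hpsik; lra].
        specialize (Hk2 y ltac:(lra)). lra.
      - apply (continuous_minus (fun _ => 1) (fun x => m * h x)); [apply continuous_const |].
        apply (continuous_scal_r m h). apply (ex_derive_continuous h). eexists. apply Hhd. lra. }
    rewrite Hx2 in Dpsi.
    unfold x. evar_last.
    { apply (is_derive_comp psi (fun t => t + v t + m * z t)); [exact Dpsi |].
      apply (is_derive_plus (fun t => t + v t) (fun t => m * z t)).
      - apply (is_derive_plus (fun t => t) v); [apply is_derive_id | exact Dv].
      - apply is_derive_scal. exact Dz. }
    specialize (Hk2 (x t) ltac:(lra)).
    unfold scal, plus, one; simpl. unfold mult; simpl.
    rewrite <- Hmb. field. lra.
  - unfold k in Hx2. lra.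
  - set (M := C0 * Rabs (p1 t) / p t) in *.
    assert (HM : 0 <= M).
    { unfold M, Rdiv. apply Rmult_le_pos; [| left; apply Rinv_0_lt_compat; auto].
      apply Rmult_le_pos; [lra | apply Rabs_pos]. }
    destruct (Rabs_le_of_sum_squares (v t) (z t) ((K + 1) * M)).
    + eapply Rle_trans; [apply (Hbd t M HM); intros s Hs; apply HH; auto |].
      rewrite Rpow_mult_distr. apply Rmult_le_compat_r; [apply pow2_ge_0 | nra].
    + nra.
    + replace (2 * (K + 1) * C0 * Rabs (p1 t) / p t) with (2 * ((K + 1) * M)) by (unfold M; field; lra).
      lra.
Qed.

(** * Regularity of the inverse function and of the extended nonlinearity *)

(** Comes from differentiating g' = 1 / f'(g) twice. The formula is available only on the open
    half-line beyond [f 0], so each differentiation goes through equality near a point. *)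
Lemma inverse_regularity (f g : R -> R) :
  (forall u, 0 <= u -> g (f u) = u) ->
  (forall t, f 0 <= t -> 0 <= g t /\ f (g t) = t) ->
  Ck_on_Ico0_infty 4 f -> (forall x, 0 < x -> 0 < Derive f x) ->
  forall t, f 0 < t -> 0 < g t /\ is_derive g t (Derive g t) /\ 0 < Derive g t /\
    is_derive (Derive g) t (Derive_n g 2 t) /\ is_derive (Derive_n g 2) t (Derive_n g 3 t).
Proof.
  intros Hgf Hfg [Hreg _] Hpos.
  assert (Hg : forall t, f 0 < t -> 0 < g t).
  { intros t Ht. destruct (Hfg t) as [[A | A] B]; [lra | auto |].
    exfalso. rewrite <- A in B. lra. }
  assert (D1 : forall x, 0 < x -> is_derive f x (Derive f x)).
  { intros x Hx. apply Derive_correct. apply (proj1 (Hreg x Hx) 1%nat). lia. }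
  assert (D2 : forall x, 0 < x -> is_derive (Derive f) x (Derive_n f 2 x)).
  { intros x Hx. apply Derive_correct. apply (proj1 (Hreg x Hx) 2%nat). lia. }
  assert (D3 : forall x, 0 < x -> is_derive (Derive_n f 2) x (Derive_n f 3 x)).
  { intros x Hx. apply Derive_correct. apply (proj1 (Hreg x Hx) 3%nat). lia. }
  assert (G1 : forall t, f 0 < t -> is_derive g t (/ Derive f (g t))).
  { intros t Ht. assert (Pt := Hg t Ht). destruct (Hfg t) as [_ B]; [lra |].
    rewrite <- B at 1. apply (is_derive_inverse f (Derive f) g (g t) (g t)); [auto | |].
    - intros x Hx. apply Rabs_def2 in Hx.
      split; [apply D1; lra | split; [apply Hpos; lra | apply Hgf; lra]].
    - apply (ex_derive_continuous (Derive f)). eexists. apply D2; auto. }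
  assert (Hloc : forall t, f 0 < t -> locally t (fun s => f 0 < s)).
  { intros t Ht. apply (open_gt (f 0) t Ht). }
  set (g2 := fun t => - Derive_n f 2 (g t) * / Derive f (g t) / Derive f (g t) ^ 2).
  assert (G2' : forall t, f 0 < t -> is_derive (fun t => / Derive f (g t)) t (g2 t)).
  { intros t Ht. assert (Pt := Hg t Ht). assert (Pd := Hpos _ Pt).
    assert (E1 := G1 t Ht). assert (E2 := D2 _ Pt). unfold g2. auto_derive.
    - repeat split; try (eexists; eassumption); lra.
    - subst_derive E1. subst_derive E2. field. lra. }
  assert (G2 : forall t, f 0 < t -> is_derive (Derive g) t (g2 t)).
  { intros t Ht. apply (is_derive_ext_loc (fun t => / Derive f (g t))); [| apply G2'; auto].
    generalize (Hloc t Ht). apply filter_imp. intros s Hs. symmetry.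
    apply is_derive_unique. apply G1; auto. }
  assert (G3 : forall t, f 0 < t -> ex_derive g2 t).
  { intros t Ht. assert (Pt := Hg t Ht). assert (Pd := Hpos _ Pt).
    assert (E1 := G1 t Ht). assert (E2 := D2 _ Pt). assert (E3 := D3 _ Pt). unfold g2.
    auto_derive. repeat split; try (eexists; eassumption); try lra.
    apply Rmult_integral_contrapositive_currified; [lra |]. apply Rmult_integral_contrapositive_currified; lra. }
  intros t Ht. assert (Pt := Hg t Ht). assert (Pd := Hpos _ Pt).
  split; [auto |].
  split; [apply Derive_correct; eexists; apply G1; auto |].
  split; [rewrite (is_derive_unique _ _ _ (G1 t Ht)); apply Rinv_0_lt_compat; auto |].
  split; [apply Derive_correct; eexists; apply G2; auto |].
  apply Derive_correct. apply (ex_derive_ext_loc g2); [| apply G3; auto].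
  generalize (Hloc t Ht). apply filter_imp. intros s Hs. symmetry.
  apply is_derive_unique. apply G2; auto.
Qed.

(* [f] carries no information on negative reals, so it is extended by the constant [f 0]. *)
Lemma extension_regularity (f : R -> R) :
  Ck_on_Ico0_infty 4 f -> (forall x, 0 < x -> 0 < Derive f x) ->
  let fe := fun x => f (Rmax x 0) in
  (forall x y, x <= y -> fe x <= fe y) /\
  forall A, exists L, 0 < L /\ forall x y, x <= A -> y <= A -> Rabs (fe x - fe y) <= L * Rabs (x - y).
Proof.
  intros (Hreg & H0 & Hlim) Hpos fe.
  assert (D1 : forall x, 0 < x -> is_derive f x (Derive f x)).
  { intros x Hx. apply Derive_correct. apply (proj1 (Hreg x Hx) 1%nat). lia. }
  assert (C1 : forall x, 0 < x -> continuous (Derive f) x).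
  { intros x Hx. apply (ex_derive_continuous (Derive f)). apply (proj1 (Hreg x Hx) 2%nat). lia. }
  assert (E1 : forall x, 0 < x -> is_derive fe x (Derive f x)).
  { intros x Hx. apply (is_derive_ext_loc f); [| apply D1; auto].
    generalize (open_gt 0 x Hx). apply filter_imp. intros s Hs. unfold fe. rewrite Rmax_left; lra. }
  assert (Ce : forall x, 0 <= x -> continuous fe x).
  { intros x [Hx | <-]; [apply (ex_derive_continuous fe); eexists; apply E1; auto |].
    apply continuous_eps. intros eps Heps.
    destruct (proj1 (filterlim_locally _ _) H0 (mkposreal eps Heps)) as [d Hd].
    exists d. split; [apply cond_pos |]. intros y Hy. unfold fe. rewrite (Rmax_left 0 0) by lra.
    destruct (Rle_lt_dec y 0) as [h | h].
    - rewrite Rmax_right, Rminus_diag, Rabs_R0 by lra. auto.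
    - rewrite Rmax_left by lra. apply (Hd y Hy h). }
  (* The mean value theorem may return the endpoint 0, where [fe] can fail to be differentiable; the
     default value 0 keeps both the sign and the bound of [df] valid there. *)
  set (df := fun x => if Rle_dec x 0 then 0 else Derive f x).
  assert (Hmvt : forall x y, 0 <= x -> x <= y -> exists w, x <= w <= y /\ fe y - fe x = df w * (y - x)).
  { intros x y Hx Hxy. destruct (MVT_gen fe x y df) as [w [Hw E]].
    - rewrite Rmin_left, Rmax_right by lra. intros w Hw. unfold df.
      destruct Rle_dec; [lra |]. apply E1; lra.
    - rewrite Rmin_left, Rmax_right by lra. intros w Hw.
      apply continuity_pt_filterlim. apply Ce. lra.
    - rewrite Rmin_left, Rmax_right in Hw by lra. exists w. auto. }
  assert (Hfe : forall x, fe (Rmax x 0) = fe x).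
  { intros x. unfold fe. f_equal. apply Rmax_left, Rmax_r. }
  split.
  - intros x y Hxy. rewrite <- (Hfe x), <- (Hfe y).
    assert (A1 := Rmax_r x 0).
    assert (A2 : Rmax x 0 <= Rmax y 0) by (apply Rle_max_compat_r; auto).
    destruct (Hmvt _ _ A1 A2) as (w & Hw & E).
    assert (0 <= df w).
    { unfold df. destruct Rle_dec; [lra |]. left. apply Hpos. lra. }
    nra.
  - intros A.
    (* Near 0 the derivative is bounded through its one-sided limit, on the remaining compact
       interval through continuity. *)
    destruct (Hlim 1%nat ltac:(lia)) as [l Hl].
    destruct (proj1 (filterlim_locally _ _) Hl (mkposreal 1 Rlt_0_1)) as [d Hd].
    assert (Pd := cond_pos d).
    assert (HM : exists M, forall x, d / 2 <= x <= A -> Rabs (Derive f x) <= M).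
    { destruct (Rle_lt_dec (d / 2) A) as [h | h]; [| exists 0; intros; lra].
      destruct (continuity_ab_maj (fun x => Rabs (Derive f x)) (d / 2) A h) as (M & HM & _).
      - intros x Hx. apply continuity_pt_filterlim.
        apply (continuous_comp (Derive f) Rabs); [apply C1; lra | apply continuous_Rabs].
      - exists (Rabs (Derive f M)). exact HM. }
    destruct HM as [M HM].
    set (L := Rabs l + 1 + Rabs M).
    assert (Pl := Rabs_pos l). assert (PM := Rabs_pos M).
    assert (HL : forall w, w <= A -> Rabs (df w) <= L).
    { intros w Hw. unfold df, L. destruct Rle_dec as [h | h]; [rewrite Rabs_R0; lra |].
      destruct (Rle_lt_dec (d / 2) w) as [h' | h'].
      - assert (H1 := HM w ltac:(lra)). assert (H2 := Rle_abs M). lra.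
      - assert (B : Rabs (Derive f w - l) < 1).
        { apply (Hd w); [| lra]. unfold ball; simpl. unfold AbsRing_ball, abs, minus, plus, opp; simpl.
          apply Rabs_def1; lra. }
        replace (Derive f w) with (l + (Derive f w - l)) by ring.
        eapply Rle_trans; [apply Rabs_triang |]. lra. }
    exists L. split; [unfold L; lra |].
    assert (Hord : forall x y, y <= A -> x <= y -> Rabs (fe x - fe y) <= L * Rabs (x - y)).
    { intros x y Hy Hxy. rewrite <- (Hfe x), <- (Hfe y).
      destruct (Rle_lt_dec y 0) as [h | h].
      - rewrite !Rmax_right, Rminus_diag, Rabs_R0 by lra.
        apply Rmult_le_pos; [unfold L; lra | apply Rabs_pos].
      - assert (A1 := Rmax_r x 0). rewrite (Rmax_left y 0) by lra.
        assert (A2 : Rmax x 0 <= y) by (apply Rmax_lub; lra).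
        assert (A3 := Rmax_l x 0).
        destruct (Hmvt _ _ A1 A2) as (w & Hw & E).
        rewrite Rabs_minus_sym, E, Rabs_mult. apply Rmult_le_compat; auto using Rabs_pos.
        + apply HL. lra.
        + rewrite (Rabs_minus_sym x), !Rabs_pos_eq by lra. lra. }
    intros x y Hx Hy. destruct (Rle_lt_dec x y) as [h | h]; [apply Hord; auto |].
    rewrite Rabs_minus_sym, (Rabs_minus_sym x). apply Hord; lra.
Qed.

(** * Asymptotic expansion of the profile *)

Lemma little_o_elim (h : R -> R) : little_o_id h ->
  forall d, 0 < d -> exists T, 0 < T /\ forall t, T <= t -> Rabs (h t) <= d * t.
Proof.
  intros H d Hd. destruct (proj1 (is_lim_infty_eps _ _) H d Hd) as [T HT].
  exists (Rmax T 1). assert (B1 := Rmax_l T 1). assert (B2 := Rmax_r T 1).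
  split; [lra |]. intros t Ht. specialize (HT t ltac:(lra)).
  rewrite Rminus_0_r in HT. unfold Rdiv in HT.
  rewrite Rabs_mult, (Rabs_pos_eq (/ t)) in HT by (left; apply Rinv_0_lt_compat; lra).
  replace (Rabs (h t)) with (Rabs (h t) * / t * t) by (field; lra).
  apply Rmult_le_compat_r; lra.
Qed.

Lemma little_o_shift (h : R -> R) (k c : R) : little_o_id h -> little_o_id (fun s => h (s + k) + c).
Proof.
  intros H. apply little_o_intro. intros d Hd.
  destruct (little_o_elim h H (d / 2)) as (T & HT0 & HT); [lra |].
  set (B := Rabs k * d + 2 * Rabs c).
  assert (Pk := Rabs_pos k). assert (Pc := Rabs_pos c).
  assert (HB : 0 <= B) by (unfold B; nra).
  exists (Rmax (T - k) (B / d)). intros t Ht.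
  assert (B1 := Rmax_l (T - k) (B / d)). assert (B2 := Rmax_r (T - k) (B / d)).
  specialize (HT (t + k) ltac:(lra)).
  assert (H2 : B <= d * t).
  { replace B with (d * (B / d)) by (field; lra). apply Rmult_le_compat_l; lra. }
  eapply Rle_trans; [apply Rabs_triang |].
  assert (Hk := Rle_abs k). unfold B in H2. nra.
Qed.

Lemma little_o_const (k : R) : little_o_id (fun _ => k).
Proof.
  apply little_o_intro. intros d Hd. exists (Rabs k / d). intros t Ht.
  replace (Rabs k) with (d * (Rabs k / d)) by (field; lra). apply Rmult_le_compat_l; lra.
Qed.

Lemma ratio_within_two (x y : R) : 0 < x -> 0 < y -> Rabs (x / y - 1) < / 2 ->
  x <= 2 * y /\ y <= 2 * x /\ Rabs (ln x - ln y) <= 1.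
Proof.
  intros Hx Hy H. apply Rabs_def2 in H.
  assert (E : x = x / y * y) by (field; lra).
  assert (x <= 2 * y) by nra. assert (y <= 2 * x) by nra.
  split; [auto |]. split; [auto |].
  assert (L2 : ln 2 <= 1).
  { rewrite <- (ln_exp 1). apply ln_le; [lra |]. assert (I := exp_ineq1_le 1). lra. }
  assert (ln x <= ln 2 + ln y) by (rewrite <- ln_mult by lra; apply ln_le; lra).
  assert (ln y <= ln 2 + ln x) by (rewrite <- ln_mult by lra; apply ln_le; lra).
  apply Rabs_le. lra.
Qed.

(** Taylor's formula, with the remainder bounded through the product p2(w) (y - s)^2 at each
    intermediate [w]. In the application the increment is O(1 + |ln p(w)|), so this product is what
    the assumption on p2 (ln p)^2 controls. *)
Lemma second_order_expansion (p p1 p2 : R -> R) (s y E : R) :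
  (forall w, Rmin s y <= w <= Rmax s y -> is_derive p w (p1 w) /\ is_derive p1 w (p2 w)) ->
  (forall w, Rmin s y <= w <= Rmax s y -> Rabs (p2 w) * (y - s) ^ 2 <= E) ->
  Rabs (p y - p s - p1 s * (y - s)) <= E.
Proof.
  intros Hd HE.
  destruct (Req_dec y s) as [-> | Hys].
  - rewrite !Rminus_diag, Rmult_0_r, Rminus_0_r, Rabs_R0.
    eapply Rle_trans; [| apply (HE s)].
    + apply Rmult_le_pos; [apply Rabs_pos | apply pow2_ge_0].
    + rewrite Rmin_left, Rmax_left; lra.
  - assert (Hpos : 0 < Rabs (y - s)) by (apply Rabs_pos_lt; lra).
    set (B := E / (y - s) ^ 2).
    assert (HB : forall w, Rmin s y <= w <= Rmax s y -> Rabs (p2 w) <= B).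
    { intros w Hw. unfold B. apply (Rmult_le_reg_r ((y - s) ^ 2)); [rewrite <- pow2_abs; apply pow_lt; auto |].
      replace (E / (y - s) ^ 2 * (y - s) ^ 2) with E by (field; lra). auto. }
    assert (Hsub : forall w x, Rmin s y <= w <= Rmax s y -> Rmin s w <= x <= Rmax s w ->
      Rmin s y <= x <= Rmax s y).
    { intros w x. unfold Rmin, Rmax; repeat destruct Rle_dec; lra. }
    assert (H1 : forall w, Rmin s y <= w <= Rmax s y -> Rabs (p1 w - p1 s) <= B * Rabs (y - s)).
    { intros w Hw. eapply Rle_trans.
      - apply (lipschitz_of_derive p1 p2 s w B).
        + intros x Hx. apply (Hd x). eauto.
        + intros x Hx. apply HB. eauto.
      - apply Rmult_le_compat_l.
        + eapply Rle_trans; [apply Rabs_pos | apply (HB s)]. unfold Rmin, Rmax; destruct Rle_dec; lra.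
        + revert Hw. unfold Rmin, Rmax, Rabs; destruct Rle_dec; repeat destruct Rcase_abs; lra. }
    replace (p y - p s - p1 s * (y - s)) with ((p y - p1 s * y) - (p s - p1 s * s)) by ring.
    replace E with (B * Rabs (y - s) * Rabs (y - s)).
    + apply (lipschitz_of_derive (fun w => p w - p1 s * w) (fun w => p1 w - p1 s)); [| exact H1].
      intros w Hw. destruct (Hd w Hw) as [D _]. auto_derive; [eexists; exact D |].
      subst_derive D. ring.
    + replace (B * Rabs (y - s) * Rabs (y - s)) with (B * Rabs (y - s) ^ 2) by ring.
      rewrite pow2_abs. unfold B. field. lra.
Qed.

(** Let y = x(s + k1) and tau = s + k2. Then y - tau = m ln p(y) + O(1), and expanding [p] around
    tau gives p(y) = p(tau) + m p1(tau) ln p(tau) + O(p1). Taking logarithms, the argument of [g]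
    differs from y by O(p1/p), and the slope of [g], comparable to [p], turns this into O(p1).
    Shifts by constants and by o(s) allow all errors to be compared at the same time s. *)
Lemma profile_asymptotics (g p p1 p2 : R -> R) (T0 m k1 k2 C T1 : R) (x v z : R -> R) :
  tame p p1 p2 T0 -> bigO_infty (fun t => p2 t * ln (p t) ^ 2) p1 ->
  (forall t, T0 < t -> is_derive g t (p t)) -> 0 < m -> 0 < C ->
  little_o_id (fun t => x t - t) ->
  (forall t, T1 <= t ->
     x t = t + m * ln (p (x t)) + v t + m * z t /\ Rabs (v t + m * z t) <= 1 /\
     Rabs (v t) + Rabs (z t) <= C * Rabs (p1 t) / p t) ->
  exists C' S, forall s, S <= s ->
    Rabs (g (x (s + k1)) -
          g (s + k1 + m * ln (p (s + k2) + m * p1 (s + k2) * ln (p (s + k2))))) <= C' * Rabs (p1 s).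
Proof.
  intros Hp HA5 Hg Hm HC Hxo Hx.
  assert (Hp' := Hp). destruct Hp' as (Hd & _ & HA3 & _ & HA50 & (C5' & T5 & HT5') & H6).
  set (C5 := Rabs C5' + 1).
  assert (HC5 : 0 < C5) by (unfold C5; assert (P := Rabs_pos C5'); lra).
  assert (HT5 : forall t s, T5 <= t -> t <= s -> Rabs (p1 s) <= C5 * Rabs (p1 t)).
  { intros t s Ht Hs. eapply Rle_trans; [apply HT5'; eauto |].
    apply Rmult_le_compat_r; [apply Rabs_pos |]. unfold C5. assert (I := Rle_abs C5'). lra. }
  clear HT5'.
  assert (Hyo : little_o_id (fun s => x (s + k1) - (s + k1) + k1)) by (apply (little_o_shift _ k1 k1 Hxo)).
  assert (HA3y := proj1 (is_lim_infty_eps _ _) (HA3 _ Hyo) (/ 2) ltac:(lra)).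
  assert (HA31 := proj1 (is_lim_infty_eps _ _) (HA3 _ (little_o_const k1)) (/ 2) ltac:(lra)).
  assert (HA32 := proj1 (is_lim_infty_eps _ _) (HA3 _ (little_o_const k2)) (/ 2) ltac:(lra)).
  destruct HA3y as [Ty HTy]. destruct HA31 as [Ta HTa]. destruct HA32 as [Tb HTb].
  destruct (bigO_infty_nonneg _ _ (H6 _ Hyo)) as (Cy & Ty' & HCy & HTy').
  destruct (bigO_infty_nonneg _ _ (H6 _ (little_o_const k1))) as (Ca & Ta' & HCa & HTa').
  destruct (bigO_infty_nonneg _ _ (H6 _ (little_o_const k2))) as (Cb & Tb' & HCb & HTb').
  destruct (bigO_infty_nonneg _ _ HA50) as (D0 & Te & HD0 & HTe).
  destruct (bigO_infty_nonneg _ _ HA5) as (D2 & Tf & HD2 & HTf).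
  set (K1 := Rabs (k1 - k2) + 1).
  assert (HK1 : 1 <= K1) by (unfold K1; assert (P := Rabs_pos (k1 - k2)); lra).
  set (CE := (8 * K1 ^ 2 * D0 + 8 * m ^ 2 * D2) * (C5 * (Cy + Cb))).
  assert (HCE : 0 < CE).
  { unfold CE. apply Rmult_lt_0_compat; [| apply Rmult_lt_0_compat; lra].
    assert (0 < K1 ^ 2 * D0) by (apply Rmult_lt_0_compat; [apply pow_lt |]; lra).
    assert (0 < m ^ 2 * D2) by (apply Rmult_lt_0_compat; [apply pow_lt |]; lra). lra. }
  set (C2 := CE + Cb * (K1 + 2 * m)).
  assert (HC2 : 0 < C2) by (unfold C2; assert (0 < Cb * (K1 + 2 * m)) by (apply Rmult_lt_0_compat; lra); lra).
  set (C3 := 4 * m * C2 + 2 * (1 + m) * C * Ca).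
  assert (HC3 : 0 < C3).
  { unfold C3. assert (0 < m * C2) by nra. assert (0 < (1 + m) * (C * Ca)) by (apply Rmult_lt_0_compat; nra). nra. }
  (* In this order the four bounds serve to absorb the change of ln p in the estimate of y - tau, to
     bound the change of ln p over unit distance by 1, to keep P >= p(y)/2 so that ln P makes sense,
     and to get |Z - y| <= 1. *)
  set (eps := Rmin (Rmin (/ (2 * m)) 1) (Rmin (/ (4 * C2)) (/ C3))).
  assert (Heps : 0 < eps).
  { unfold eps. repeat apply Rmin_glb_lt; try lra; apply Rinv_0_lt_compat; lra. }
  assert (He1 : eps <= / (2 * m)) by (eapply Rle_trans; [apply Rmin_l | apply Rmin_l]).
  assert (He2 : eps <= 1) by (eapply Rle_trans; [apply Rmin_l | apply Rmin_r]).
  assert (He3 : eps <= / (4 * C2)) by (eapply Rle_trans; [apply Rmin_r | apply Rmin_l]).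
  assert (He4 : eps <= / C3) by (eapply Rle_trans; [apply Rmin_r | apply Rmin_r]).
  assert (He1' : m * eps <= / 2).
  { replace (/ 2) with (m * / (2 * m)) by (field; lra). apply Rmult_le_compat_l; lra. }
  assert (He3' : 4 * C2 * eps <= 1).
  { replace 1 with (4 * C2 * / (4 * C2)) by (field; lra). apply Rmult_le_compat_l; lra. }
  assert (He4' : C3 * eps <= 1).
  { replace 1 with (C3 * / C3) by (field; lra). apply Rmult_le_compat_l; lra. }
  destruct (tame_ratio _ _ _ _ Hp eps Heps) as (X0 & HX0 & _ & HR).
  assert (HL := tame_ln_lipschitz _ _ _ _ X0 eps Hp HX0 (fun t Ht => proj1 (HR t Ht))).
  destruct (little_o_elim _ Hyo (/ 2) ltac:(lra)) as (Tl & HTl0 & HTl).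
  set (X := Rmax (Rmax X0 T5) (Rmax Te Tf)).
  assert (HX1 : X0 <= X) by (eapply Rle_trans; [| apply Rmax_l]; apply Rmax_l).
  assert (HX2 : T5 <= X) by (eapply Rle_trans; [| apply Rmax_l]; apply Rmax_r).
  assert (HX3 : Te <= X) by (eapply Rle_trans; [| apply Rmax_r]; apply Rmax_l).
  assert (HX4 : Tf <= X) by (eapply Rle_trans; [| apply Rmax_r]; apply Rmax_r).
  exists (8 * C3).
  set (S := Rmax (Rmax (Rmax Ty Ty') (Rmax Ta Ta')) (Rmax (Rmax Tb Tb')
     (Rmax (Rmax Tl (T1 - k1)) (Rmax (2 * (X + 1)) (Rmax X (Rmax (X - k1) (X - k2))))))).
  exists S. intros s Hs.
  assert (HS : Ty <= s /\ Ty' <= s /\ Ta <= s /\ Ta' <= s /\ Tb <= s /\ Tb' <= s /\ Tl <= s /\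
    T1 - k1 <= s /\ 2 * (X + 1) <= s /\ X <= s /\ X - k1 <= s /\ X - k2 <= s).
  { assert (Hmax : forall a b, Rmax a b <= s -> a <= s /\ b <= s).
    { intros a b Hab. assert (M1 := Rmax_l a b). assert (M2 := Rmax_r a b). lra. }
    clear - Hs Hmax. unfold S in Hs.
    repeat match goal with
    | h : Rmax _ _ <= s |- _ => apply Hmax in h; destruct h
    end. repeat split; assumption. }
  clear Hs S. destruct HS as (S1 & S2 & S3 & S4 & S5 & S6 & S7 & S8 & S9 & S10 & S11 & S12).
  specialize (HTy s S1). specialize (HTy' s S2). specialize (HTa s S3). specialize (HTa' s S4).
  specialize (HTb s S5). specialize (HTb' s S6). specialize (HTl s S7).
  destruct (Hx (s + k1) ltac:(lra)) as (Ex & Hw1 & Hw2). clear Hx.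
  set (t := s + k1) in *. set (tau := s + k2) in *. set (y := x t) in *.
  cbv beta in *. replace (y - t + k1) with (y - s) in * by (unfold t; ring).
  replace (s + (y - s)) with y in * by ring. fold t in HTa'. fold tau in HTb'.
  assert (Hy : X + 1 <= y) by (apply Rabs_le_between in HTl; lra).
  assert (Htau : X <= tau) by (unfold tau; lra).
  assert (Ht : X <= t) by (unfold t; lra).
  destruct (Hd s) as (Ps & _); [lra |]. destruct (Hd t) as (Pt & _); [lra |].
  destruct (Hd y) as (Py & _); [lra |]. destruct (Hd tau) as (Ptau & _); [lra |].
  destruct (ratio_within_two _ _ Ps Py HTy) as (Ry1 & Ry2 & Ry3).
  destruct (ratio_within_two _ _ Ps Pt HTa) as (Ra1 & Ra2 & Ra3).
  destruct (ratio_within_two _ _ Ps Ptau HTb) as (Rb1 & Rb2 & Rb3).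
  set (w := v t + m * z t) in *.
  assert (Ey : y - tau = (k1 - k2) + w + m * ln (p y)) by (unfold w, tau, t in *; lra).
  set (q := Rabs (p1 s)) in *. assert (Hq : 0 <= q) by apply Rabs_pos.
  assert (Hbt : forall xi, Rmin tau y <= xi <= Rmax tau y -> X <= xi).
  { intros xi. unfold Rmin. destruct Rle_dec; lra. }
  assert (HE : Rabs (p y - p tau - p1 tau * (y - tau)) <= CE * q).
  { apply (second_order_expansion p p1 p2).
    - intros xi Hxi. apply (Hd xi). specialize (Hbt xi Hxi). lra.
    - intros xi Hxi. specialize (Hbt xi Hxi) as Bxi.
      (* The increment is governed by ln p at [y], but the remainder needs it at [xi]. The
         difference of the logarithms is at most eps |y - tau|, which the left side absorbs. *)
      assert (I1 : Rabs (y - tau) <= 2 * K1 + 2 * m * Rabs (ln (p xi))).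
      { assert (J1 := HL xi y ltac:(lra) ltac:(lra)).
        assert (J2 : Rabs (y - xi) <= Rabs (y - tau)).
        { revert Hxi. unfold Rmin, Rmax, Rabs. destruct Rle_dec; repeat destruct Rcase_abs; lra. }
        assert (J3 : Rabs (ln (p y)) <= Rabs (ln (p xi)) + eps * Rabs (y - tau)).
        { replace (ln (p y)) with (ln (p xi) + (ln (p y) - ln (p xi))) by ring.
          eapply Rle_trans; [apply Rabs_triang |].
          assert (eps * Rabs (y - xi) <= eps * Rabs (y - tau)) by (apply Rmult_le_compat_l; lra). lra. }
        assert (J4 : Rabs (y - tau) <= K1 + m * Rabs (ln (p y))).
        { rewrite Ey. eapply Rle_trans; [apply Rabs_triang |].
          rewrite Rabs_mult, (Rabs_pos_eq m) by lra.
          assert (J5 := Rabs_triang (k1 - k2) w). unfold K1. lra. }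
        assert (m * Rabs (ln (p y)) <= m * Rabs (ln (p xi)) + m * eps * Rabs (y - tau)).
        { rewrite Rmult_assoc, <- Rmult_plus_distr_l. apply Rmult_le_compat_l; lra. }
        assert (m * eps * Rabs (y - tau) <= / 2 * Rabs (y - tau)) by (apply Rmult_le_compat_r; [apply Rabs_pos | auto]).
        lra. }
      assert (I2 : (y - tau) ^ 2 <= 8 * K1 ^ 2 + 8 * m ^ 2 * ln (p xi) ^ 2).
      { rewrite <- pow2_abs, <- (pow2_abs (ln (p xi))).
        set (l := Rabs (ln (p xi))) in *. assert (Pl : 0 <= l) by apply Rabs_pos.
        assert (J : Rabs (y - tau) ^ 2 <= (2 * K1 + 2 * m * l) ^ 2) by (apply pow_incr; split; [apply Rabs_pos | auto]).
        assert (0 <= (2 * K1 - 2 * m * l) ^ 2) by apply pow2_ge_0.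
        eapply Rle_trans; [apply J | clear - H; lra]. }
      specialize (HTe xi ltac:(lra)). specialize (HTf xi ltac:(lra)). cbv beta in HTf.
      rewrite Rabs_mult, (Rabs_pos_eq (_ ^ 2)) in HTf by apply pow2_ge_0.
      (* Later values of [p1] are dominated by earlier ones, so the smaller of [tau] and [y] is a
         reference point valid for all [xi]; both are o(s) shifts of [s]. *)
      assert (I3 : Rabs (p1 xi) <= C5 * (Cy + Cb) * q).
      { assert (Rabs (p1 xi) <= C5 * Rabs (p1 (Rmin tau y))).
        { apply HT5; [| apply Hxi]. unfold Rmin; destruct Rle_dec; lra. }
        assert (Rabs (p1 (Rmin tau y)) <= (Cy + Cb) * q).
        { rewrite Rmult_plus_distr_r.
          assert (0 <= Cy * q) by (apply Rmult_le_pos; lra).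
          assert (0 <= Cb * q) by (apply Rmult_le_pos; lra).
          unfold Rmin; destruct Rle_dec; lra. }
        rewrite Rmult_assoc. eapply Rle_trans; [eassumption |].
        apply Rmult_le_compat_l; lra. }
      assert (P2 := Rabs_pos (p2 xi)).
      apply Rle_trans with (Rabs (p2 xi) * (8 * K1 ^ 2 + 8 * m ^ 2 * ln (p xi) ^ 2)).
      { apply Rmult_le_compat_l; auto. }
      assert (PK : 0 <= K1 ^ 2) by apply pow2_ge_0. assert (PM : 0 <= m ^ 2) by apply pow2_ge_0.
      assert (K1 ^ 2 * Rabs (p2 xi) <= K1 ^ 2 * (D0 * Rabs (p1 xi))) by (apply Rmult_le_compat_l; auto).
      assert (m ^ 2 * (Rabs (p2 xi) * ln (p xi) ^ 2) <= m ^ 2 * (D2 * Rabs (p1 xi)))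
        by (apply Rmult_le_compat_l; auto).
      apply Rle_trans with ((8 * K1 ^ 2 * D0 + 8 * m ^ 2 * D2) * Rabs (p1 xi)); [lra |].
      replace (CE * q) with ((8 * K1 ^ 2 * D0 + 8 * m ^ 2 * D2) * (C5 * (Cy + Cb) * q))
        by (unfold CE; ring).
      apply Rmult_le_compat_l; [| auto].
      assert (0 <= K1 ^ 2 * D0) by (apply Rmult_le_pos; lra).
      assert (0 <= m ^ 2 * D2) by (apply Rmult_le_pos; lra). lra. }
  set (P := p tau + m * p1 tau * ln (p tau)).
  assert (HP : Rabs (P - p y) <= C2 * q).
  { rewrite Rabs_minus_sym.
    replace (p y - P) with ((p y - p tau - p1 tau * (y - tau)) +
       p1 tau * ((k1 - k2) + w + m * (ln (p y) - ln (p tau)))) by (unfold P; rewrite Ey; ring).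
    eapply Rle_trans; [apply Rabs_triang |]. rewrite Rabs_mult.
    assert (J1 : Rabs (k1 - k2 + w + m * (ln (p y) - ln (p tau))) <= K1 + 2 * m).
    { eapply Rle_trans; [apply Rabs_triang |]. rewrite Rabs_mult, (Rabs_pos_eq m) by lra.
      assert (J2 := Rabs_triang (k1 - k2) w).
      assert (J3 : Rabs (ln (p y) - ln (p tau)) <= 2).
      { apply Rabs_le_between in Ry3. apply Rabs_le_between in Rb3. apply Rabs_le. lra. }
      apply (Rmult_le_compat_l m) in J3; [unfold K1; lra | lra]. }
    assert (J4 : Rabs (p1 tau) * Rabs (k1 - k2 + w + m * (ln (p y) - ln (p tau))) <= Cb * q * (K1 + 2 * m))
      by (apply Rmult_le_compat; auto using Rabs_pos).
    unfold C2. lra. }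
  assert (Hqs : q <= eps * p s) by (apply HR; lra).
  assert (HPy : Rabs (P - p y) <= / 2 * p y).
  { eapply Rle_trans; [apply HP |].
    assert (C2 * q <= C2 * (eps * (2 * p y))).
    { apply Rmult_le_compat_l; [lra |]. eapply Rle_trans; [apply Hqs |]. apply Rmult_le_compat_l; lra. }
    assert (4 * C2 * eps * p y <= 1 * p y) by (apply Rmult_le_compat_r; lra). lra. }
  assert (Hqp : forall r, 0 < r -> p s <= 2 * r -> q / r <= 2 * (q / p s)).
  { intros r Hr Hrs. unfold Rdiv.
    replace (2 * (q * / p s)) with (q * (2 * / p s)) by ring. apply Rmult_le_compat_l; [auto |].
    apply (Rmult_le_reg_l r); [auto |]. apply (Rmult_le_reg_l (p s)); [auto |].
    replace (p s * (r * / r)) with (p s) by (field; lra).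
    replace (p s * (r * (2 * / p s))) with (2 * r) by (field; lra). auto. }
  assert (Hln : Rabs (ln P - ln (p y)) <= 2 * C2 * (q / p y)).
  { apply Rle_trans with (2 / p y * Rabs (P - p y)).
    - apply (lipschitz_of_derive ln Rinv).
      + intros r Hr. apply is_derive_ln. apply Rabs_le_between in HPy.
        revert Hr. unfold Rmin. destruct Rle_dec; lra.
      + intros r Hr.
        assert (/ 2 * p y <= r).
        { apply Rabs_le_between in HPy. revert Hr. unfold Rmin. destruct Rle_dec; lra. }
        rewrite Rabs_pos_eq by (left; apply Rinv_0_lt_compat; lra).
        replace (2 / p y) with (/ (/ 2 * p y)) by (field; lra).
        apply Rinv_le_contravar; lra.
    - replace (2 * C2 * (q / p y)) with (2 / p y * (C2 * q)) by (field; lra).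
      apply Rmult_le_compat_l; [| auto]. left. apply Rdiv_lt_0_compat; lra. }
  set (Z := t + m * ln P).
  assert (HZ : Rabs (Z - y) <= C3 * (q / p s)).
  { replace (Z - y) with (m * (ln P - ln (p y)) - w) by (unfold Z, w; lra).
    eapply Rle_trans; [apply Rabs_triang |]. rewrite Rabs_Ropp, Rabs_mult, (Rabs_pos_eq m) by lra.
    assert (J1 := Hqp (p y) Py Ry1). assert (J2 := Hqp (p t) Pt Ra1).
    assert (J3 : m * Rabs (ln P - ln (p y)) <= m * (2 * C2 * (2 * (q / p s)))).
    { apply Rmult_le_compat_l; [lra |]. eapply Rle_trans; [apply Hln |]. apply Rmult_le_compat_l; lra. }
    assert (J4 : Rabs w <= (1 + m) * (Rabs (v t) + Rabs (z t))).
    { unfold w. eapply Rle_trans; [apply Rabs_triang |]. rewrite Rabs_mult, (Rabs_pos_eq m) by lra.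
      assert (Q1 := Rabs_pos (v t)). assert (Q2 := Rabs_pos (z t)).
      assert (0 <= m * Rabs (v t)) by (apply Rmult_le_pos; lra). lra. }
    assert (J5 : C * Rabs (p1 t) / p t <= C * Ca * (2 * (q / p s))).
    { apply Rle_trans with (C * Ca * (q / p t)).
      - unfold Rdiv. replace (C * Ca * (q * / p t)) with (C * (Ca * q) * / p t) by ring.
        apply Rmult_le_compat_r; [left; apply Rinv_0_lt_compat; auto |].
        apply Rmult_le_compat_l; [lra | auto].
      - apply Rmult_le_compat_l; [apply Rmult_le_pos; lra | auto]. }
    assert (J6 : Rabs w <= (1 + m) * (C * Ca * (2 * (q / p s)))).
    { eapply Rle_trans; [apply J4 |]. apply Rmult_le_compat_l; lra. }
    unfold C3. lra. }
  assert (HZ1 : Rabs (Z - y) <= 1).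
  { eapply Rle_trans; [apply HZ |].
    assert (q / p s <= eps).
    { apply (Rmult_le_reg_r (p s)); [auto |]. replace (q / p s * p s) with q by (field; lra). auto. }
    assert (C3 * (q / p s) <= C3 * eps) by (apply Rmult_le_compat_l; lra). lra. }
  rewrite Rabs_minus_sym.
  (* Within distance 1 of [y] the slope of [g] is at most exp 1 times p(y), hence at most 4 p(y) <=
     8 p(s). *)
  apply Rle_trans with (8 * p s * Rabs (Z - y)).
  - apply (lipschitz_of_derive g p).
    + intros r Hr. apply Hg. apply Rabs_le_between in HZ1. revert Hr. unfold Rmin. destruct Rle_dec; lra.
    + intros r Hr. apply Rabs_le_between in HZ1.
      assert (Br : Rabs (r - y) <= 1).
      { apply Rabs_le. revert Hr. unfold Rmin, Rmax. destruct Rle_dec; lra. }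
      assert (Xr : X <= r) by (apply Rabs_le_between in Br; lra).
      destruct (Hd r) as (Pr & _); [lra |]. rewrite Rabs_pos_eq by lra.
      assert (L := HL y r ltac:(lra) ltac:(lra)).
      assert (L1 : ln (p r) <= ln (p y) + 1).
      { assert (eps * Rabs (r - y) <= 1 * 1) by (apply Rmult_le_compat; auto using Rabs_pos; lra).
        apply Rabs_le_between in L. lra. }
      rewrite <- (exp_ln (p r)) by auto.
      eapply Rle_trans; [apply exp_le_compat, L1 |].
      rewrite exp_plus, exp_ln by auto. assert (E4 := exp_1_lt_4).
      apply Rle_trans with (p y * 4); [apply Rmult_le_compat_l |]; lra.
  - replace (8 * C3 * q) with (8 * p s * (C3 * (q / p s))) by (field; lra).
    apply Rmult_le_compat_l; [lra | auto].
Qed.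

(** * Real powers and the continuation of the solution down to zero *)

Lemma Rpower_pos (x y : R) : 0 < Rpower x y.
Proof. apply exp_pos. Qed.

Lemma is_derive_Rpower (x y : R) : 0 < x -> is_derive (fun x => Rpower x y) x (y * Rpower x (y - 1)).
Proof. intros Hx. apply is_derive_Reals. apply derivable_pt_lim_power. auto. Qed.

Lemma Rpower_bounded (a b y : R) : 0 < a -> exists Q, 0 < Q /\ forall x, a <= x <= b -> Rpower x y <= Q.
Proof.
  intros Ha. exists (exp (Rabs y * (Rabs (ln a) + Rabs (ln b)))). split; [apply exp_pos |].
  intros x Hx. apply exp_le_compat.
  eapply Rle_trans; [apply Rle_abs |]. rewrite Rabs_mult.
  apply Rmult_le_compat_l; [apply Rabs_pos |].
  assert (ln a <= ln x) by (apply ln_le; lra). assert (ln x <= ln b) by (apply ln_le; lra).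
  unfold Rabs; repeat destruct Rcase_abs; lra.
Qed.

(** An exponent at most 1 makes the slope nonincreasing, so the slope at [c] bounds it; for p < 1 it
    is unbounded near 0, which is why the flux must be kept away from 0. *)
Lemma Rpower_lipschitz_above (c p : R) : 0 < c -> 0 < p <= 1 ->
  forall x y, c <= x -> c <= y -> Rabs (Rpower x p - Rpower y p) <= p * Rpower c (p - 1) * Rabs (x - y).
Proof.
  intros Hc Hp x y Hx Hy.
  apply (lipschitz_of_derive (fun x => Rpower x p) (fun x => p * Rpower x (p - 1))).
  - intros w Hw. apply is_derive_Rpower. revert Hw. unfold Rmin. destruct Rle_dec; lra.
  - intros w Hw.
    assert (c <= w) by (revert Hw; unfold Rmin; destruct Rle_dec; lra).
    rewrite Rabs_pos_eq by (apply Rmult_le_pos; [lra | left; apply Rpower_pos]).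
    apply Rmult_le_compat_l; [lra |]. apply exp_le_compat.
    assert (ln c <= ln w) by (apply ln_le; lra). nra.
Qed.

Lemma continuous_Rpower_clamp (a b y : R) : 0 < a -> a <= b ->
  forall t, continuous (fun t => Rpower (Rmax a (Rmin b t)) y) t.
Proof.
  intros Ha Hab t.
  assert (Hc : continuous (fun t => Rmax a (Rmin b t)) t).
  { apply continuous_eps. intros eps Heps. exists eps. split; [auto |]. intros s Hs.
    eapply Rle_lt_trans; [apply (clamp_spec a b s t Hab) | exact Hs]. }
  apply (continuous_comp (fun t => Rmax a (Rmin b t)) (fun x => Rpower x y)); [exact Hc |].
  apply (ex_derive_continuous (fun x => Rpower x y)). eexists. apply is_derive_Rpower.
  apply Rlt_le_trans with a; [auto | apply Rmax_l].
Qed.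

Lemma Rmin_lipschitz (x y b : R) : Rabs (Rmin x b - Rmin y b) <= Rabs (x - y).
Proof.
  unfold Rmin; repeat destruct Rle_dec; unfold Rabs; repeat destruct Rcase_abs; lra.
Qed.

Lemma Rmax_lipschitz (x y b : R) : Rabs (Rmax x b - Rmax y b) <= Rabs (x - y).
Proof.
  unfold Rmax; repeat destruct Rle_dec; unfold Rabs; repeat destruct Rcase_abs; lra.
Qed.

(* Here w = r^alpha |u'|^m. Integrating w' gives w >= k r^(gamma+1), so that
   -u' >= k^(1/m) r^(theta/m-1), which is not integrable at infinity. *)
Lemma continuation_to_zero (phi : R -> R) (alpha gamma m theta phi0 r0 u0 w0 : R) :
  (forall A, exists L, 0 < L /\ forall x y, x <= A -> y <= A -> Rabs (phi x - phi y) <= L * Rabs (x - y)) ->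
  0 < phi0 -> (forall x, phi0 <= phi x) ->
  1 <= m -> 0 < gamma + 1 -> theta = gamma + 1 - alpha + m -> 0 < theta ->
  0 < r0 -> 0 < u0 -> 0 < w0 ->
  exists (rs R1 : R) (u w : R -> R), r0 < rs < R1 /\ u r0 = u0 /\ w r0 = w0 /\
    (forall r, r0 <= r < R1 ->
       is_derive u r (- (Rpower r (- alpha / m) * Rpower (w r) (1 / m))) /\
       is_derive w r (Rpower r gamma * phi (u r)) /\ 0 < w r) /\
    u rs = 0 /\ forall r, r0 <= r < rs -> 0 < u r.
Proof.
  intros Hphi Hphi0 Hphi1 Hm Hgam Htheta Hth Hr0 Hu0 Hw0.
  assert (Him : 0 < 1 / m <= 1).
  { split; [apply Rdiv_lt_0_compat; lra |].
    apply (Rmult_le_reg_r m); [lra |]. replace (1 / m * m) with 1 by (field; lra). lra. }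
  (* Chosen so that k r^(gamma+1) starts below [w] at [r0] and has derivative at most phi0
     r^gamma. *)
  set (k := Rmin (w0 / Rpower r0 (gamma + 1)) (phi0 / (gamma + 1))).
  assert (Hk : 0 < k).
  { unfold k. apply Rmin_glb_lt; apply Rdiv_lt_0_compat; auto using Rpower_pos. }
  assert (Hk1 : k * Rpower r0 (gamma + 1) <= w0).
  { assert (P := Rpower_pos r0 (gamma + 1)).
    replace w0 with (w0 / Rpower r0 (gamma + 1) * Rpower r0 (gamma + 1)) by (field; lra).
    apply Rmult_le_compat_r; [lra | apply Rmin_l]. }
  assert (Hk2 : k * (gamma + 1) <= phi0).
  { replace phi0 with (phi0 / (gamma + 1) * (gamma + 1)) by (field; lra).
    apply Rmult_le_compat_r; [lra | apply Rmin_r]. }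
  set (kap := Rpower k (1 / m)).
  assert (Hkap : 0 < kap) by apply Rpower_pos.
  (* The value of r^(theta/m) at which the integrated upper bound for u reaches 0. At [Re], where
     this power equals Y + 1, u is strictly negative. *)
  set (Y := Rpower r0 (theta / m) + u0 * theta / (kap * m)).
  assert (HY0 : 0 < u0 * theta / (kap * m)).
  { apply Rdiv_lt_0_compat; apply Rmult_lt_0_compat; lra. }
  assert (HY : 0 < Y) by (unfold Y; assert (P := Rpower_pos r0 (theta / m)); lra).
  assert (Htm : 0 < theta / m) by (apply Rdiv_lt_0_compat; lra).
  set (Re := Rpower (Y + 1) (m / theta)).
  assert (HRe : Rpower Re (theta / m) = Y + 1).
  { unfold Re. rewrite Rpower_mult. replace (m / theta * (theta / m)) with 1 by (field; lra).
    apply Rpower_1. lra. }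
  assert (HRr : r0 < Re).
  { destruct (Rlt_le_dec r0 Re) as [h | h]; [auto | exfalso].
    assert (I := Rle_Rpower_l Re r0 (theta / m) ltac:(lra) (conj (Rpower_pos _ _) h)).
    rewrite HRe in I. unfold Y in I. lra. }
  set (R1 := Re + 1).
  destruct (Hphi u0) as (L & HL & HphiL).
  destruct (Rpower_bounded r0 R1 (- alpha / m) Hr0) as (Q1 & HQ1 & HQ1').
  destruct (Rpower_bounded r0 R1 gamma Hr0) as (Q2 & HQ2 & HQ2').
  set (cl := fun t => Rmax r0 (Rmin R1 t)).
  assert (HR1 : r0 <= R1) by (unfold R1; lra).
  assert (Hcl : forall t, r0 <= cl t <= R1 /\ (r0 <= t <= R1 -> cl t = t)).
  { intros t. destruct (clamp_spec r0 R1 t t HR1) as (A1 & _ & A2). auto. }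
  (* Truncation to a globally Lipschitz field: the radius stays in a compact interval, w^(1/m) is
     used only above [w0] and [phi] only below [u0]. After [r0], w increases and u decreases, so on
     [r0,R1] nothing is changed. *)
  set (F := fun (i : bool) t u w =>
    if i then - (Rpower (cl t) (- alpha / m) * Rpower (Rmax w w0) (1 / m))
    else Rpower (cl t) gamma * phi (Rmin u u0)).
  set (Lw := 1 / m * Rpower w0 (1 / m - 1)).
  assert (HLw : 0 < Lw) by (apply Rmult_lt_0_compat; [lra | apply Rpower_pos]).
  destruct (ode_global_solution F (Q1 * Lw + Q2 * L) (Q1 * Rpower w0 (1 / m) + Q2 * phi u0) r0 u0 w0)
    as (u & w & Eu & Ew & Huw).
  - intros i t y z y' z'.
    assert (Py := Rabs_pos (y - y')). assert (Pz := Rabs_pos (z - z')).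
    assert (0 < Q1 * Lw) by nra. assert (0 < Q2 * L) by nra.
    destruct i; simpl.
    + replace (- (Rpower (cl t) (- alpha / m) * Rpower (Rmax z w0) (1 / m)) -
               - (Rpower (cl t) (- alpha / m) * Rpower (Rmax z' w0) (1 / m)))
        with (- (Rpower (cl t) (- alpha / m) * (Rpower (Rmax z w0) (1 / m) - Rpower (Rmax z' w0) (1 / m)))) by ring.
      rewrite Rabs_Ropp, Rabs_mult, (Rabs_pos_eq (Rpower _ (- alpha / m))) by (left; apply Rpower_pos).
      apply Rle_trans with (Q1 * (Lw * Rabs (z - z'))); [| nra].
      apply Rmult_le_compat; [left; apply Rpower_pos | apply Rabs_pos | apply HQ1', Hcl |].
      eapply Rle_trans; [apply (Rpower_lipschitz_above w0); auto; apply Rmax_r |].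
      apply Rmult_le_compat_l; [apply Rlt_le, HLw | apply Rmax_lipschitz].
    + rewrite <- Rmult_minus_distr_l, Rabs_mult, (Rabs_pos_eq (Rpower _ gamma)) by (left; apply Rpower_pos).
      apply Rle_trans with (Q2 * (L * Rabs (y - y'))); [| nra].
      apply Rmult_le_compat; [left; apply Rpower_pos | apply Rabs_pos | apply HQ2', Hcl |].
      eapply Rle_trans; [apply HphiL; apply Rmin_r |].
      apply Rmult_le_compat_l; [lra | apply Rmin_lipschitz].
  - intros i y z t. destruct i; simpl.
    + apply (continuous_opp (fun t => Rpower (cl t) (- alpha / m) * Rpower (Rmax z w0) (1 / m))).
      apply (continuous_mult (fun t => Rpower (cl t) (- alpha / m)) (fun _ => Rpower (Rmax z w0) (1 / m)));
        [apply continuous_Rpower_clamp; auto | apply continuous_const].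
    + apply (continuous_mult (fun t => Rpower (cl t) gamma) (fun _ => phi (Rmin y u0)));
        [apply continuous_Rpower_clamp; auto | apply continuous_const].
  - intros i t. specialize (Hphi1 u0).
    assert (P1 := Rpower_pos w0 (1 / m)).
    assert (B1 := HQ1' _ (proj1 (Hcl t))). assert (B2 := HQ2' _ (proj1 (Hcl t))).
    assert (P2 := Rpower_pos (cl t) (- alpha / m)). assert (P3 := Rpower_pos (cl t) gamma).
    assert (0 <= Q1 * Rpower w0 (1 / m)) by nra. assert (0 <= Q2 * phi u0) by nra.
    destruct i; simpl.
    + rewrite (Rmax_left w0 w0) by lra. rewrite Rabs_Ropp, Rabs_pos_eq by nra. nra.
    + rewrite (Rmin_left u0 u0) by lra. rewrite Rabs_pos_eq by nra. nra.
  - assert (Hwm : forall r, r0 <= r -> w0 <= w r).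
    { intros r Hr. rewrite <- Ew.
      apply (derive_nonneg_incr w (fun r => F false r (u r) (w r))); [auto | |].
      - intros s _. apply Huw.
      - intros s _. simpl. specialize (Hphi1 (Rmin (u s) u0)).
        apply Rmult_le_pos; [left; apply Rpower_pos | lra]. }
    assert (Hud : forall r s, r <= s -> 0 <= - u s - - u r).
    { intros r s Hrs. enough (- u r <= - u s) by lra.
      apply (derive_nonneg_incr (fun r => - u r) (fun r => - F true r (u r) (w r))); [auto | |].
      - intros x _. apply (is_derive_opp u). apply Huw.
      - intros x _. simpl. rewrite Ropp_involutive. left. apply Rmult_lt_0_compat; apply Rpower_pos. }
    assert (Hode : forall r, r0 <= r <= R1 ->
       is_derive u r (- (Rpower r (- alpha / m) * Rpower (w r) (1 / m))) /\
       is_derive w r (Rpower r gamma * phi (u r)) /\ 0 < w r).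
    { intros r Hr. destruct (Huw r) as [D1 D2]. simpl in D1, D2.
      specialize (Hwm r ltac:(lra)). specialize (Hud r0 r ltac:(lra)). rewrite Eu in Hud.
      rewrite (proj2 (Hcl r) Hr) in D1, D2. rewrite Rmax_left in D1 by lra.
      rewrite Rmin_left in D2 by lra. split; [auto | split; [auto | lra]]. }
    assert (Hwk : forall r, r0 <= r <= R1 -> k * Rpower r (gamma + 1) <= w r).
    { intros r Hr.
      enough (w r0 - k * Rpower r0 (gamma + 1) <= w r - k * Rpower r (gamma + 1)) by lra.
      apply (derive_nonneg_incr (fun r => w r - k * Rpower r (gamma + 1))
         (fun r => Rpower r gamma * phi (u r) - k * ((gamma + 1) * Rpower r (gamma + 1 - 1)))); [lra | |].
      - intros s Hs. apply (is_derive_minus w (fun r => k * Rpower r (gamma + 1))).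
        + apply Hode; lra.
        + apply is_derive_scal. apply is_derive_Rpower. lra.
      - intros s Hs. replace (gamma + 1 - 1) with gamma by ring.
        specialize (Hphi1 (u s)). assert (P := Rpower_pos s gamma). nra. }
    assert (Hend : u Re < 0).
    { assert (I : - u r0 - kap * m / theta * Rpower r0 (theta / m) <=
                  - u Re - kap * m / theta * Rpower Re (theta / m)).
      { apply (derive_nonneg_incr (fun r => - u r - kap * m / theta * Rpower r (theta / m))
          (fun r => - - (Rpower r (- alpha / m) * Rpower (w r) (1 / m)) -
                    kap * m / theta * (theta / m * Rpower r (theta / m - 1)))); [lra | |].
        - intros s Hs.
          apply (is_derive_minus (fun r => - u r) (fun r => kap * m / theta * Rpower r (theta / m))).
          + apply (is_derive_opp u). apply Hode. unfold R1; lra.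
          + apply is_derive_scal. apply is_derive_Rpower. lra.
        - intros s Hs. rewrite Ropp_involutive.
          replace (kap * m / theta * (theta / m * Rpower s (theta / m - 1)))
            with (kap * Rpower s (theta / m - 1)) by (field; lra).
          replace (Rpower s (theta / m - 1)) with (Rpower s (- alpha / m) * Rpower (Rpower s (gamma + 1)) (1 / m)).
          + assert (I1 := Hwk s ltac:(unfold R1; lra)).
            assert (P1 := Rpower_pos s (gamma + 1)).
            assert (I2 : Rpower (k * Rpower s (gamma + 1)) (1 / m) <= Rpower (w s) (1 / m)).
            { apply Rle_Rpower_l; [lra |]. split; [nra | auto]. }
            rewrite <- Rpower_mult_distr in I2 by auto. fold kap in I2.
            assert (P2 := Rpower_pos s (- alpha / m)). nra.
          + rewrite Rpower_mult, <- Rpower_plus. f_equal. rewrite Htheta. field. lra. }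
      rewrite HRe, Eu in I. unfold Y in I.
      replace (kap * m / theta * (Rpower r0 (theta / m) + u0 * theta / (kap * m) + 1))
        with (kap * m / theta * Rpower r0 (theta / m) + u0 + kap * m / theta) in I by (field; lra).
      assert (0 < kap * m / theta) by (apply Rdiv_lt_0_compat; nra). lra. }
    destruct (ivt_incr (fun r => - u r) r0 Re 0) as (rs & Hrs & Ers); [lra | | lra |].
    { intros x Hx. apply (ex_derive_continuous (fun r => - u r)).
      eexists. apply (is_derive_opp u). exact (proj1 (Hode x ltac:(unfold R1; lra))). }
    assert (Hrs1 : r0 < rs).
    { destruct (proj1 Hrs) as [h | h]; [auto |]. rewrite <- h in Ers. lra. }
    exists rs, R1, u, w. split; [unfold R1; lra |]. split; [auto |]. split; [auto |].
    split; [intros r Hr; apply Hode; lra |]. split; [lra |].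
    intros r Hr.
    (* If u(r) <= 0 before [rs], monotonicity makes u constant up to [rs], against u' < 0. *)
    destruct (Rlt_le_dec 0 (u r)) as [h | h]; [auto | exfalso].
    assert (Hflat : forall s, r <= s <= rs -> u s = u r).
    { intros s Hs. assert (A1 := Hud r s ltac:(lra)). assert (A2 := Hud s rs ltac:(lra)).
      assert (A3 := Hud r rs ltac:(lra)). lra. }
    destruct (MVT_gen u r rs (fun r => - (Rpower r (- alpha / m) * Rpower (w r) (1 / m)))) as (c & Hc & E).
    + rewrite Rmin_left, Rmax_right by lra. intros x Hx. apply Hode. unfold R1; lra.
    + rewrite Rmin_left, Rmax_right by lra. intros x Hx. apply continuity_pt_filterlim.
      apply (ex_derive_continuous u). eexists. exact (proj1 (Hode x ltac:(unfold R1; lra))).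
    + rewrite (Hflat rs) in E by lra.
      assert (P := Rmult_lt_0_compat _ _ (Rpower_pos c (- alpha / m)) (Rpower_pos (w c) (1 / m))).
      nra.
Qed.

(** * Gluing, dilation and return to the radial equation *)

Lemma is_derive_glue (f1 f2 : R -> R) (x l : R) :
  f1 x = f2 x -> is_derive f1 x l -> is_derive f2 x l ->
  is_derive (fun r => if Rle_dec r x then f1 r else f2 r) x l.
Proof.
  intros E H1 H2. apply is_derive_Reals in H1. apply is_derive_Reals in H2. apply is_derive_Reals.
  intros eps Heps. destruct (H1 eps Heps) as [d1 Hd1]. destruct (H2 eps Heps) as [d2 Hd2].
  assert (Hd : 0 < Rmin d1 d2) by (apply Rmin_glb_lt; apply cond_pos).
  exists (mkposreal _ Hd). intros h Hh Hhd. simpl in Hhd.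
  assert (B1 := Rmin_l d1 d2). assert (B2 := Rmin_r d1 d2).
  destruct (Rle_dec x x); [| lra]. destruct (Rle_dec (x + h) x).
  - apply Hd1; lra.
  - rewrite E. apply Hd2; lra.
Qed.

(** Both pieces obey the same differential equation, so equality of the values at the junction
    already makes the one-sided slopes agree. *)
Lemma is_derive_glue_ode (f1 f2 df : R -> R) (a x b : R) :
  f1 x = f2 x -> (forall r, a < r <= x -> is_derive f1 r (df r)) ->
  (forall r, x <= r < b -> is_derive f2 r (df r)) ->
  forall r, a < r < b -> is_derive (fun r => if Rle_dec r x then f1 r else f2 r) r (df r).
Proof.
  intros E H1 H2 r Hr.
  destruct (Rtotal_order r x) as [h | [-> | h]].
  - apply (is_derive_ext_loc f1); [| apply H1; lra].
    generalize (open_lt x r h). apply filter_imp. intros s Hs. destruct Rle_dec; [auto | lra].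
  - apply is_derive_glue; [auto | apply H1; lra | apply H2; lra].
  - apply (is_derive_ext_loc f2); [| apply H2; lra].
    generalize (open_gt x r h). apply filter_imp. intros s Hs. destruct Rle_dec; [lra | auto].
Qed.

(** The function is given a little beyond 1, so the one-sided limits required at 1 are values of
    continuous derivatives. *)
Lemma Ck2_of_derivatives (u D1 D2 : R -> R) (d : R) : 0 < d ->
  (forall r, 0 < r < 1 + d -> is_derive u r (D1 r) /\ is_derive D1 r (D2 r) /\ continuous D2 r) ->
  Ck_on_Ioc 2 0 1 u.
Proof.
  intros Hd H.
  assert (Hloc : forall r, 0 < r < 1 + d -> locally r (fun s => 0 < s < 1 + d)).
  { intros r Hr. apply filter_and; [apply (open_gt 0 r) | apply (open_lt (1 + d) r)]; lra. }
  assert (E1 : forall r, 0 < r < 1 + d -> Derive u r = D1 r).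
  { intros r Hr. apply is_derive_unique. apply H; auto. }
  assert (G2 : forall r, 0 < r < 1 + d -> is_derive (Derive u) r (D2 r)).
  { intros r Hr. apply (is_derive_ext_loc D1); [| apply H; auto].
    generalize (Hloc r Hr). apply filter_imp. intros s Hs. symmetry. auto. }
  assert (E2 : forall r, 0 < r < 1 + d -> Derive_n u 2 r = D2 r).
  { intros r Hr. apply is_derive_unique. apply G2; auto. }
  assert (Hc : forall r j, 0 < r < 1 + d -> (j <= 2)%nat -> continuous (Derive_n u j) r).
  { intros r j Hr Hj. destruct j as [| [| [| j]]]; [| | | lia].
    - apply (ex_derive_continuous u). exists (D1 r). apply H; auto.
    - apply (ex_derive_continuous (Derive u)). eexists. apply G2; auto.
    - eapply continuous_ext_loc; [| apply H; auto].
      generalize (Hloc r Hr). apply filter_imp. intros s Hs. symmetry. auto. }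
  assert (Hleft : forall j, (j <= 2)%nat ->
    filterlim (Derive_n u j) (at_left 1) (locally (Derive_n u j 1))).
  { intros j Hj. apply (filterlim_filter_le_1 (F := locally 1) (Derive_n u j)).
    - apply filter_le_within.
    - apply (Hc 1 j); auto. lra. }
  split; [| split].
  - intros r Hr. split; [| apply Hc; [lra | lia]].
    intros j Hj. destruct j as [| [| [| j]]]; [exact Logic.I | | | lia].
    + exists (D1 r). apply H. lra.
    + exists (D2 r). apply G2. lra.
  - apply (Hleft 0%nat). lia.
  - intros j Hj. eexists. apply Hleft. auto.
Qed.

(** Here [w] is minus the flux. As w > 0, u' never vanishes, so the degenerate factor |u'|^beta is
    harmless and [u] is twice continuously differentiable. The cut [Rmax (u r) 0] keeps the system
    meaningful beyond 1, where [u] is negative. *)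
Lemma singular_solution_of_system (alpha beta gamma m lambda d : R) (f u w : R -> R) :
  m = beta + 1 -> 1 <= m -> 0 < d -> (forall x, continuous (fun x => f (Rmax x 0)) x) ->
  (forall r, 0 < r < 1 + d ->
     is_derive u r (- (Rpower r (- alpha / m) * Rpower (w r) (1 / m))) /\
     is_derive w r (lambda * (Rpower r gamma * exp (f (Rmax (u r) 0)))) /\ 0 < w r) ->
  (forall r, 0 < r < 1 -> 0 < u r) -> u 1 = 0 ->
  filterlim u (at_right 0) (Rbar_locally p_infty) ->
  singular_solution alpha beta gamma lambda f u.
Proof.
  intros Em Hm Hd Hf H Hpos Hu1 Hlim.
  set (D1 := fun r => - (Rpower r (- alpha / m) * Rpower (w r) (1 / m))).
  set (w' := fun r => lambda * (Rpower r gamma * exp (f (Rmax (u r) 0)))).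
  set (D2 := fun r => D1 r * (- alpha / m * / r + 1 / m * (w' r * / w r))).
  assert (HD2 : forall r, 0 < r < 1 + d -> is_derive D1 r (D2 r)).
  { intros r Hr. destruct (H r Hr) as (_ & Hw & Pw).
    unfold D2, D1, w', Rpower. auto_derive.
    - repeat split; try lra. eexists; exact Hw.
    - subst_derive Hw. unfold Rpower. field. lra. }
  assert (Hcr : forall r, 0 < r -> continuous (fun r => / r) r).
  { intros r Hr. apply (ex_derive_continuous (fun r : R => / r)). auto_derive. lra. }
  assert (HD2c : forall r, 0 < r < 1 + d -> continuous D2 r).
  { intros r Hr. destruct (H r Hr) as (Hu & Hw & Pw).
    assert (Cu : continuous u r) by (apply (ex_derive_continuous u); eexists; exact Hu).
    assert (Cw : continuous w r) by (apply (ex_derive_continuous w); eexists; exact Hw).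
    unfold D2. apply (continuous_mult D1).
    - apply (ex_derive_continuous D1). eexists. apply HD2; auto.
    - apply (continuous_plus (fun r => - alpha / m * / r) (fun r => 1 / m * (w' r * / w r))).
      + apply (continuous_scal_r (- alpha / m) (fun r => / r)). apply Hcr. lra.
      + apply (continuous_scal_r (1 / m) (fun r => w' r * / w r)).
        apply (continuous_mult w' (fun r => / w r)).
        * unfold w'. apply (continuous_scal_r lambda (fun r => Rpower r gamma * exp (f (Rmax (u r) 0)))).
          apply (continuous_mult (fun r => Rpower r gamma) (fun r => exp (f (Rmax (u r) 0)))).
          -- apply (ex_derive_continuous (fun r => Rpower r gamma)). eexists. apply is_derive_Rpower. lra.
          -- apply (continuous_comp (fun r => f (Rmax (u r) 0)) exp); [| apply continuous_exp].
             apply (continuous_comp u (fun x => f (Rmax x 0))); [exact Cu | apply Hf].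
        * apply (continuous_comp w (fun x => / x)); [exact Cw | apply Hcr; auto]. }
  assert (Hflux : forall r, 0 < r < 1 + d -> flux alpha beta u r = - w r).
  { intros r Hr. destruct (H r Hr) as (Hu & _ & Pw). unfold flux.
    rewrite (is_derive_unique _ _ _ Hu).
    set (D := Rpower r (- alpha / m) * Rpower (w r) (1 / m)).
    assert (PD : 0 < D) by (apply Rmult_lt_0_compat; apply Rpower_pos).
    unfold abs_pow. destruct Req_EM_T as [Z | _]; [lra |].
    rewrite Rabs_Ropp, Rabs_pos_eq by lra.
    replace (Rpower r alpha * Rpower D beta * - D) with (- (Rpower r alpha * (Rpower D beta * D))) by ring.
    f_equal. rewrite <- (Rpower_1 D PD) at 2. rewrite <- Rpower_plus, <- Em.
    unfold D. rewrite <- Rpower_mult_distr by apply Rpower_pos.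
    rewrite !Rpower_mult, <- Rmult_assoc, <- Rpower_plus.
    replace (alpha + - alpha / m * m) with 0 by (field; lra).
    replace (1 / m * m) with 1 by (field; lra).
    rewrite Rpower_O, Rpower_1 by lra. ring. }
  assert (Hdf : forall r, 0 < r < 1 -> is_derive (flux alpha beta u) r (- w' r)).
  { intros r Hr. apply (is_derive_ext_loc (fun r => - w r)).
    - assert (Hl : locally r (fun s => 0 < s < 1 + d)).
      { apply filter_and; [apply (open_gt 0 r) | apply (open_lt (1 + d) r)]; lra. }
      generalize Hl. apply filter_imp. intros s Hs. symmetry. auto.
    - apply (is_derive_opp w). apply H. lra. }
  split; [| split; [| split; [exact Hpos | split; [exact Hu1 | exact Hlim]]]].
  - apply (Ck2_of_derivatives u D1 D2 d Hd). intros r Hr.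
    split; [apply H; auto | split; [apply HD2; auto | apply HD2c; auto]].
  - intros r Hr. split; [eexists; apply Hdf; auto |].
    unfold Lop. rewrite (is_derive_unique _ _ _ (Hdf r Hr)). unfold w'.
    specialize (Hpos r Hr). rewrite Rmax_left by lra.
    replace (Rpower r (- gamma) * - (lambda * (Rpower r gamma * exp (f (u r)))))
      with (- lambda * (Rpower r (- gamma) * Rpower r gamma) * exp (f (u r))) by ring.
    rewrite <- Rpower_plus. replace (- gamma + gamma) with 0 by ring. rewrite Rpower_O by lra. ring.
Qed.

(** Under r -> rs r the flux r^alpha |u'|^m picks up rs^(m-alpha). Its derivative gains one more
    factor rs and r^gamma gives rs^gamma, in total rs^theta, which is the new lambda. *)
Lemma system_rescaling (alpha gamma m theta rs R1 : R) (phi u w : R -> R) :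
  0 < m -> theta = gamma + 1 - alpha + m -> 0 < rs ->
  (forall r, 0 < r < R1 ->
     is_derive u r (- (Rpower r (- alpha / m) * Rpower (w r) (1 / m))) /\
     is_derive w r (Rpower r gamma * phi (u r)) /\ 0 < w r) ->
  let U := fun r => u (rs * r) in
  let W := fun r => Rpower rs (m - alpha) * w (rs * r) in
  forall r, 0 < r < R1 / rs ->
     is_derive U r (- (Rpower r (- alpha / m) * Rpower (W r) (1 / m))) /\
     is_derive W r (Rpower rs theta * (Rpower r gamma * phi (U r))) /\ 0 < W r.
Proof.
  intros Hm Eth Hrs H U W r Hr.
  assert (Hr' : 0 < rs * r < R1).
  { split; [apply Rmult_lt_0_compat; lra |].
    replace R1 with (rs * (R1 / rs)) by (field; lra). apply Rmult_lt_compat_l; lra. }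
  destruct (H _ Hr') as (Hu & Hw & Pw). unfold U, W.
  assert (P := Rpower_pos rs (m - alpha)).
  split; [| split; [| nra]].
  - evar_last; [apply (is_derive_comp u (fun r => rs * r)); [exact Hu |] |].
    + apply is_derive_scal. apply is_derive_id.
    + unfold scal, one; simpl. unfold mult; simpl.
      rewrite <- !Rpower_mult_distr, !Rpower_mult by (auto; lra).
      replace ((m - alpha) * (1 / m)) with (1 + - alpha / m) by (field; lra).
      rewrite Rpower_plus, Rpower_1 by auto. ring.
  - evar_last; [apply is_derive_scal; apply (is_derive_comp w (fun r => rs * r)); [exact Hw |] |].
    + apply is_derive_scal. apply is_derive_id.
    + unfold scal, one; simpl. unfold mult; simpl.
      rewrite <- !Rpower_mult_distr by (auto; lra).
      replace theta with ((m - alpha) + (1 + gamma)) by lra.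
      rewrite !Rpower_plus, Rpower_1 by auto. ring.
Qed.

(** Undoes the change of variables: [w] is r^alpha |u'|^m written through its logarithm. The shift
    [kappa] = ln(theta^m (alpha - m)) absorbs the constants of the equation, so that lambda = 1
    here. *)
Lemma radial_system_of_profile (alpha gamma m theta b T1 kappa : R) (f g p p1 x v z : R -> R) :
  0 < m -> m < alpha -> 0 < theta -> theta = gamma + 1 - alpha + m ->
  m * b = (alpha - m) / theta -> kappa = m * ln theta + ln (alpha - m) ->
  (forall t, f 0 < t -> 0 < g t /\ f (g t) = t /\ is_derive g t (p t) /\ 0 < p t /\ is_derive p t (p1 t)) ->
  (forall t, T1 <= t -> f 0 < x t /\ is_derive x t (exp (z t)) /\
     is_derive z t (- b * (exp (v t) - 1) - p1 (x t) / p (x t) * exp (z t)) /\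
     x t = t + m * ln (p (x t)) + v t + m * z t) ->
  let T := fun r => - theta * ln r + kappa in
  let u := fun r => g (x (T r)) in
  let w := fun r => exp (m * ln theta + (alpha - m) * ln r + m * (ln (p (x (T r))) + z (T r))) in
  forall r, 0 < r -> T1 <= T r ->
    is_derive u r (- (Rpower r (- alpha / m) * Rpower (w r) (1 / m))) /\
    is_derive w r (Rpower r gamma * exp (f (u r))) /\ 0 < w r /\ 0 < u r.
Proof.
  intros Hm Ha Hth Eth Eb Ek Hg Hx T u w r Hr HT.
  destruct (Hx _ HT) as (X0 & Dx & Dz & Ex).
  destruct (Hg _ X0) as (G0 & G1 & Dg & Pp & Dp).
  assert (DT : is_derive T r (- theta / r)).
  { unfold T. auto_derive; [auto | field; lra]. }
  assert (Dxr : is_derive (fun r => x (T r)) r (- theta / r * exp (z (T r)))).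
  { apply (is_derive_comp x T); [exact Dx | exact DT]. }
  assert (Dzr : is_derive (fun r => z (T r)) r
     (- theta / r * (- b * (exp (v (T r)) - 1) - p1 (x (T r)) / p (x (T r)) * exp (z (T r))))).
  { apply (is_derive_comp z T); [exact Dz | exact DT]. }
  assert (Dl := is_derive_ln_comp p p1 _ Pp Dp).
  assert (Dlr : is_derive (fun r => ln (p (x (T r)))) r
     (- theta / r * exp (z (T r)) * (p1 (x (T r)) / p (x (T r))))).
  { apply (is_derive_comp (fun t => ln (p t)) (fun r => x (T r))); [exact Dl | exact Dxr]. }
  split; [| split; [| split; [apply exp_pos | exact G0]]].
  - unfold u. evar_last; [apply (is_derive_comp g (fun r => x (T r))); [exact Dg | exact Dxr] |].
    unfold scal; simpl. unfold mult; simpl.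
    unfold w, Rpower. rewrite ln_exp, <- exp_plus.
    replace (- alpha / m * ln r + 1 / m * (m * ln theta + (alpha - m) * ln r + m * (ln (p (x (T r))) + z (T r))))
      with (ln theta + (- ln r + (ln (p (x (T r))) + z (T r)))) by (field; lra).
    rewrite !exp_plus, exp_Ropp, !exp_ln by auto. field. lra.
  - unfold w. evar_last.
    + apply (is_derive_comp exp
        (fun r => m * ln theta + (alpha - m) * ln r + m * (ln (p (x (T r))) + z (T r)))).
      * apply is_derive_exp.
      * apply (is_derive_plus (fun r => m * ln theta + (alpha - m) * ln r)
                 (fun r => m * (ln (p (x (T r))) + z (T r)))).
        -- apply (is_derive_plus (fun r => m * ln theta) (fun r => (alpha - m) * ln r)).
           ++ apply (is_derive_const (K := R_AbsRing) (V := R_NormedModule)).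
           ++ apply is_derive_scal. apply is_derive_ln. auto.
        -- apply is_derive_scal.
           apply (is_derive_plus (fun r => ln (p (x (T r)))) (fun r => z (T r))); eassumption.
    + unfold scal, plus, zero; simpl. unfold mult; simpl.
      unfold u. rewrite G1.
      set (lp := ln (p (x (T r)))) in *. set (zz := z (T r)) in *. set (vv := v (T r)) in *.
      set (ww := exp (m * ln theta + (alpha - m) * ln r + m * (lp + zz))).
      (* In the logarithmic derivative of w the terms with p1/p cancel, and theta m b = alpha - m
         merges the rest into (alpha - m) exp v / r. *)
      match goal with |- ?S * ww = _ => replace S with ((alpha - m) * exp vv / r) end.
      * replace (Rpower r gamma * exp (x (T r))) with (exp (gamma * ln r + x (T r)))
          by (rewrite exp_plus; reflexivity).
        rewrite Ex. unfold T at 1. rewrite Ek.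
        replace (gamma * ln r + (- theta * ln r + (m * ln theta + ln (alpha - m)) + m * lp + vv + m * zz))
          with (ln (alpha - m) + (vv + (- ln r + (m * ln theta + (alpha - m) * ln r + m * (lp + zz)))))
          by (rewrite Eth; ring).
        rewrite (exp_plus (ln (alpha - m))), (exp_plus vv), (exp_plus (- ln r)), exp_Ropp, !exp_ln by lra.
        fold ww. field. lra.
      * replace (alpha - m) with (theta * (m * b)) by (rewrite Eb; field; lra). field. lra.
Qed.

(** * Construction of the singular solution and of lambda *)

Theorem theorem1p1 (alpha beta gamma : R) (f g : R -> R)
  (* g = f^{-1} : [f 0, +oo) -> [0, +oo) *)
  (Hgf : forall u, 0 <= u -> g (f u) = u)
  (Hfg : forall t, f 0 <= t -> 0 <= g t /\ f (g t) = t)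
  (* (A1) *)
  (HA1reg : Ck_on_Ico0_infty 4 f)
  (HA1pos : (forall x, 0 < x -> 0 < Derive f x) /\
            exists l, 0 < l /\ filterlim (Derive f) (at_right 0) (locally l))
  (HA1lim : is_lim f p_infty p_infty)
  (* (A2) *)
  (HA2a : is_lim (Derive_n g 2) p_infty 0)
  (HA2b : forall eps : R -> R, bigO_infty eps (Derive_n g 2) ->
            is_lim (fun t => f (g t + eps t) / t) p_infty 1)
  (* (A3) *)
  (HA3 : forall h : R -> R, little_o_id h ->
            is_lim (fun t => Derive g t / Derive g (t + h t)) p_infty 1)
  (* (A4) *)
  (HA4 : is_lim (fun t => Derive_n g 2 t / Derive g t * ln (Derive g t)) p_infty 0)
  (* (A5)(a) *)
  (HA5a : (forall n : nat, (n <= 2)%nat ->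
             bigO_infty (fun t => Derive_n g 3 t * (ln (Derive g t)) ^ n) (Derive_n g 2)) /\
          bigO_infty (fun t => Derive_n g 4 t * ln (Derive g t)) (Derive_n g 2))
  (* (A5)(b) *)
  (HA5b : (exists C T : R, forall t s, T <= t -> t <= s ->
             Rabs (Derive_n g 2 s) <= C * Rabs (Derive_n g 2 t)) /\
          (forall h : R -> R, little_o_id h ->
             bigO_infty (fun t => Derive_n g 2 (t + h t)) (Derive_n g 2)))
  (* (A6) *)
  (HA6 : beta + 1 < alpha /\ 0 <= beta /\ 0 < gamma + 2 + beta - alpha) :
  let theta := gamma + 2 + beta - alpha in
  exists (lambda : R) (u : R -> R),
    0 < lambda /\
    singular_solution alpha beta gamma lambda f u /\
    exists C delta : R, 0 < delta /\
      forall r, 0 < r < delta ->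
        let tau := ln ((beta + 1) / (lambda * Rpower r theta)) in
        let Z := ln (Rpower theta (beta + 1) * (alpha - beta - 1)) - ln lambda
                 - theta * ln r
                 + (beta + 1) * ln (Derive g tau
                                    + (beta + 1) * Derive_n g 2 tau * ln (Derive g tau)) in
        Rabs (u r - g Z) <= C * Rabs (Derive_n g 2 (- theta * ln r)).
Proof.
  intros theta.
  destruct HA6 as (Ha & Hb & Hth). fold theta in Hth.
  destruct HA1pos as [Hfpos _].
  set (m := beta + 1).
  assert (Hm : 1 <= m) by (unfold m; lra).
  assert (Ham : m < alpha) by (unfold m; lra).
  assert (Eth : theta = gamma + 1 - alpha + m) by (unfold theta, m; ring).
  assert (Hreg := inverse_regularity f g Hgf Hfg HA1reg Hfpos).
  destruct (extension_regularity f HA1reg Hfpos) as [Hmono Hlip].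
  assert (Hbig0 : bigO_infty (Derive_n g 3) (Derive_n g 2)).
  { destruct (proj1 HA5a 0%nat ltac:(auto)) as (C & T & HT). exists C, T. intros t Ht.
    specialize (HT t Ht). simpl pow in HT. rewrite Rmult_1_r in HT. exact HT. }
  assert (Htame : tame (Derive g) (Derive_n g 2) (Derive_n g 3) (f 0)).
  { destruct HA5b as [H5 H6].
    split; [intros t Ht; apply Hreg, Ht | repeat (split; [assumption |]); exact H6]. }
  set (a := (alpha - m) / theta).
  assert (Hapos : 0 < a) by (apply Rdiv_lt_0_compat; lra).
  assert (Hbpos : 0 < a / m) by (apply Rdiv_lt_0_compat; lra).
  assert (Emb : m * (a / m) = a) by (field; lra).
  destruct (profile_solution _ _ _ _ a (a / m) m Htame Hapos Hbpos ltac:(lra) Emb)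
    as (T1 & C & x & v & z & HC & Hxo & Hx).
  set (kappa := ln (Rpower theta m * (alpha - beta - 1))).
  assert (Ek : kappa = m * ln theta + ln (alpha - m)).
  { unfold kappa. rewrite ln_mult by (try apply Rpower_pos; lra).
    unfold Rpower. rewrite ln_exp. f_equal. f_equal. unfold m. ring. }
  assert (Hnear := radial_system_of_profile alpha gamma m theta (a / m) T1 kappa f g
    (Derive g) (Derive_n g 2) x v z ltac:(lra) Ham Hth Eth Emb Ek).
  specialize (Hnear (fun t Ht => let '(conj A (conj B (conj D (conj E _)))) := Hreg t Ht in
    conj A (conj (proj2 (Hfg t (Rlt_le _ _ Ht))) (conj B (conj D E))))).
  specialize (Hnear (fun t Ht => let '(conj A (conj B (conj D (conj E _)))) := Hx t Ht in
    conj A (conj B (conj D E)))).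
  cbv zeta in Hnear.
  set (T := fun r => - theta * ln r + kappa) in *.
  set (un := fun r => g (x (T r))) in *.
  set (wn := fun r => exp (m * ln theta + (alpha - m) * ln r + m * (ln (Derive g (x (T r))) + z (T r)))) in *.
  assert (HTB : forall B r, 0 < r -> r <= exp ((kappa - B) / theta) -> B <= T r).
  { intros B r Hr HrB. unfold T. apply ln_le in HrB; [| auto]. rewrite ln_exp in HrB.
    assert (theta * ln r <= kappa - B).
    { replace (kappa - B) with (theta * ((kappa - B) / theta)) by (field; lra).
      apply Rmult_le_compat_l; lra. }
    lra. }
  (* This radius satisfies T r0 = T1: the profile gives the solution on (0, r0], and the initial
     value problem continues it from there. *)
  set (r0 := exp ((kappa - T1) / theta)).
  assert (Hr0 : 0 < r0) by apply exp_pos.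
  set (phi := fun u => exp (f (Rmax u 0))).
  assert (Hphi : forall A, exists L, 0 < L /\ forall x y, x <= A -> y <= A ->
    Rabs (phi x - phi y) <= L * Rabs (x - y)).
  { intros A. destruct (Hlip A) as (L & HL & HLip).
    exists (exp (f (Rmax A 0)) * L). split; [apply Rmult_lt_0_compat; [apply exp_pos | auto] |].
    intros y y' Hy Hy'. rewrite Rmult_assoc. unfold phi.
    eapply Rle_trans.
    - apply (lipschitz_of_derive exp exp (f (Rmax y' 0)) (f (Rmax y 0)) (exp (f (Rmax A 0)))).
      + intros s _. apply is_derive_exp.
      + intros s Hs. rewrite Rabs_pos_eq by (left; apply exp_pos). apply exp_le_compat.
        eapply Rle_trans; [apply Hs |]. apply Rmax_lub; apply Hmono; auto.
    - apply Rmult_le_compat_l; [left; apply exp_pos | apply HLip; auto]. }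
  destruct (Hnear r0 Hr0 (HTB T1 r0 Hr0 (Rle_refl _))) as (_ & _ & Hw0 & Hu0).
  destruct (continuation_to_zero phi alpha gamma m theta (exp (f 0)) r0 (un r0) (wn r0))
    as (rs & R1 & uc & wc & Hrs & Eu & Ew & Hode & Huz & Hup); auto.
  { apply exp_pos. }
  { intros s. apply exp_le_compat. rewrite <- (Rmax_left 0 0) at 1 by lra.
    destruct (Rle_lt_dec 0 s) as [h | h]; [apply Hmono; auto |].
    rewrite (Rmax_right s 0), (Rmax_left 0 0) by lra. lra. }
  { unfold theta in Hth. lra. }
  set (u := fun r => if Rle_dec r r0 then un r else uc r).
  set (w := fun r => if Rle_dec r r0 then wn r else wc r).
  assert (Eun : forall r, r <= r0 -> u r = un r /\ w r = wn r).
  { intros r Hr. unfold u, w. destruct Rle_dec; [auto | lra]. }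
  assert (Euc : forall r, r0 <= r -> u r = uc r /\ w r = wc r).
  { intros r Hr. unfold u, w. destruct Rle_dec; [| auto]. replace r with r0 by lra. auto. }
  assert (Hnear' : forall r, 0 < r <= r0 ->
    is_derive un r (- (Rpower r (- alpha / m) * Rpower (w r) (1 / m))) /\
    is_derive wn r (Rpower r gamma * phi (u r)) /\ 0 < w r /\ 0 < u r).
  { intros r Hr. destruct (Hnear r (proj1 Hr) (HTB T1 r (proj1 Hr) (proj2 Hr))) as (A1 & A2 & A3 & A4).
    destruct (Eun r (proj2 Hr)) as [-> ->]. unfold phi. rewrite Rmax_left by lra. auto. }
  assert (Hsys : forall r, 0 < r < R1 ->
     is_derive u r (- (Rpower r (- alpha / m) * Rpower (w r) (1 / m))) /\
     is_derive w r (Rpower r gamma * phi (u r)) /\ 0 < w r).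
  { intros r Hr. split; [| split].
    - apply (is_derive_glue_ode un uc
        (fun r => - (Rpower r (- alpha / m) * Rpower (w r) (1 / m))) 0 r0 R1); auto.
      + intros s Hs. apply Hnear'; lra.
      + intros s Hs. destruct (Euc s (proj1 Hs)) as [_ ->]. apply Hode; lra.
    - apply (is_derive_glue_ode wn wc (fun r => Rpower r gamma * phi (u r)) 0 r0 R1); auto.
      + intros s Hs. apply Hnear'; lra.
      + intros s Hs. destruct (Euc s (proj1 Hs)) as [-> _]. apply Hode; lra.
    - destruct (Rle_lt_dec r r0) as [h | h]; [apply Hnear'; lra |].
      destruct (Euc r) as [_ ->]; [lra |]. apply Hode; lra. }
  assert (Hrs0 : 0 < rs) by lra.
  assert (Hresc := system_rescaling alpha gamma m theta rs R1 phi u w ltac:(lra) Eth Hrs0 Hsys).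
  cbv zeta in Hresc.
  set (lambda := Rpower rs theta) in *.
  assert (Hlam : 0 < lambda) by apply Rpower_pos.
  (* Hence T (rs r) = -theta ln r + kappa - ln lambda: the dilation is a constant shift in the
     logarithmic variable. *)
  assert (Elam : ln lambda = theta * ln rs) by (unfold lambda, Rpower; apply ln_exp).
  set (U := fun r => u (rs * r)) in *.
  assert (HR1 : 1 < R1 / rs).
  { apply (Rmult_lt_reg_l rs); [auto |]. replace (rs * (R1 / rs)) with R1 by (field; lra). lra. }
  exists lambda, U. split; [exact Hlam | split].
  - apply (singular_solution_of_system alpha beta gamma m lambda (R1 / rs - 1) f U
      (fun r => Rpower rs (m - alpha) * w (rs * r))); auto; [lra | | | | | ].
    + intros s. apply continuous_eps. intros eps Heps.
      destruct (Hlip (s + 1)) as (L & HL & HLip).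
      exists (Rmin 1 (eps / L)).
      assert (B1 := Rmin_l 1 (eps / L)). assert (B2 := Rmin_r 1 (eps / L)).
      split; [apply Rmin_glb_lt; [lra | apply Rdiv_lt_0_compat; lra] |].
      intros s' Hs'. assert (B3 : Rabs (s' - s) < 1) by lra. apply Rabs_def2 in B3.
      eapply Rle_lt_trans; [apply HLip; lra |].
      replace eps with (L * (eps / L)) by (field; lra). apply Rmult_lt_compat_l; lra.
    + intros r Hr. apply Hresc. lra.
    + intros r Hr. unfold U.
      assert (B : 0 < rs * r < rs).
      { split; [apply Rmult_lt_0_compat; lra |]. rewrite <- (Rmult_1_r rs) at 2.
        apply Rmult_lt_compat_l; lra. }
      destruct (Rle_lt_dec (rs * r) r0) as [h | h]; [apply Hnear'; lra |].
      destruct (Euc (rs * r)) as [-> _]; [lra |]. apply Hup; lra.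
    + unfold U. rewrite Rmult_1_r. destruct (Euc rs) as [-> _]; [lra | auto].
    + intros P [M HM].
      destruct (little_o_elim _ Hxo (/ 2) ltac:(lra)) as (Tl & HTl0 & HTl).
      (* Once T >= B, the value y = x(T) is at least T/2 > f(max(M, 0)). Since f(g y) = y and f is
         monotone, g y <= M is impossible. *)
      set (B := Rmax T1 (Rmax Tl (2 * f (Rmax M 0) + 1))).
      assert (B1 : T1 <= B) by apply Rmax_l.
      assert (B2 : Tl <= B) by (eapply Rle_trans; [apply Rmax_l | apply Rmax_r]).
      assert (B3 : 2 * f (Rmax M 0) + 1 <= B) by (eapply Rle_trans; [apply Rmax_r | apply Rmax_r]).
      set (d := Rmin r0 (exp ((kappa - B) / theta)) / rs).
      assert (Hd : 0 < d).
      { apply Rdiv_lt_0_compat; [apply Rmin_glb_lt; auto using exp_pos | auto]. }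
      exists (mkposreal d Hd). intros r Hr Hr_pos.
      apply HM.
      assert (Hrd : r < d).
      { unfold ball in Hr; simpl in Hr. unfold AbsRing_ball, abs, minus, plus, opp in Hr; simpl in Hr.
        apply Rabs_def2 in Hr. lra. }
      assert (Hrr : rs * r < Rmin r0 (exp ((kappa - B) / theta))).
      { replace (Rmin r0 (exp ((kappa - B) / theta))) with (rs * d) by (unfold d; field; lra).
        apply Rmult_lt_compat_l; auto. }
      assert (H1 := Rlt_le_trans _ _ _ Hrr (Rmin_l _ _)).
      assert (H2 := Rlt_le_trans _ _ _ Hrr (Rmin_r _ _)).
      assert (H0 : 0 < rs * r) by (apply Rmult_lt_0_compat; auto).
      assert (HT := HTB B (rs * r) H0 ltac:(lra)).
      unfold U. rewrite (proj1 (Eun (rs * r) ltac:(lra))). unfold un.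
      specialize (HTl (T (rs * r)) ltac:(lra)). apply Rabs_le_between in HTl.
      destruct (Hx (T (rs * r)) ltac:(lra)) as (X0 & _).
      set (y := x (T (rs * r))) in *.
      destruct (Rlt_le_dec M (g y)) as [h | h]; [exact h | exfalso].
      apply Hmono in h. destruct (Hreg y X0) as (Gy & _).
      rewrite (Rmax_left (g y) 0), (proj2 (Hfg y (Rlt_le _ _ X0))) in h by lra. lra.
  (* With s = -theta ln r, the constants are [k1], the shift due to the dilation, and [k2], for
     which s + k2 is the tau of the statement. *)
  - destruct (profile_asymptotics g (Derive g) (Derive_n g 2) (Derive_n g 3) (f 0) m
      (kappa - ln lambda) (ln m - ln lambda) C T1 x v z) as (C' & S & HS); auto.
    + apply (proj1 HA5a 2%nat). auto.
    + intros t Ht. apply Hreg, Ht.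
    + lra.
    + intros t Ht. destruct (Hx t Ht) as (_ & _ & _ & A & B & D). auto.
    + set (d := Rmin (r0 / rs) (exp (- S / theta))).
      exists C', d. split.
      { apply Rmin_glb_lt; [apply Rdiv_lt_0_compat; auto | apply exp_pos]. }
      intros r Hr. cbv zeta.
      assert (H1 := Rlt_le_trans _ _ _ (proj2 Hr) (Rmin_l _ _)).
      assert (H2 := Rlt_le_trans _ _ _ (proj2 Hr) (Rmin_r _ _)).
      assert (H0 : 0 < rs * r) by (apply Rmult_lt_0_compat; lra).
      assert (H1' : rs * r <= r0).
      { replace r0 with (rs * (r0 / rs)) by (field; lra). apply Rmult_le_compat_l; lra. }
      assert (Hs : S <= - theta * ln r).
      { apply ln_increasing in H2; [| lra]. rewrite ln_exp in H2.
        assert (theta * ln r <= theta * (- S / theta)) by (apply Rmult_le_compat_l; lra).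
        replace (theta * (- S / theta)) with (- S) in H by (field; lra). lra. }
      specialize (HS _ Hs).
      unfold U. rewrite (proj1 (Eun (rs * r) H1')). unfold un.
      replace (T (rs * r)) with (- theta * ln r + (kappa - ln lambda))
        by (unfold T; rewrite ln_mult, Elam by lra; ring).
      replace (ln (m / (lambda * Rpower r theta))) with (- theta * ln r + (ln m - ln lambda)).
      * replace (kappa - ln lambda - theta * ln r) with (- theta * ln r + (kappa - ln lambda)) by ring.
        exact HS.
      * assert (Pr := Rpower_pos r theta). rewrite ln_div, ln_mult by (auto; nra).
        unfold Rpower at 1. rewrite ln_exp. ring.
Qed.
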